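(* Let $\mathbb{K}$ be an algebraically closed field of characteristic $p$, where $p=0$ or $p\geq 5$. Let $(\Lambda_1,\Lambda_2,\Lambda_3)$ be a dual $3$-net of order $n$ in the projective plane $PG(2,\mathbb{K})$ which realizes a group $G$ (so $|G|=n$), and assume that $n<p$ whenever $p>0$. Then the following hold. (I) If $G\cong C_3\times C_3$ or $G\cong C_2\times C_4$, then $(\Lambda_1,\Lambda_2,\Lambda_3)$ is algebraic. (II) If $p=0$, then the alternating group $\mathrm{Alt}_4$ cannot be realized; that is, if $\mathbb{K}$ has characteristic $0$, there is no dual $3$-net in $PG(2,\mathbb{K})$ realizing $\mathrm{Alt}_4$.
   Context: $C_m$ denotes the cyclic group of order $m$. A dual $3$-net of order $n$ in $PG(2,\mathbb{K})$ is a triple $(\Lambda_1,\Lambda_2,\Lambda_3)$ of pairwise disjoint point sets of $PG(2,\mathbb{K})$, each of size $n$ (called components), such that every line meeting two distinct components meets each component in precisely one point. The dual $3$-net realizes a group $(G,\cdot)$ if there are bijections $\alpha:G\to\Lambda_1$, $\beta:G\to\Lambda_2$, $\gamma:G\to\Lambda_3$ such that for all $a,b,c\in G$: $a\cdot b=c$ if and only if the points $\alpha(a),\beta(b),\gamma(c)$ are collinear. A dual $3$-net realizing a group is algebraic if all points of $\Lambda_1\cup\Lambda_2\cup\Lambda_3$ lie on a plane cubic, i.e. on the zero set in $PG(2,\mathbb{K})$ of a nonzero homogeneous polynomial of degree $3$ in three variables (the cubic may be reducible). *)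

(* Defs.v *)
From HB Require Import structures.
From mathcomp Require Import all_boot all_fingroup all_algebra all_solvable.
From mathcomp Require Import finmap mpoly.

Set Implicit Arguments.
Unset Strict Implicit.
Unset Printing Implicit Defensive.

Import GRing.Theory.
Local Open Scope ring_scope.

(* PG(2,K) is the lattice of subspaces of K^3: points have dimension 1 and    *)
(* lines have dimension 2, incidence being inclusion.                         *)
Record point (K : fieldType) := Point {
  point_space :> {vspace 'rV[K]_3};
  dim_point : \dim point_space == 1%N
}.
Record line (K : fieldType) := Line {
  line_space :> {vspace 'rV[K]_3};
  dim_line : \dim line_space == 2%N
}.

HB.instance Definition _ (K : fieldType) := [isSub for @point_space K].
HB.instance Definition _ (K : fieldType) := [Choice of point K by <:].
HB.instance Definition _ (K : fieldType) := [isSub for @line_space K].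
HB.instance Definition _ (K : fieldType) := [Choice of line K by <:].

Definition incident (K : fieldType) (P : point K) (l : line K) : bool :=
  (P <= l)%VS.

Definition collinear (K : fieldType) (P Q R : point K) : Prop :=
  exists l : line K, [/\ incident P l, incident Q l & incident R l].

Definition meets (K : fieldType) (l : line K) (A : {fset point K}) : Prop :=
  exists2 P, P \in A & incident P l.

Definition dual_3net (K : fieldType) (n : nat) (L : 'I_3 -> {fset point K}) :
    Prop :=
  [/\ forall i, #|` L i| = n,
      forall i j, i != j -> [disjoint L i & L j]%fset
    & forall (l : line K) i j, i != j -> meets l (L i) -> meets l (L j) ->
        forall k, exists! P, P \in L k /\ incident P l].

Definition bij_onto (K : fieldType) (gT : finGroupType) (G : {group gT})
    (f : gT -> point K) (A : {fset point K}) : Prop :=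
  {in G &, injective f} /\ [fset f x | x in G]%fset = A.

Definition realizes (K : fieldType) (L : 'I_3 -> {fset point K})
    (gT : finGroupType) (G : {group gT}) : Prop :=
  exists alpha beta gamma : gT -> point K,
    [/\ bij_onto G alpha (L 0), bij_onto G beta (L 1), bij_onto G gamma (L 2)
      & {in G & &, forall a b c,
          (a * b)%g = c <-> collinear (alpha a) (beta b) (gamma c)}].

(* As F is homogeneous, its vanishing at one nonzero representative v of P    *)
(* is equivalent to its vanishing on all of P.                                *)
Definition on_cubic (K : fieldType) (F : {mpoly K[3]}) (P : point K) : Prop :=
  forall v : 'rV[K]_3, v \in point_space P -> F.@[v 0] = 0.

Definition algebraic (K : fieldType) (L : 'I_3 -> {fset point K}) : Prop :=
  exists F : {mpoly K[3]},
    [/\ F != 0, F \is 3.-homog & forall i P, P \in L i -> on_cubic F P].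

Definition has_char (K : fieldType) (p : nat) : Prop :=
  if p is 0 then [pchar K] =i pred0 else p \in [pchar K].

(* Main.v *)
Require Import Defs.
From mathcomp Require Import all_boot all_fingroup all_algebra all_solvable.
From mathcomp Require Import finmap mpoly.
From mathcomp Require Import ring.

(* Put homogeneous coordinates on the points; collinearity becomes the vanishing
   of a determinant. By the Cayley-Bacharach theorem, a cubic through eight of the
   nine points of a 3 x 3 grid formed by net lines passes through the ninth one.
   For C_2 x C_4, a cubic through nine well chosen points of the net is
   forced by such grids through all the others.

   For C_3 x C_3, it suffices to find a cubic through five well chosen cosets of
   0 x C_3. If one coset is not collinear, it serves as coordinate triangle, and a
   pair of matching cosets of the other two components becomes the orbits, under
   the cyclic shift of coordinates, of a vector b and of its dual, up to a
   diagonal map d. Pappus-type concurrences between two pairs, diagonalized by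
   cube roots of unity, show that for one of the three choices of two pairs the
   quotient of the two maps d is trivial; a cubic in the span of xyz,
   x^2 y + y^2 z + z^2 x and x^2 z + y^2 x + z^2 y then contains the five cosets.
   If all cosets are collinear, matching the fixed points of the projectivities
   of order 3 of the lines shows that five of them lie on a triangle.

   For Alt_4, the subgroup V_4 and a 3-cycle s give three nets over V_4, with
   components (V, V, V), (V, Vs, Vs) and (Vs, V, Vs). Each is described by the
   character table of V_4, and conjugation by s turns the comparison of the
   three descriptions into a system with the sign pattern of the quaternions,
   which is inconsistent. *)

Set Implicit Arguments.
Unset Strict Implicit.
Unset Printing Implicit Defensive.

Import GRing.Theory.
Local Open Scope ring_scope.

(** * Vectors and determinants *)

Section Vectors.
Variable K : fieldType.

(** Cubics form a space of dimension 10, so nine points can always be prescribed; this starts the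
    case of C_2 x C_4 but falls short of the fifteen points of five cosets. For C_3 x C_3 cubics
    invariant under the cyclic shift are used instead: those in the given span contain the
    coordinate triangle, and their values at [b] and at [dual b] are proportional, so that a whole
    pair of cosets costs a single linear condition. Two pairs leave a nonzero solution among the
    three coefficients, provided that both are written with the same diagonal map up to a factor (1,
    e, e^2) with e^3 = 1; this is what a trivial quotient means. The incidences between two pairs
    alone leave an exceptional case open, and only the comparison of all three pairs excludes it.
    For Alt_4 the obstacle is that four vectors in a space of dimension 3 are dependent, so
    coefficients can be compared only up to a linear relation. This relation is unique up to a
    factor and its coefficients have distinct squares, which is what the final system of equations
    contradicts. *)

Definition vec := (K * K * K)%type.

Definition lc2 (x : K) (u : vec) (y : K) (v : vec) : vec :=
  (x * u.1.1 + y * v.1.1, x * u.1.2 + y * v.1.2, x * u.2 + y * v.2).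
Definition lc3 (x : K) (u : vec) (y : K) (v : vec) (z : K) (w : vec) : vec :=
  (x * u.1.1 + y * v.1.1 + z * w.1.1, x * u.1.2 + y * v.1.2 + z * w.1.2,
   x * u.2 + y * v.2 + z * w.2).
Definition scale (x : K) (u : vec) : vec := (x * u.1.1, x * u.1.2, x * u.2).

Definition det3 (u v w : vec) : K :=
  u.1.1 * (v.1.2 * w.2 - v.2 * w.1.2) - u.1.2 * (v.1.1 * w.2 - v.2 * w.1.1)
  + u.2 * (v.1.1 * w.1.2 - v.1.2 * w.1.1).

Lemma vecP (u v : vec) :
  u.1.1 = v.1.1 -> u.1.2 = v.1.2 -> u.2 = v.2 -> u = v.
Proof. by case: u v => [[? ?] ?] [[? ?] ?] /= -> -> ->. Qed.

Lemma det3_lc2 x u y v s t :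
  det3 (lc2 x u y v) s t = x * det3 u s t + y * det3 v s t.
Proof. rewrite /det3 /=; ring. Qed.

Lemma det3_lc3 x u y v z w s t :
  det3 (lc3 x u y v z w) s t =
  x * det3 u s t + y * det3 v s t + z * det3 w s t.
Proof. rewrite /det3 /=; ring. Qed.

Lemma det3_scale x u s t : det3 (scale x u) s t = x * det3 u s t.
Proof. rewrite /det3 /=; ring. Qed.

Lemma det3C u v w : det3 u v w = - det3 v u w.
Proof. rewrite /det3; ring. Qed.

Lemma det3_rot u v w : det3 u v w = det3 v w u.
Proof. rewrite /det3; ring. Qed.

Lemma det3_uu u v : det3 u u v = 0.
Proof. rewrite /det3; ring. Qed.

Lemma det3_eq0C u v w : (det3 v u w == 0) = (det3 u v w == 0).
Proof. by rewrite (det3C u) oppr_eq0. Qed.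

Lemma vec_basis u v w z : det3 u v w != 0 ->
  z = lc3 (det3 z v w / det3 u v w) u (det3 u z w / det3 u v w) v
          (det3 u v z / det3 u v w) w.
Proof.
move=> h; have k x y : x / det3 u v w * y * det3 u v w = x * y.
  by rewrite mulrAC divfK.
by apply: vecP; apply: (mulIf h); rewrite /= !mulrDl !k /det3; ring.
Qed.

(** The vector [t] certifies that [u] and [v] are independent; in a net it is a point off the line
    joining them. *)
Lemma vec_plane u v t w : det3 u v t != 0 -> det3 u v w = 0 ->
  exists x y, w = lc2 x u y v.
Proof.
move=> h h0; exists (det3 w v t / det3 u v t), (det3 u w t / det3 u v t).
rewrite {1}(vec_basis w h) h0 mul0r.
by apply: vecP; rewrite /= mul0r addr0.
Qed.

Lemma vec_line u v : u != 0 -> (forall t, det3 u v t = 0) ->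
  exists x, v = scale x u.
Proof.
case: u => [[u0 u1] u2]; case: v => [[v0 v1] v2] nu h.
have e0 : u1 * v2 = u2 * v1.
  by apply/subr0_eq; rewrite -(h (1, 0, 0)) /det3 /=; ring.
have e1 : u2 * v0 = u0 * v2.
  by apply/subr0_eq; rewrite -(h (0, 1, 0)) /det3 /=; ring.
have e2 : u0 * v1 = u1 * v0.
  by apply/subr0_eq; rewrite -(h (0, 0, 1)) /det3 /=; ring.
have [u0z|u0n] := eqVneq u0 0; last first.
  exists (v0 / u0); apply: vecP => /=.
  - by rewrite divfK.
  - by apply: (mulfI u0n); rewrite e2; field.
  - by apply: (mulfI u0n); rewrite -e1; field.
have [u1z|u1n] := eqVneq u1 0; last first.
  exists (v1 / u1); apply: vecP => /=.
  - by apply: (mulfI u1n); rewrite -e2 u0z; field.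
  - by rewrite divfK.
  - by apply: (mulfI u1n); rewrite e0; field.
have u2n : u2 != 0.
  by apply: contra nu => /eqP u2z; rewrite u0z u1z u2z.
exists (v2 / u2); apply: vecP => /=.
- by apply: (mulfI u2n); rewrite e1 u0z; field.
- by apply: (mulfI u2n); rewrite -e0 u1z; field.
- by rewrite divfK.
Qed.

End Vectors.

(** * The Cayley-Bacharach theorem *)

Section Cubics.
Variable K : fieldType.
Implicit Types (F : {mpoly K[3]}) (u v w : vec K).

Definition crd v (i : 'I_3) : K := [:: v.1.1; v.1.2; v.2]`_i.
Definition mev F v : K := F.@[crd v].

(** Ordered by powers of [r]: the line [t = 0] sees only [k 0, k 1, k 3, k 6], the line [s = 0] only
    [k 0, k 2, k 5, k 9], and the terms of [k 4, k 7, k 8] are divisible by [s * t]. *)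
Definition ternary_cubic (k : nat -> K) (r s t : K) : K :=
  k 0 * r ^+ 3 + r ^+ 2 * (k 1 * s + k 2 * t)
  + r * (k 3 * s ^+ 2 + k 4 * s * t + k 5 * t ^+ 2)
  + k 6 * s ^+ 3 + k 7 * s ^+ 2 * t + k 8 * s * t ^+ 2 + k 9 * t ^+ 3.

Lemma ternary_cubicD k k' r s t :
  ternary_cubic (fun i => k i + k' i) r s t =
  ternary_cubic k r s t + ternary_cubic k' r s t.
Proof. by rewrite /ternary_cubic; ring. Qed.

Lemma ternary_cubic_prod (c a0 a1 a2 b0 b1 b2 c0 c1 c2 : K) :
  exists k, forall r s t, ternary_cubic k r s t =
   c * ((r * a0 + s * a1 + t * a2) * (r * b0 + s * b1 + t * b2)
        * (r * c0 + s * c1 + t * c2)).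
Proof.
exists (fun i => c * [:: a0 * b0 * c0;
   a1 * b0 * c0 + a0 * b1 * c0 + a0 * b0 * c1;
   a2 * b0 * c0 + a0 * b2 * c0 + a0 * b0 * c2;
   a1 * b1 * c0 + a1 * b0 * c1 + a0 * b1 * c1;
   a1 * b2 * c0 + a2 * b1 * c0 + a1 * b0 * c2 + a2 * b0 * c1
   + a0 * b1 * c2 + a0 * b2 * c1;
   a2 * b2 * c0 + a2 * b0 * c2 + a0 * b2 * c2;
   a1 * b1 * c1;
   a1 * b1 * c2 + a1 * b2 * c1 + a2 * b1 * c1;
   a1 * b2 * c2 + a2 * b1 * c2 + a2 * b2 * c1;
   a2 * b2 * c2]`_i) => r s t.
by rewrite /ternary_cubic /=; ring.
Qed.

(** A cubic monomial written as a product of three coordinates becomes, after a linear substitution,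
    a product of three linear forms, the shape handled by [ternary_cubic_prod]. *)
Lemma cubic_monomial (m : 'X_{1..3}) : mdeg m = 3 ->
  exists i j k : 'I_3, forall x : 'I_3 -> K,
    \prod_i x i ^+ m i = x i * x j * x k.
Proof.
rewrite mdegE !big_ord_recl big_ord0 addn0.
set i0 := ord0; set i1 := lift _ _; set i2 := lift _ _ => d3.
suff [i [j [k h]]] : exists i j k : 'I_3, forall x : 'I_3 -> K,
    x i0 ^+ m i0 * (x i1 ^+ m i1 * x i2 ^+ m i2) = x i * x j * x k.
  by exists i, j, k => x; rewrite !big_ord_recl big_ord0 mulr1 h.
move: d3; move: (m i0) (m i1) (m i2) => [|[|[|[|a]]]] [|[|[|[|b]]]]
  [|[|[|[|c]]]] // _.
all: first [ exists i0, i0, i0 => x; ring | exists i0, i0, i1 => x; ring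
 | exists i0, i0, i2 => x; ring | exists i0, i1, i1 => x; ring
 | exists i0, i1, i2 => x; ring | exists i0, i2, i2 => x; ring
 | exists i1, i1, i1 => x; ring | exists i1, i1, i2 => x; ring
 | exists i1, i2, i2 => x; ring | exists i2, i2, i2 => x; ring].
Qed.

Lemma crd_lc3 r u s v t w i :
  crd (lc3 r u s v t w) i = r * crd u i + s * crd v i + t * crd w i.
Proof. by case: i => [[|[|[|i]]]]. Qed.

Lemma mev_lc3 F u v w : F \is 3.-homog ->
  exists k, forall r s t,
    mev F (lc3 r u s v t w) = ternary_cubic k r s t.
Proof.
move/dhomogP => hF.
suff [k hk] : exists k, forall r s t,
    \sum_(m <- msupp F) F@_m * \prod_i crd (lc3 r u s v t w) i ^+ m i =
    ternary_cubic k r s t.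
  by exists k => r s t; rewrite /mev mevalE hk.
elim: (msupp F : seq _) hF => [|m s IHs] hF.
  by exists (fun=> 0) => r t x; rewrite big_nil /ternary_cubic; ring.
have [|k hk] := IHs.
  by move=> m' hm'; apply: hF; rewrite inE hm' orbT.
have [i [j [l hm]]] := cubic_monomial (hF m (mem_head _ _)).
have [k' hk'] := ternary_cubic_prod (F@_m) (crd u i) (crd v i) (crd w i)
  (crd u j) (crd v j) (crd w j) (crd u l) (crd v l) (crd w l).
exists (fun i => k' i + k i) => r t x.
by rewrite ternary_cubicD big_cons hk hk' hm !crd_lc3.
Qed.

Lemma mev_scale F x u : F \is 3.-homog -> mev F (scale x u) = x ^+ 3 * mev F u.
Proof.
move=> hF; have [k hk] := mev_lc3 u u u hF.
have e y : scale y u = lc3 y u 0 u 0 u by apply: vecP; rewrite /=; ring.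
have -> : mev F u = mev F (scale 1 u) by congr mev; apply: vecP; rewrite /= mul1r.
by rewrite !e !hk /ternary_cubic; ring.
Qed.

(* With rows [t = 0] and [s = 0], the cubic agrees with a multiple of
   the product of the three columns up to [s * t * (linear form)]. *)
Lemma cayley_bacharach_coord (k : nat -> K) (x0 x1 x2 y0 y1 y2 : K)
    (s0 t0 s1 t1 s2 t2 a b : K) :
  let f := ternary_cubic k in
  x0 != x1 -> x0 != x2 -> x1 != x2 -> y0 != y1 -> y0 != y2 -> y1 != y2 ->
  f x0 1 0 = 0 -> f x1 1 0 = 0 -> f x2 1 0 = 0 ->
  f y0 0 1 = 0 -> f y1 0 1 = 0 -> f y2 0 1 = 0 ->
  s0 * t0 != 0 -> s1 * t1 != 0 ->
  f (x0 * s0 + y0 * t0) s0 t0 = 0 -> f (x1 * s1 + y1 * t1) s1 t1 = 0 ->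
  x2 * s2 + y2 * t2 = a * (x0 * s0 + y0 * t0) + b * (x1 * s1 + y1 * t1) ->
  s2 = a * s0 + b * s1 -> t2 = a * t0 + b * t1 ->
  f (x2 * s2 + y2 * t2) s2 t2 = 0.
Proof.
move=> f.
(* Vieta's formulas by divided differences; [q0] may be zero, and then all coefficients vanish. *)
have roots (q0 q1 q2 q3 z0 z1 z2 : K) : z0 != z1 -> z0 != z2 -> z1 != z2 ->
    q0 * z0 ^+ 3 + q1 * z0 ^+ 2 + q2 * z0 + q3 = 0 ->
    q0 * z1 ^+ 3 + q1 * z1 ^+ 2 + q2 * z1 + q3 = 0 ->
    q0 * z2 ^+ 3 + q1 * z2 ^+ 2 + q2 * z2 + q3 = 0 ->
    [/\ q1 = - q0 * (z0 + z1 + z2), q2 = q0 * (z0 * z1 + z0 * z2 + z1 * z2)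
      & q3 = - q0 * (z0 * z1 * z2)].
  rewrite -subr_eq0 => n01; rewrite -subr_eq0 => n02.
  rewrite -subr_eq0 => n12 e0 e1 e2.
  have d01 : q0 * (z0 ^+ 2 + z0 * z1 + z1 ^+ 2) + q1 * (z0 + z1) + q2 = 0.
    by apply: (mulfI n01); rewrite mulr0 -[RHS](subrr 0) -[X in _ = X - _]e0
      -[X in _ = _ - X]e1; ring.
  have d02 : q0 * (z0 ^+ 2 + z0 * z2 + z2 ^+ 2) + q1 * (z0 + z2) + q2 = 0.
    by apply: (mulfI n02); rewrite mulr0 -[RHS](subrr 0) -[X in _ = X - _]e0
      -[X in _ = _ - X]e2; ring.
  have d : q0 * (z0 + z1 + z2) + q1 = 0.
    by apply: (mulfI n12); rewrite mulr0 -[RHS](subrr 0) -[X in _ = X - _]d01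
      -[X in _ = _ - X]d02; ring.
  have E1 : q1 = - q0 * (z0 + z1 + z2).
    by apply/subr0_eq; rewrite -d; ring.
  have E2 : q2 = q0 * (z0 * z1 + z0 * z2 + z1 * z2).
    by apply/subr0_eq; rewrite -d01 E1; ring.
  by split=> //; apply/subr0_eq; rewrite -e0 E1 E2; ring.
move=> nx01 nx02 nx12 ny01 ny02 ny12 fx0 fx1 fx2 fy0 fy1 fy2 st0 st1 f0 f1
  er es et.
have [k1 k3 k6] : [/\ k 1 = - k 0 * (x0 + x1 + x2),
    k 3 = k 0 * (x0 * x1 + x0 * x2 + x1 * x2) & k 6 = - k 0 * (x0 * x1 * x2)].
  apply: (roots _ _ _ _ x0 x1 x2) => //; [rewrite -fx0 | rewrite -fx1 | rewrite -fx2];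
    by rewrite /f /ternary_cubic; ring.
have [k2 k5 k9] : [/\ k 2 = - k 0 * (y0 + y1 + y2),
    k 5 = k 0 * (y0 * y1 + y0 * y2 + y1 * y2) & k 9 = - k 0 * (y0 * y1 * y2)].
  apply: (roots _ _ _ _ y0 y1 y2) => //; [rewrite -fy0 | rewrite -fy1 | rewrite -fy2];
    by rewrite /f /ternary_cubic; ring.
pose c4 := k 4 - k 0 * (x0 * y1 + x0 * y2 + x1 * y0 + x1 * y2 + x2 * y0 + x2 * y1).
pose c7 := k 7 + k 0 * (x0 * x1 * y2 + x0 * y1 * x2 + y0 * x1 * x2).
pose c8 := k 8 + k 0 * (x0 * y1 * y2 + y0 * x1 * y2 + y0 * y1 * x2).
pose q r s t := c4 * r + c7 * s + c8 * t.
have fE r s t : f r s t =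
    k 0 * ((r - x0 * s - y0 * t) * (r - x1 * s - y1 * t) * (r - x2 * s - y2 * t))
    + s * t * q r s t.
  by rewrite /f /ternary_cubic k1 k2 k3 k5 k6 k9 /q /c4 /c7 /c8; ring.
(* The form [q] is linear and vanishes at two points of the third row, hence at the third, which is
   a combination of them. *)
have q0 : q (x0 * s0 + y0 * t0) s0 t0 = 0.
  by apply: (mulfI st0); rewrite mulr0 -f0 fE; ring.
have q1 : q (x1 * s1 + y1 * t1) s1 t1 = 0.
  by apply: (mulfI st1); rewrite mulr0 -f1 fE; ring.
have q2 : q (x2 * s2 + y2 * t2) s2 t2 =
    a * q (x0 * s0 + y0 * t0) s0 t0 + b * q (x1 * s1 + y1 * t1) s1 t1.
  by rewrite /q er es et; ring.
by rewrite fE q2 q0 q1; ring.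
Qed.

End Cubics.

Section CB.
Variable K : fieldType.
Implicit Types (F : {mpoly K[3]}) (u v w : vec K).

Lemma lc3_inj u v w r s t r' s' t' : det3 u v w != 0 ->
  lc3 r u s v t w = lc3 r' u s' v t' w -> [/\ r = r', s = s' & t = t'].
Proof.
move=> D e.
have E1 a b c : a * det3 u v w = det3 (lc3 a u b v c w) v w.
  by rewrite /det3 /=; ring.
have E2 a b c : b * det3 u v w = det3 u (lc3 a u b v c w) w.
  by rewrite /det3 /=; ring.
have E3 a b c : c * det3 u v w = det3 u v (lc3 a u b v c w).
  by rewrite /det3 /=; ring.
split; apply: (mulIf D).
- by rewrite (E1 r s t) e -E1.
- by rewrite (E2 r s t) e -E2.
- by rewrite (E3 r s t) e -E3.
Qed.

Section Grid.
Variables (F : {mpoly K[3]}) (p : 'I_3 -> 'I_3 -> vec K).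
Hypothesis hF : F \is 3.-homog.
Hypothesis row_col : forall i j k l, det3 (p i j) (p i k) (p i l) = 0.
Hypothesis col_col : forall i j k l, det3 (p j i) (p k i) (p l i) = 0.
Hypothesis row_gen : forall i i' j k l,
  i != i' -> k != l -> det3 (p i j) (p i' k) (p i' l) != 0.

Lemma cayley_bacharach_last :
  (forall i j, (i, j) != (ord_max, ord_max) -> mev F (p i j) = 0) ->
  mev F (p ord_max ord_max) = 0.
Proof.
move=> hp.
pose o0 : 'I_3 := @Ordinal 3 0 isT; pose o1 : 'I_3 := @Ordinal 3 1 isT.
pose o2 : 'I_3 := @Ordinal 3 2 isT.
have -> : ord_max = o2 by apply: val_inj.
have {}hp i j : (i, j) != (o2, o2) -> mev F (p i j) = 0.
  by move=> h; apply: hp; rewrite (_ : ord_max = o2) //; apply: val_inj.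
pose next (j : 'I_3) : 'I_3 := if j == o0 then o1 else o0.
have nextP j : j != next j by case: j => [[|[|[|j]]]].
pose Y0 := p o0 o0; pose Y1 := p o1 o0.
(* [X] is the intersection of the first two rows: in the basis [X, Y0, Y1] these rows are [t = 0]
   and [s = 0]. *)
pose X := lc2 (det3 (p o0 o1) Y1 (p o1 o1)) Y0
              (- det3 Y0 Y1 (p o1 o1)) (p o0 o1).
have D0 : det3 X Y0 Y1 != 0.
  rewrite det3_lc2 det3_uu mulr0 add0r mulf_neq0 ?oppr_eq0 ?row_gen //.
  by rewrite -det3_rot row_gen.
have [b0 [b1 Xrow1]] : exists b0 b1, X = lc2 b0 Y1 b1 (p o1 o1).
  apply: (@vec_plane _ _ _ Y0).
    by rewrite -det3_rot row_gen.
  by rewrite -det3_rot det3_lc2; ring.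
have Xr1 : det3 X (p o1 o0) (p o1 o1) = 0.
  by rewrite Xrow1 det3_lc2 /Y1 !row_col !mulr0 addr0.
have Xr0 : det3 X (p o0 o0) (p o0 o1) = 0.
  by rewrite det3_lc2 /Y0 !row_col !mulr0 addr0.
have coord0 j : exists r s, s != 0 /\ p o0 j = lc3 r X s Y0 0 Y1.
  exists (det3 (p o0 j) Y0 Y1 / det3 X Y0 Y1).
  exists (det3 X (p o0 j) Y1 / det3 X Y0 Y1).
  have e : p o0 j = lc3 (det3 (p o0 j) Y0 Y1 / det3 X Y0 Y1) X
    (det3 X (p o0 j) Y1 / det3 X Y0 Y1) Y0 0 Y1.
    rewrite {1}(vec_basis (p o0 j) D0); congr lc3.
    by rewrite det3_lc2 det3_uu row_col !mulr0 addr0 mul0r.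
  split=> //; apply/eqP => s0.
  have := @row_gen o0 o1 j o0 o1 isT isT.
  by rewrite e s0 det3_lc3 Xr1 !mul0r !addr0 mulr0 eqxx.
have coord1 j : exists r t, t != 0 /\ p o1 j = lc3 r X 0 Y0 t Y1.
  exists (det3 (p o1 j) Y0 Y1 / det3 X Y0 Y1).
  exists (det3 X Y0 (p o1 j) / det3 X Y0 Y1).
  have e : p o1 j = lc3 (det3 (p o1 j) Y0 Y1 / det3 X Y0 Y1) X 0 Y0
    (det3 X Y0 (p o1 j) / det3 X Y0 Y1) Y1.
    rewrite {1}(vec_basis (p o1 j) D0); congr lc3.
    rewrite {1}Xrow1 det3_lc2 -det3_rot det3_uu.
    by rewrite row_col !mulr0 addr0 mul0r.
  split=> //; apply/eqP => s0.
  have := @row_gen o1 o0 j o0 o1 isT isT.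
  by rewrite e s0 det3_lc3 Xr0 !mul0r !addr0 mulr0 eqxx.
have coord2 j : exists a b, a * b != 0 /\ p o2 j = lc2 a (p o0 j) b (p o1 j).
  have [||a [b e]] := @vec_plane _ (p o0 j) (p o1 j) (p o1 (next j)) (p o2 j).
  - exact: row_gen.
  - exact: col_col.
  exists a, b; split=> //; rewrite mulf_eq0 negb_or.
  apply/andP; split; apply/eqP => z0.
    have := @row_gen o2 o1 j j (next j) isT (nextP j).
    by rewrite e z0 det3_lc2 det3_uu mul0r mulr0 addr0 eqxx.
  have := @row_gen o2 o0 j j (next j) isT (nextP j).
  by rewrite e z0 det3_lc2 det3_uu mul0r mulr0 addr0 eqxx.
have [k hk] := mev_lc3 X Y0 Y1 hF.
have [a [b e22]] : exists a b, p o2 o2 = lc2 a (p o2 o0) b (p o2 o1).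
  by apply: (@vec_plane _ _ _ Y0); rewrite ?row_col // -det3_rot row_gen.
have {}coord0 j : exists x s, s != 0 /\ p o0 j = scale s (lc3 x X 1 Y0 0 Y1).
  have [r [s [ns e]]] := coord0 j; exists (r / s), s; split=> //.
  by rewrite e; apply: vecP; rewrite /=; field.
have {}coord1 j : exists x s, s != 0 /\ p o1 j = scale s (lc3 x X 0 Y0 1 Y1).
  have [r [s [ns e]]] := coord1 j; exists (r / s), s; split=> //.
  by rewrite e; apply: vecP; rewrite /=; field.
have tcE r s t x : mev F (scale x (lc3 r X s Y0 t Y1)) =
    x ^+ 3 * ternary_cubic k r s t by rewrite mev_scale // hk.
have coord j : exists x y s t, [/\ s * t != 0,
    p o2 j = lc3 (x * s + y * t) X s Y0 t Y1,
    exists2 c, c != 0 & p o0 j = scale c (lc3 x X 1 Y0 0 Y1) &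
    exists2 c, c != 0 & p o1 j = scale c (lc3 y X 0 Y0 1 Y1)].
  have [x [c [nc e0]]] := coord0 j; have [y [d [nd e1]]] := coord1 j.
  have [a' [b' [nab e2]]] := coord2 j.
  exists x, y, (a' * c), (b' * d); split; last 2 first.
  - by exists c.
  - by exists d.
  - by rewrite mulrACA mulf_neq0 // mulf_neq0.
  by rewrite e2 e0 e1; apply: vecP; rewrite /lc2 /lc3 /scale /=; ring.
have [x0 [y0 [s0 [t0 [st0 E0 [c0 nc0 e00] [d0 nd0 e10]]]]]] := coord o0.
have [x1 [y1 [s1 [t1 [st1 E1 [c1 nc1 e01] [d1 nd1 e11]]]]]] := coord o1.
have [x2 [y2 [s2 [t2 [st2 E2 [c2 nc2 e02] [d2 nd2 e12]]]]]] := coord o2.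
have tc0 c r s t q : c != 0 -> q = scale c (lc3 r X s Y0 t Y1) -> mev F q = 0 ->
    ternary_cubic k r s t = 0.
  by move=> nc -> /eqP; rewrite tcE mulf_eq0 expf_eq0 (negPf nc) => /eqP.
have := e22; rewrite E0 E1 E2 => e.
have {e}[er es et] : [/\ x2 * s2 + y2 * t2 =
      a * (x0 * s0 + y0 * t0) + b * (x1 * s1 + y1 * t1),
    s2 = a * s0 + b * s1 & t2 = a * t0 + b * t1].
  have {}e : lc3 (x2 * s2 + y2 * t2) X s2 Y0 t2 Y1 =
    lc3 (a * (x0 * s0 + y0 * t0) + b * (x1 * s1 + y1 * t1)) X
        (a * s0 + b * s1) Y0 (a * t0 + b * t1) Y1.
    by rewrite e; apply: vecP; rewrite /=; ring.
  exact: lc3_inj D0 e.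
have e1s r s t : lc3 r X s Y0 t Y1 = scale 1 (lc3 r X s Y0 t Y1).
  by apply: vecP; rewrite /= mul1r.
rewrite e1s tcE (cayley_bacharach_coord (x0 := x0) (x1 := x1) (y0 := y0) (y1 := y1)
  (s0 := s0) (t0 := t0) (s1 := s1) (t1 := t1) (a := a) (b := b)) ?mulr0 //.
- apply/eqP => h; have := @row_gen o1 o0 o0 o0 o1 isT isT.
  by rewrite e00 e01 h /det3 /= ; apply/negP; rewrite negbK; apply/eqP; ring.
- apply/eqP => h; have := @row_gen o1 o0 o0 o0 o2 isT isT.
  by rewrite e00 e02 h /det3 /= ; apply/negP; rewrite negbK; apply/eqP; ring.
- apply/eqP => h; have := @row_gen o1 o0 o0 o1 o2 isT isT.
  by rewrite e01 e02 h /det3 /= ; apply/negP; rewrite negbK; apply/eqP; ring.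
- apply/eqP => h; have := @row_gen o0 o1 o0 o0 o1 isT isT.
  by rewrite e10 e11 h /det3 /= ; apply/negP; rewrite negbK; apply/eqP; ring.
- apply/eqP => h; have := @row_gen o0 o1 o0 o0 o2 isT isT.
  by rewrite e10 e12 h /det3 /= ; apply/negP; rewrite negbK; apply/eqP; ring.
- apply/eqP => h; have := @row_gen o0 o1 o0 o1 o2 isT isT.
  by rewrite e11 e12 h /det3 /= ; apply/negP; rewrite negbK; apply/eqP; ring.
- exact: tc0 nc0 e00 (hp _ _ _).
- exact: tc0 nc1 e01 (hp _ _ _).
- exact: tc0 nc2 e02 (hp _ _ _).
- exact: tc0 nd0 e10 (hp _ _ _).
- exact: tc0 nd1 e11 (hp _ _ _).
- exact: tc0 nd2 e12 (hp _ _ _).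
- apply: (tc0 1 _ _ _ (p o2 o0)) => //; first exact: oner_neq0.
    by rewrite E0; apply: vecP; rewrite /= mul1r.
  exact: hp.
- apply: (tc0 1 _ _ _ (p o2 o1)) => //; first exact: oner_neq0.
    by rewrite E1; apply: vecP; rewrite /= mul1r.
  exact: hp.
Qed.

End Grid.

Lemma cayley_bacharach F (p : 'I_3 -> 'I_3 -> vec K) (i j : 'I_3) :
  F \is 3.-homog ->
  (forall i j k l, det3 (p i j) (p i k) (p i l) = 0) ->
  (forall i j k l, det3 (p j i) (p k i) (p l i) = 0) ->
  (forall i i' j k l, i != i' -> k != l ->
    det3 (p i j) (p i' k) (p i' l) != 0) ->
  (forall i' j', (i', j') != (i, j) -> mev F (p i' j') = 0) ->
  mev F (p i j) = 0.
Proof.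
move=> hF hr hc hg hp.
pose s := tperm ord_max i; pose t := tperm ord_max j.
have := @cayley_bacharach_last F (fun k l => p (s k) (t l)) hF.
rewrite !tpermL; apply => //.
  by move=> a a' b c d h1 h2; apply: hg; rewrite (inj_eq perm_inj).
move=> k l h; apply: hp; apply: contra h => /eqP [hk hl].
by rewrite xpair_eqE -(inj_eq (@perm_inj _ s) k)
  -(inj_eq (@perm_inj _ t) l)
  !tpermL hk hl !eqxx.
Qed.

End CB.

(** * Nets over abelian groups *)

Section Nets.
Variable K : fieldType.

Definition general (I J : eqType) (p : I -> vec K) (q : J -> vec K) :=
  forall x x' y, x != x' -> det3 (p x) (p x') (q y) != 0.

(* A net realizing an abelian group, with the labels of the third component
   negated, so that the components play symmetric roles. *)
Record symnet (G : zmodType) (P : 'I_3 -> G -> vec K) : Prop := SymNet {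
  net_col : forall x y z, x + y + z = 0 -> det3 (P 0 x) (P 1 y) (P 2 z) = 0;
  net_gen : forall t t', t != t' -> general (P t) (P t')
}.

Section Net.
Variables (G : zmodType) (P : 'I_3 -> G -> vec K).
Hypothesis netP : symnet P.

Lemma det3_net (L : 'I_3 -> G) (j k l : 'I_3) : L 0 + L 1 + L 2 = 0 ->
  det3 (P j (L j)) (P k (L k)) (P l (L l)) = 0.
Proof.
move=> hL; have h : det3 (P 0 (L 0)) (P 1 (L 1)) (P 2 (L 2)) = 0.
  exact: net_col.
have e0 (i : 'I_3) : [|| i == 0, i == 1 | i == 2] by case: i => [[|[|[|i]]]].
move: (e0 j) (e0 k) (e0 l).
by do 3 (case/or3P => /eqP ->);
  first [exact: h | by rewrite det3_uu | by rewrite det3_rot det3_uu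
    | by rewrite -det3_rot det3_uu | by rewrite det3_rot h
    | by rewrite -det3_rot h | by rewrite det3C h oppr0
    | by rewrite det3C det3_rot h oppr0 | by rewrite det3C -det3_rot h oppr0].
Qed.

(** Were the point on the line, that line would carry two points of component [t] besides one of
    another component, against generality. *)
Lemma det3_off_net (L : 'I_3 -> G) (t k l : 'I_3) (g : G) :
  L 0 + L 1 + L 2 = 0 -> g != L t -> k != l ->
  det3 (P t g) (P k (L k)) (P l (L l)) != 0.
Proof.
move=> hL hg kl; have [e|tk] := eqVneq t k.
  by rewrite -e; apply: (net_gen netP) => //; rewrite e.
have [e|tl] := eqVneq t l.
  by rewrite -e -det3_rot; apply: (net_gen netP); rewrite // eq_sym.
apply/eqP => h; rewrite det3_rot in h.
(* The nonzero shift [g - L t] gives a second point of component [k], which serves as independence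
   witness. *)
have gk : L k + (g - L t) != L k by rewrite addrC -subr_eq0 addrK subr_eq0.
have D : det3 (P k (L k)) (P l (L l)) (P k (L k + (g - L t))) != 0.
  by rewrite -det3_rot; apply: (net_gen netP).
have [x [y e1]] := vec_plane D h.
have [x' [y' e2]] := vec_plane D (det3_net k l t hL).
have /eqP[] := net_gen netP tk (L k) hg.
by rewrite e1 e2 /det3 /=; ring.
Qed.

Section Circuits.
Variables (F : {mpoly K[3]}) (hF : F \is 3.-homog).

(* The lines of the net through these nine points form a 3 x 3 grid. *)
Definition circuit (p q x y : G) (t i : 'I_3) : G :=
  [:: p + [:: x; 0; y]`_i; q + [:: 0; y; x]`_i;
      - (p + q + [:: x; y; x + y]`_i)]`_t.

Lemma mev_circuit (p q x y : G) (t i : 'I_3) :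
  x != 0 -> y != 0 -> x != y ->
  (forall t' i', (t', i') != (t, i) ->
     mev F (P t' (circuit p q x y t' i')) = 0) ->
  mev F (P t (circuit p q x y t i)) = 0.
Proof.
move=> x0 y0 xy h; pose c := circuit p q x y.
have row_sum (r : 'I_3) : c 0 r + c 1 r + c 2 r = 0.
  apply/eqP; rewrite /c /circuit /= subr_eq0 addrACA; apply/eqP; congr (_ + _).
  by case: r => [[|[|[|r]]] hr] //=; rewrite ?addr0 ?add0r // addrC.
have col_sum (r : 'I_3) : c 0 r + c 1 (1 + r) + c 2 (2 + r) = 0.
  apply/eqP; rewrite /c /circuit /= subr_eq0 addrACA; apply/eqP; congr (_ + _).
  by case: r => [[|[|[|r]]] hr] //=; rewrite ?addr0 ?add0r // addrC.
have c_inj (s : 'I_3) : injective (c s).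
  have nthI (e : seq G) (i1 i2 : 'I_3) : uniq e -> size e = 3 ->
      e`_i1 = e`_i2 -> i1 = i2.
    by move=> ue se /eqP; rewrite nth_uniq ?se // => /eqP /val_inj.
  case: s => [[|[|[|s]]] hs] // i1 i2; rewrite /c /circuit /=.
  - move/addrI; apply: nthI => //=.
    by rewrite !inE negb_or x0 xy (eq_sym 0) y0.
  - move/addrI; apply: nthI => //=.
    by rewrite !inE negb_or (eq_sym 0) y0 (eq_sym 0) x0 eq_sym xy.
  - have e1 : (x == x + y) = false.
      by rewrite -[X in X == _]addr0 (inj_eq (addrI x)) eq_sym (negPf y0).
    have e2 : (y == x + y) = false.
      by rewrite -[X in X == _]add0r (inj_eq (addIr y)) eq_sym (negPf x0).
    by move/oppr_inj/addrI; apply: nthI => //=; rewrite !inE negb_or xy e1 e2.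
(* Row [i] is the net line of index [i]; column [j] takes component [i + j] in row [i], as in a
   Latin square, so it too has one point of each component. *)
pose g (i j : 'I_3) := P (i + j) (c (i + j) i).
have := @cayley_bacharach _ F g i (t - i) hF.
rewrite /g /= addrCA subrr addr0; apply.
- by move=> r j k l; apply: (det3_net (L := fun s => c s r)).
- move=> r j k l.
  have := @det3_net (fun s => c s (s - r)) (j + r) (k + r) (l + r).
  rewrite /= !addrK; apply.
  by have := col_sum (- r); rewrite sub0r.
- move=> r r' j k l rr' kl.
  apply: (det3_off_net (L := fun s => c s r')) => //.
    by rewrite (inj_eq (c_inj _)).
  by rewrite (inj_eq (addrI _)).
move=> i' j' hij; apply: h; apply: contra hij => /eqP[e1 e2].
by rewrite xpair_eqE -e1 e2 eqxx addrAC subrr add0r eqxx.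
Qed.

End Circuits.
End Net.
End Nets.

(** * Propagating the vanishing of a cubic along circuits *)

Section Closure.
Variable G : zmodType.

Definition ord3 : seq 'I_3 := [:: 0; 1; 2].

Lemma mem_ord3 i : i \in ord3.
Proof. by case: i => [[|[|[|i]]]]. Qed.

Definition circuit_points (c : G * G * G * G) : seq ('I_3 * G) :=
  let: (p, q, x, y) := c in
  [seq (ti.1, circuit p q x y ti.1 ti.2) | ti <- [seq (t, i) | t <- ord3, i <- ord3]].

Definition add_forced (known : seq ('I_3 * G)) (c : G * G * G * G) :=
  if [seq z <- circuit_points c | z \notin known] is [:: z]
  then z :: known else known.

(** Each circuit is tried once, on the points collected so far, so the order of the list is part of
    the certificate. *)
Definition forced (cs : seq (G * G * G * G)) (known : seq ('I_3 * G)) :=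
  foldl add_forced known cs.

Lemma mev_forced (K : fieldType) (P : 'I_3 -> G -> vec K)
    (F : {mpoly K[3]}) cs known :
  symnet P -> F \is 3.-homog ->
  {in cs, forall c, [&& c.1.2 != 0, c.2 != 0 & c.1.2 != c.2]} ->
  {in known, forall z, mev F (P z.1 z.2) = 0} ->
  {in forced cs known, forall z, mev F (P z.1 z.2) = 0}.
Proof.
move=> netP hF; elim: cs known => [|c cs IHcs] s hc hs //=.
apply: IHcs => [c' hc'|]; first by apply: hc; rewrite inE hc' orbT.
have /and3P[] := hc c (mem_head _ _).
case: c {hc} => [[[p q] x] y] /= x0 y0 xy; rewrite /add_forced /circuit_points.
rewrite filter_map; set idx := filter _ _.
case E: idx => [|[t i] [|tj r]] //= z; rewrite inE => /orP[/eqP ->|]; last first.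
  exact: hs.
apply: mev_circuit => // t' i' ne.
apply: (hs (t', circuit p q x y t' i')).
have : (t', i') \notin idx by rewrite E inE.
rewrite mem_filter negb_and => /orP[|/negP[]]; first by rewrite /= negbK.
by apply: allpairs_f; apply: mem_ord3.
Qed.

End Closure.

Section PairGroup.
Variables m n : nat.
Notation G := ('Z_m * 'Z_n)%type.

(* Elements of ['Z_m * 'Z_n] are coded by the numbers [i * n + j]. *)
Definition pair_code (e : nat) : G := (inZp (e %/ n), inZp (e %% n)).

Definition pair_elements : seq G :=
  [seq (x, y) | x <- [seq inZp i | i <- iota 0 (Zp_trunc m).+2],
                y <- [seq inZp i | i <- iota 0 (Zp_trunc n).+2]].

Lemma mem_pair_elements g : g \in pair_elements.
Proof.
have h k (x : 'Z_k) : x \in [seq inZp i | i <- iota 0 (Zp_trunc k).+2].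
  apply/mapP; exists (x : nat); first by rewrite mem_iota /= add0n ltn_ord.
  by rewrite valZpK.
by case: g => x y; apply: allpairs_f; apply: h.
Qed.

Definition forces_all (cs : seq (nat * nat * nat * nat)) (known : seq ('I_3 * G)) :=
  let ds := [seq (pair_code c.1.1.1, pair_code c.1.1.2, pair_code c.1.2,
                  pair_code c.2) | c <- cs] in
  all (fun c => [&& c.1.2 != 0, c.2 != 0 & c.1.2 != c.2]) ds &&
  all (fun z => z \in forced ds known)
    [seq (t, g) | t <- ord3, g <- pair_elements].

Lemma mev_forces_all (K : fieldType) (P : 'I_3 -> G -> vec K)
    (F : {mpoly K[3]}) cs known t g :
  symnet P -> F \is 3.-homog -> forces_all cs known ->
  {in known, forall z, mev F (P z.1 z.2) = 0} -> mev F (P t g) = 0.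
Proof.
move=> netP hF /andP[/allP h1 /allP h2] hk.
apply: (mev_forced netP hF h1 hk (x := (t, g))); apply: h2.
by apply: allpairs_f; rewrite ?mem_ord3 ?mem_pair_elements.
Qed.

End PairGroup.

(* Nine points, so that some cubic contains them all. *)
Definition seed24 : seq ('I_3 * ('Z_2 * 'Z_4)) :=
  [seq (inZp e.1, pair_code 2 4 e.2) | e <-
    [:: (0, 0); (0, 1); (0, 4); (1, 0); (1, 1); (1, 4); (2, 3); (2, 4); (0, 5)]]%N.

(** The seed leaves 15 of the 24 points; each of the 15 circuits adds exactly one of them. *)
Lemma forces_all24 : forces_all [:: (0, 0, 1, 4); (0, 0, 4, 5); (0, 4, 1, 4);
  (0, 4, 1, 5); (0, 5, 3, 4); (0, 5, 3, 5); (0, 5, 4, 5); (0, 5, 4, 7);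
  (0, 6, 3, 4); (0, 6, 4, 6); (0, 6, 6, 7); (0, 7, 1, 3); (0, 7, 1, 7);
  (0, 7, 2, 3); (0, 7, 2, 4)]%N seed24.
Proof. by vm_compute. Qed.

Definition blocks (s : seq ('I_3 * 'Z_3)) : seq ('I_3 * ('Z_3 * 'Z_3)) :=
  [seq (ti.1, (ti.2, j)) | ti <- s, j <- [:: 0; 1; 2]].

(** The three choices of two among the three matched pairs (coset [t] of the second component, coset
    [- t] of the third), always with coset 0 of the first. Twelve circuits supply the 12 points
    outside the five cosets. *)
Lemma forces_all33 :
  [/\ exists cs, forces_all cs (blocks [:: (0, 0); (1, 0); (1, 1); (2, 0); (2, - 1)]),
      exists cs, forces_all cs (blocks [:: (0, 0); (1, 0); (1, 2); (2, 0); (2, - 2)])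
    & exists cs, forces_all cs (blocks [:: (0, 0); (1, 1); (1, 2); (2, - 1); (2, - 2)])].
Proof.
split.
- by exists [:: (0, 0, 1, 3); (0, 0, 1, 4); (0, 0, 1, 5); (0, 0, 3, 4);
    (0, 0, 3, 5); (0, 0, 4, 5); (0, 3, 1, 3); (0, 3, 1, 4); (0, 3, 1, 5);
    (0, 3, 1, 6); (0, 3, 1, 7); (0, 3, 1, 8)]%N; vm_compute.
- by exists [:: (0, 0, 1, 6); (0, 0, 1, 7); (0, 0, 1, 8); (0, 0, 6, 7);
    (0, 0, 6, 8); (0, 0, 7, 8); (0, 3, 6, 7); (0, 4, 2, 6); (0, 4, 3, 7);
    (0, 4, 4, 6); (0, 4, 5, 6); (0, 5, 1, 3)]%N; vm_compute.
- by exists [:: (0, 3, 1, 3); (0, 3, 1, 4); (0, 3, 1, 5); (0, 3, 3, 4);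
    (0, 3, 3, 5); (0, 3, 4, 5); (0, 6, 1, 3); (0, 6, 1, 4); (0, 6, 1, 5);
    (0, 6, 1, 6); (0, 6, 1, 7); (0, 6, 1, 8)]%N; vm_compute.
Qed.

(** * Cubics and points *)

Section CubicExistence.
Variable K : fieldType.

Definition cubic_exponents : seq (seq nat) :=
  [:: [:: 3; 0; 0]; [:: 2; 1; 0]; [:: 2; 0; 1]; [:: 1; 2; 0]; [:: 1; 1; 1];
      [:: 1; 0; 2]; [:: 0; 3; 0]; [:: 0; 2; 1]; [:: 0; 1; 2]; [:: 0; 0; 3]]%N.

Definition cubic_mnm (i : 'I_10) : 'X_{1..3} :=
  [multinom nth 0%N (nth [::] cubic_exponents i) j | j < 3].

Lemma cubic_mnm_inj : injective cubic_mnm.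
Proof.
move=> i j /mnmP e.
have {e}e l : (l < 3)%N -> nth 0%N (nth [::] cubic_exponents i) l =
                           nth 0%N (nth [::] cubic_exponents j) l.
  by move=> hl; have := e (Ordinal hl); rewrite !mnmE.
apply/eqP; rewrite -val_eqE /= -(@nth_uniq _ [::] cubic_exponents) //.
apply/eqP; apply: (@eq_from_nth _ 0%N) => [|l].
  by case: i {e} => [[|[|[|[|[|[|[|[|[|[|i]]]]]]]]]]] //;
     case: j => [[|[|[|[|[|[|[|[|[|[|j]]]]]]]]]]].
move=> hl; apply: e; apply: leq_trans hl _.
by case: i => [[|[|[|[|[|[|[|[|[|[|i]]]]]]]]]]].
Qed.

Lemma mdeg_cubic_mnm i : mdeg (cubic_mnm i) = 3.
Proof.
rewrite mdegE !big_ord_recl big_ord0 !mnmE.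
by case: i => [[|[|[|[|[|[|[|[|[|[|i]]]]]]]]]]].
Qed.

(** Ten monomials against at most nine linear conditions: the evaluation matrix has a nonzero left
    kernel. *)
Lemma cubic_through (vs : seq (vec K)) : (size vs < 10)%N ->
  exists F : {mpoly K[3]}, [/\ F != 0, F \is 3.-homog &
    {in vs, forall v, mev F v = 0}].
Proof.
move=> sz; pose M : 'M[K]_(10, size vs) :=
  \matrix_(i, j) mev 'X_[cubic_mnm i] (nth (0, 0, 0) vs j).
have : kermx M != 0.
  rewrite -mxrank_eq0 mxrank_ker subn_eq0 -ltnNge.
  exact: leq_ltn_trans (rank_leq_col M) sz.
case/rowV0Pn => k /sub_kermxP kM k0.
pose F : {mpoly K[3]} := \sum_i k 0 i *: 'X_[cubic_mnm i].
exists F; split.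
- apply: contra k0 => /eqP F0; apply/eqP/rowP => i; rewrite mxE.
  have := congr1 (fun p => p@_(cubic_mnm i)) F0.
  rewrite mcoeff0 raddf_sum (bigD1 i) //= mcoeffZ mcoeffX eqxx mulr1.
  rewrite big1 ?addr0 // => j ji; rewrite mcoeffZ mcoeffX.
  by rewrite (inj_eq cubic_mnm_inj) (negPf ji) mulr0.
- by apply: rpred_sum => i _; apply: rpredZ; rewrite dhomogX; apply/eqP/mdeg_cubic_mnm.
move=> v /(nthP (0, 0, 0))[j hj <-].
have /rowP/(_ (Ordinal hj)) := kM; rewrite !mxE => e; rewrite -[RHS]e.
rewrite /mev raddf_sum; apply: eq_bigr => i _.
by rewrite mxE; apply: mevalZ.
Qed.

Definition linear_form (u : vec K) : {mpoly K[3]} :=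
  \sum_i crd u i *: 'X_i.

Lemma mev_linear_form u v :
  mev (linear_form u) v = u.1.1 * v.1.1 + u.1.2 * v.1.2 + u.2 * v.2.
Proof.
rewrite /mev raddf_sum !big_ord_recl big_ord0 /= !mevalZ !mevalXU /crd /=.
by rewrite addr0 addrA.
Qed.

Lemma linear_form_homog u : linear_form u \is 1.-homog.
Proof.
apply: rpred_sum => i _; apply: rpredZ; rewrite dhomogX; apply/eqP.
exact: mdeg1.
Qed.

Definition line_form (u v : vec K) : {mpoly K[3]} :=
  linear_form (u.1.2 * v.2 - u.2 * v.1.2, u.2 * v.1.1 - u.1.1 * v.2,
               u.1.1 * v.1.2 - u.1.2 * v.1.1).

Lemma mev_line_form u v w : mev (line_form u v) w = det3 u v w.
Proof. by rewrite mev_linear_form /det3 /=; ring. Qed.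

Lemma mevM (F H : {mpoly K[3]}) v : mev (F * H) v = mev F v * mev H v.
Proof. exact: mevalM. Qed.
Lemma mevD (F H : {mpoly K[3]}) v : mev (F + H) v = mev F v + mev H v.
Proof. exact: mevalD. Qed.
Lemma mevZ c (F : {mpoly K[3]}) v : mev (c *: F) v = c * mev F v.
Proof. exact: mevalZ. Qed.
Lemma mev0 v : mev (0 : {mpoly K[3]}) v = 0.
Proof. exact: meval0. Qed.

Lemma mul3_homog (F1 F2 F3 : {mpoly K[3]}) : F1 \is 1.-homog ->
  F2 \is 1.-homog -> F3 \is 1.-homog -> F1 * F2 * F3 \is 3.-homog.
Proof. by move=> h1 h2 h3; apply: (dhomogM (dhomogM h1 h2) h3). Qed.

End CubicExistence.

Section Points.
Variable K : fieldType.
Implicit Types P Q R : point K.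

Definition vec_of_row (r : 'rV[K]_3) : vec K := (r 0 0, r 0 1, r 0 2).
Definition row_of_vec (v : vec K) : 'rV[K]_3 := \row_i crd v i.
Definition vpt P : vec K := vec_of_row (vpick P).

Lemma vec_of_rowK : cancel vec_of_row row_of_vec.
Proof.
move=> r; apply/rowP => i; rewrite mxE /crd /vec_of_row.
by case: i => [[|[|[|i]]]] //= h; congr (r _ _); apply: val_inj.
Qed.

Lemma row_of_vec_lc2 x u y v :
  row_of_vec (lc2 x u y v) = x *: row_of_vec u + y *: row_of_vec v.
Proof. by apply/rowP => i; rewrite !mxE; case: i => [[|[|[|i]]]]. Qed.

Lemma row_of_vec_lc3 x u y v z w : row_of_vec (lc3 x u y v z w) =
  x *: row_of_vec u + y *: row_of_vec v + z *: row_of_vec w.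
Proof. by apply/rowP => i; rewrite !mxE crd_lc3. Qed.

Lemma row_of_vpt P : row_of_vec (vpt P) = vpick P.
Proof. exact: vec_of_rowK. Qed.

Lemma vpick_point P : vpick P != 0.
Proof. by rewrite vpick0 -dimv_eq0 (eqP (dim_point P)). Qed.

Lemma point_lineE P : point_space P = <[vpick P]>%VS.
Proof.
apply/eqP; rewrite eq_sym eqEdim -memvE memv_pick dim_vline vpick_point.
by rewrite (eqP (dim_point P)).
Qed.

Lemma on_cubic_vpt (F : {mpoly K[3]}) P : F \is 3.-homog ->
  mev F (vpt P) = 0 -> on_cubic F P.
Proof.
move=> hF h v; rewrite point_lineE => /vlineP[c ->].
rewrite (@meval_eq _ _ _ (crd (scale c (vpt P)))) => [|i].
  by have := mev_scale c (vpt P) hF; rewrite /mev => ->; rewrite [F.@[_]]h mulr0.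
rewrite mxE; rewrite -[vpick P in LHS]row_of_vpt mxE.
by case: i => [[|[|[|i]]]].
Qed.

Lemma collinear_det3 P Q R :
  collinear P Q R -> det3 (vpt P) (vpt Q) (vpt R) = 0.
Proof.
case=> l [hP hQ hR]; apply/eqP; apply: contraT => D.
have : ({:'rV[K]_3} <= l)%VS.
  apply/subvP => r _; rewrite -[r]vec_of_rowK.
  rewrite (vec_basis (vec_of_row r) D) row_of_vec_lc3 !row_of_vpt.
  have h S : incident S l -> vpick S \in line_space l.
    by move/subvP; apply; apply: memv_pick.
  by rewrite !rpredD // rpredZ // h.
by move/dimvS; rewrite dimvf (eqP (dim_line l)).
Qed.

Lemma det3_incident P Q R : P != Q -> det3 (vpt P) (vpt Q) (vpt R) = 0 ->
  exists l : line K, [/\ incident P l, incident Q l & incident R l].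
Proof.
move=> PQ D.
have Pn : vpt P != 0.
  apply: contraNneq (vpick_point P) => h; rewrite -row_of_vpt h.
  by apply/eqP/rowP => i; rewrite !mxE; case: i => [[|[|[|i]]]].
have [t Dt] : exists t, det3 (vpt P) (vpt Q) t != 0.
  case: (eqVneq (det3 (vpt P) (vpt Q) (1, 0, 0)) 0) => [h0|]; last by exists (1, 0, 0).
  case: (eqVneq (det3 (vpt P) (vpt Q) (0, 1, 0)) 0) => [h1|]; last by exists (0, 1, 0).
  case: (eqVneq (det3 (vpt P) (vpt Q) (0, 0, 1)) 0) => [h2|]; last by exists (0, 0, 1).
  have [|x e] := vec_line Pn (v := vpt Q).
    move=> t; have -> : t = lc3 t.1.1 (1, 0, 0) t.1.2 (0, 1, 0) t.2 (0, 0, 1).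
      by apply: vecP; rewrite /=; ring.
    by rewrite -det3_rot det3_lc3 (det3_rot (1, 0, 0))
      (det3_rot (0, 1, 0)) (det3_rot (0, 0, 1)) h0 h1 h2; ring.
  case/eqP: PQ; apply: val_inj; apply/eqP; rewrite /= eq_sym eqEdim.
  rewrite (eqP (dim_point P)) (eqP (dim_point Q)) leqnn andbT.
  rewrite (point_lineE Q) -memvE -row_of_vpt e.
  rewrite (_ : row_of_vec _ = x *: row_of_vec (vpt P)); last first.
    by apply/rowP => i; rewrite !mxE; case: i => [[|[|[|i]]]].
  by rewrite rpredZ // row_of_vpt memv_pick.
have d2 : \dim (point_space P + point_space Q) == 2%N.
  rewrite eqn_leq; apply/andP; split.
    apply: leq_trans (dimv_add_leqif _ _) _.
    by rewrite (eqP (dim_point P)) (eqP (dim_point Q)).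
  rewrite ltnNge; apply/negP => d1.
  have PQs : (point_space P <= point_space P + point_space Q)%VS := addvSl _ _.
  have : point_space P = (point_space P + point_space Q)%VS.
    by apply/eqP; rewrite eqEdim PQs (eqP (dim_point P)).
  move=> e; have := memv_pick Q; move: (addvSr P Q); rewrite -e => /subvP h.
  move/h => {}h; have : vpick Q \in <[vpick P]>%VS by rewrite -point_lineE.
  case/vlineP => x eQ.
  move: Dt; rewrite /det3 /vpt eQ /vec_of_row !mxE /= => /eqP[]; ring.
exists (Line d2); split; rewrite /incident /=; first exact: addvSl.
  exact: addvSr.
have [x [y e]] := vec_plane Dt D.
rewrite (point_lineE R) -memvE -row_of_vpt e row_of_vec_lc2 !row_of_vpt.
by rewrite memv_add // rpredZ // memv_pick.
Qed.

End Points.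

(** * From realized groups to nets of vectors *)

Section Realization.
Variables (K : fieldType) (n : nat) (L : 'I_3 -> {fset point K}).
Variables (gT : finGroupType) (G : {group gT}).

Definition labelling (lab : 'I_3 -> gT -> point K) : Prop :=
  (forall t, bij_onto G (lab t) (L t)) /\
  {in G & &, forall a b c,
    (a * b)%g = c <-> collinear (lab 0 a) (lab 1 b) (lab 2 c)}.

Lemma realizes_labelling : realizes L G -> exists lab, labelling lab.
Proof.
case=> [al [be [ga [h0 h1 h2 h]]]].
exists (fun t => nth al [:: al; be; ga] t); split=> //.
by case=> [[|[|[|t]]] //= ht];
  [move: h0|move: h1|move: h2]; congr bij_onto; apply/congr1/val_inj.
Qed.

Variable lab : 'I_3 -> gT -> point K.
Hypotheses (netL : dual_3net n L) (labP : labelling lab).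

Lemma lab_in t x : x \in G -> lab t x \in L t.
Proof. by move=> xG; case: labP => /(_ t)[_ <-] _; apply: in_imfset. Qed.

Lemma lab_surj t P : P \in L t -> exists2 x, x \in G & P = lab t x.
Proof. by case: labP => /(_ t)[_ <-] _ /imfsetP. Qed.

(** The maps [f t] need not exhaust [G], so this also yields the nets formed by cosets of a
    subgroup. Generality comes from the uniqueness of the point of a component on a line that meets
    two components. *)
Lemma symnet_lab (H : zmodType) (f : 'I_3 -> H -> gT) :
  (forall t, injective (f t)) -> (forall t h, f t h \in G) ->
  (forall x y z, x + y + z = 0 -> (f 0 x * f 1%R y)%g = f 2 z) ->
  symnet (fun t h => vpt (lab t (f t h))).
Proof.
move=> f_inj fG fM; case: netL => _ disj uniqL; split.
  move=> x y z /fM e; apply: collinear_det3.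
  by case: labP => _ h; apply: (proj1 (h _ _ _ (fG 0 x) (fG 1 y) (fG 2 z)) e).
move=> t t' tt' h h' k hh'; apply/eqP => D.
have neq : lab t (f t h) != lab t' (f t' k).
  apply: contraTneq (disj _ _ tt') => e; apply/negP => /fdisjointP.
  by move/(_ _ (lab_in t (fG t h))); rewrite e lab_in.
have [|l [i1 i2 i3]] := det3_incident neq (R := lab t (f t h')).
  by rewrite -det3_rot det3C D oppr0.
have m1 : meets l (L t) by exists (lab t (f t h)) => //; apply: lab_in.
have m2 : meets l (L t') by exists (lab t' (f t' k)) => //; apply: lab_in.
have [P [_ Pu]] := uniqL l _ _ tt' m1 m2 t.
case/eqP: hh'; apply: (f_inj t).
case: labP => /(_ t)[lab_inj _] _; apply: lab_inj; rewrite ?fG //.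
by rewrite -(Pu (lab t (f t h))) ?(Pu (lab t (f t h'))) //; split=> //; apply: lab_in.
Qed.

Lemma algebraic_lab (H : Type) (f : 'I_3 -> H -> gT) (F : {mpoly K[3]}) :
  (forall t x, x \in G -> exists h, x = f t h) ->
  F != 0 -> F \is 3.-homog -> (forall t h, mev F (vpt (lab t (f t h))) = 0) ->
  algebraic L.
Proof.
move=> f_surj F0 hF hv; exists F; split=> // t P /lab_surj[x xG ->].
by apply: on_cubic_vpt => //; have [h ->] := f_surj t x xG.
Qed.

Lemma isog_symnet (m k : nat) : G \isog [set: 'Z_m * 'Z_k] ->
  exists P : 'I_3 -> 'Z_m * 'Z_k -> vec K, symnet P /\
   forall F : {mpoly K[3]}, F != 0 -> F \is 3.-homog ->
     (forall t h, mev F (P t h) = 0) -> algebraic L.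
Proof.
rewrite isog_sym => /isogP[g /injmP g_inj gG].
have {}g_inj : injective g by move=> x y; apply: g_inj; rewrite inE.
have gin x : g x \in G by rewrite -gG mem_morphim ?inE.
pose f (t : 'I_3) x := g (if t == 2 then - x else x).
have f_inj t : injective (f t).
  by move=> x y /g_inj; case: ifP => // _ /oppr_inj.
exists (fun t h => vpt (lab t (f t h))); split.
  apply: symnet_lab => [|t x|x y z /eqP]; [exact: f_inj | exact: gin |].
  rewrite /f /= addr_eq0 => /eqP <-.
  by rewrite -morphM ?inE.
move=> F F0 hF; apply: algebraic_lab => // t x; rewrite -gG => /morphimP[y _ _ ->].
by exists (if t == 2 then - y else y); rewrite /f; case: ifP => e; rewrite e ?opprK.
Qed.

End Realization.

Lemma algebraic24 (K : fieldType) n (L : 'I_3 -> {fset point K})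
    (gT : finGroupType) (G : {group gT}) :
  dual_3net n L -> realizes L G -> G \isog [set: 'Z_2 * 'Z_4] -> algebraic L.
Proof.
move=> netL /realizes_labelling[lab labP] /(isog_symnet netL labP)[P [netP algP]].
have [//|F [F0 hF Fv]] := cubic_through (vs := [seq P z.1 z.2 | z <- seed24]).
apply: (algP F) => // t h; apply: (mev_forces_all _ _ netP hF forces_all24) => z hz.
by apply: Fv; apply: map_f.
Qed.

(** * The alternating group *)

Section Quaternion.
Variable K : fieldType.
Hypothesis two_neq0 : 2 != 0 :> K.

(** The four equations are linear in [f0, n0, f1, n1] and have a nonzero solution, so their
    determinant vanishes; the conclusion is this determinant, expanded. *)
Lemma first_rows (h0 h1 h2 h3 k0 k1 k2 k3 f0 f1 n0 n1 : K) : f0 != 0 ->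
  f0 * h0 + n0 * k0 = - (f1 * h1) + n1 * k1 ->
  f0 * h1 + n0 * k1 = f1 * h0 + n1 * k0 ->
  f0 * h2 + n0 * k2 = - (f1 * h3) + n1 * k3 ->
  f0 * h3 + n0 * k3 = f1 * h2 + n1 * k2 ->
  (h0 ^+ 2 + h1 ^+ 2) * (k2 ^+ 2 - k3 ^+ 2)
  + (h2 ^+ 2 + h3 ^+ 2) * (k0 ^+ 2 - k1 ^+ 2) =
  2 * (h0 * h2 + h1 * h3) * (k0 * k2 - k1 * k3).
Proof.
move=> f0n /eqP; rewrite -subr_eq0 => /eqP e0 /eqP; rewrite -subr_eq0 => /eqP e1.
move=> /eqP; rewrite -subr_eq0 => /eqP e2 /eqP; rewrite -subr_eq0 => /eqP e3.
apply/eqP; rewrite -subr_eq0 -(mulIr_eq0 _ (mulIf f0n)); apply/eqP.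
(* Cofactors of the column of [f0], which eliminate [n0], [f1] and [n1]. *)
pose c0 := det3 (- h0, k1, - k0) (h3, k2, - k3) (- h2, k3, - k2).
pose c1 := det3 (h1, k0, - k1) (h3, k2, - k3) (- h2, k3, - k2).
pose c2 := det3 (h1, k0, - k1) (- h0, k1, - k0) (- h2, k3, - k2).
pose c3 := det3 (h1, k0, - k1) (- h0, k1, - k0) (h3, k2, - k3).
transitivity (c0 * 0 - c1 * 0 + c2 * 0 - c3 * 0); last by ring.
by rewrite -{1}e0 -{1}e1 -{1}e2 -{1}e3 /c0 /c1 /c2 /c3 /det3 /=; ring.
Qed.

(** Changing the signs of [h1] and [h2] carries these rows to those of [first_rows]; in the
    conclusion only [h0 * h2 + h1 * h3] changes sign. *)
Lemma last_rows (h0 h1 h2 h3 k0 k1 k2 k3 f2 f3 n2 n3 : K) : f2 != 0 ->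
  - (f2 * h2) + n2 * k2 = - (f3 * h3) + n3 * k3 ->
  f2 * h3 + n2 * k3 = - (f3 * h2) + n3 * k2 ->
  f2 * h0 + n2 * k0 = f3 * h1 + n3 * k1 ->
  - (f2 * h1) + n2 * k1 = f3 * h0 + n3 * k0 ->
  (h0 ^+ 2 + h1 ^+ 2) * (k2 ^+ 2 - k3 ^+ 2)
  + (h2 ^+ 2 + h3 ^+ 2) * (k0 ^+ 2 - k1 ^+ 2) =
  - (2 * (h0 * h2 + h1 * h3) * (k0 * k2 - k1 * k3)).
Proof.
move=> f2n e0 e1 e2 e3.
have := @first_rows h0 (- h1) (- h2) h3 k0 k1 k2 k3 f2 f3 n2 n3 f2n.
rewrite !mulrN !opprK !sqrrN => -> //; ring.
Qed.

(** [first_rows] and [last_rows] equate the same expression with opposite values; as 2 is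
    invertible, both sides vanish. *)
Lemma pair_rows (h0 h1 h2 h3 k0 k1 k2 k3 f0 f1 f2 f3 n0 n1 n2 n3 : K)
    (g0 g1 g2 g3 : K) : f0 != 0 -> f2 != 0 ->
  [/\ f0 * h0 + n0 * k0 = g0, - (f1 * h1) + n1 * k1 = g0,
      - (f2 * h2) + n2 * k2 = g0 & - (f3 * h3) + n3 * k3 = g0] ->
  [/\ f0 * h1 + n0 * k1 = g1, f1 * h0 + n1 * k0 = g1,
      f2 * h3 + n2 * k3 = g1 & - (f3 * h2) + n3 * k2 = g1] ->
  [/\ f0 * h2 + n0 * k2 = g2, - (f1 * h3) + n1 * k3 = g2,
      f2 * h0 + n2 * k0 = g2 & f3 * h1 + n3 * k1 = g2] ->
  [/\ f0 * h3 + n0 * k3 = g3, f1 * h2 + n1 * k2 = g3,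
      - (f2 * h1) + n2 * k1 = g3 & f3 * h0 + n3 * k0 = g3] ->
  (h0 ^+ 2 + h1 ^+ 2) * (k2 ^+ 2 - k3 ^+ 2)
  + (h2 ^+ 2 + h3 ^+ 2) * (k0 ^+ 2 - k1 ^+ 2) = 0 /\
  (h0 * h2 + h1 * h3) * (k0 * k2 - k1 * k3) = 0.
Proof.
move=> nf0 nf2 [a0 a1 a2 a3] [b0 b1 b2 b3] [c0 c1 c2 c3] [d0 d1 d2 d3].
have E1 := first_rows nf0 (etrans a0 (esym a1)) (etrans b0 (esym b1))
  (etrans c0 (esym c1)) (etrans d0 (esym d1)).
have E2 := last_rows nf2 (etrans a2 (esym a3)) (etrans b2 (esym b3))
  (etrans c2 (esym c3)) (etrans d2 (esym d3)).
set m := (h0 * h2 + _) * _.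
have m0 : m = 0.
  apply: (mulfI two_neq0); apply: (mulfI two_neq0); rewrite !mulr0.
  have := etrans (esym E1) E2; rewrite -!mulrA -/m => e.
  by rewrite mulr2n mulrDl mul1r {1}e addNr.
by split=> //; rewrite E1 -mulrA -/m m0 mulr0.
Qed.

(* Each of the three products in [pair_rows] has a vanishing factor; here two of
   the factors in [h] vanish. *)
Lemma two_h_vanish (h0 h1 h2 h3 k0 k1 k2 k3 : K) :
  h0 != 0 -> h1 != 0 -> h2 != 0 -> h3 != 0 ->
  k0 ^+ 2 != k2 ^+ 2 -> (k0 / h0) ^+ 2 != (k3 / h3) ^+ 2 ->
  (h0 ^+ 2 + h1 ^+ 2) * (k2 ^+ 2 - k3 ^+ 2)
  + (h2 ^+ 2 + h3 ^+ 2) * (k0 ^+ 2 - k1 ^+ 2) = 0 ->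
  (h0 ^+ 2 + h2 ^+ 2) * (k3 ^+ 2 - k1 ^+ 2)
  + (h3 ^+ 2 + h1 ^+ 2) * (k0 ^+ 2 - k2 ^+ 2) = 0 ->
  (h0 ^+ 2 + h3 ^+ 2) * (k1 ^+ 2 - k2 ^+ 2)
  + (h1 ^+ 2 + h2 ^+ 2) * (k0 ^+ 2 - k3 ^+ 2) = 0 ->
  h0 * h2 + h1 * h3 = 0 -> h0 * h3 + h2 * h1 = 0 ->
  (h0 * h1 + h3 * h2) * (k0 * k1 - k3 * k2) = 0 -> False.
Proof.
move=> nh0 nh1 nh2 nh3 k02 kh03 a1 a2 a3 b1 b2 b3.
have E1 : (h2 - h3) * (h0 - h1) = 0 by rewrite -(subrr 0) -{1}b1 -b2; ring.
have E2 : (h2 + h3) * (h0 + h1) = 0 by rewrite -(addr0 0) -{1}b1 -b2; ring.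
have dbl (x : K) : x != 0 -> x + x != 0.
  by move=> nx; rewrite -mulr2n -mulr_natl mulf_neq0.
have [h23 h01] : h2 ^+ 2 = h3 ^+ 2 /\ h0 ^+ 2 = h1 ^+ 2.
  move/eqP: E1; rewrite mulf_eq0 !subr_eq0 => /orP[/eqP e|/eqP e].
    move/eqP: E2; rewrite e mulf_eq0 (negPf (dbl _ nh3)) /= addr_eq0.
    by move/eqP ->; rewrite sqrrN.
  move/eqP: E2; rewrite e mulf_eq0 (negPf (dbl _ nh1)) orbF addr_eq0.
  by move/eqP ->; rewrite sqrrN.
have h02 : h2 ^+ 2 = - h0 ^+ 2.
  apply/eqP; rewrite -addr_eq0 addrC; apply: contraNT k02 => s.
  have : 2 * (h0 ^+ 2 + h2 ^+ 2) * (k0 ^+ 2 - k2 ^+ 2) = 0.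
    by rewrite -(addr0 0) -{1}a2 -a3 -h23 -h01; ring.
  by move/eqP; rewrite !mulf_eq0 (negPf two_neq0) (negPf s) /= subr_eq0.
have k0123 : k2 ^+ 2 - k3 ^+ 2 = k0 ^+ 2 - k1 ^+ 2.
  have n2h : 2 * h0 ^+ 2 != 0 by rewrite mulf_neq0 ?expf_neq0.
  apply/subr0_eq; apply: (mulfI n2h); rewrite mulr0 -a1 -h23 -h01 h02; ring.
have E3 : h0 * h1 + h3 * h2 != 0.
  apply/eqP => e; have := congr2 *%R b1 (erefl h1).
  rewrite mul0r (_ : (h0 * h2 + h1 * h3) * h1 =
    h2 * (h0 * h1 + h3 * h2) + h3 * (h1 ^+ 2 - h2 ^+ 2)); last by ring.
  rewrite e mulr0 add0r -h01 h02 opprK => /eqP.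
  rewrite mulf_eq0 (negPf nh3) /= => h0z.
  by move: h0z; apply/negP; apply: dbl; rewrite expf_neq0.
have {b3}kk : k0 * k1 = k3 * k2.
  by apply/eqP; rewrite -subr_eq0; move/eqP: b3; rewrite mulf_eq0 (negPf E3).
have : (k0 ^+ 2 - k2 ^+ 2) * (k0 ^+ 2 + k3 ^+ 2) = 0.
  have e : k1 ^+ 2 = k0 ^+ 2 - k2 ^+ 2 + k3 ^+ 2.
    by rewrite -[LHS](subKr (k0 ^+ 2)) -k0123; ring.
  transitivity (k0 ^+ 2 * k1 ^+ 2 - k3 ^+ 2 * k2 ^+ 2); first by rewrite e; ring.
  by rewrite -!exprMn kk subrr.
move/eqP; rewrite mulf_eq0 subr_eq0 (negPf k02) /= addr_eq0 => /eqP e.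
by case/eqP: kh03; rewrite !expr_div_n e -h23 h02 invrN mulrN mulNr.
Qed.

(* The signs are those of the multiplication table of the quaternions. *)
Lemma quaternion_obstruction (h0 h1 h2 h3 k0 k1 k2 k3 : K)
    (f0 f1 f2 f3 n0 n1 n2 n3 g0 g1 g2 g3 : K) :
  [/\ h0 != 0, h1 != 0, h2 != 0 & h3 != 0] ->
  [/\ f0 != 0, f1 != 0, f2 != 0 & f3 != 0] ->
  uniq [:: k0 ^+ 2; k1 ^+ 2; k2 ^+ 2; k3 ^+ 2] ->
  uniq [:: (k0 / h0) ^+ 2; (k1 / h1) ^+ 2; (k2 / h2) ^+ 2; (k3 / h3) ^+ 2] ->
  [/\ f0 * h0 + n0 * k0 = g0, - (f1 * h1) + n1 * k1 = g0,
      - (f2 * h2) + n2 * k2 = g0 & - (f3 * h3) + n3 * k3 = g0] ->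
  [/\ f0 * h1 + n0 * k1 = g1, f1 * h0 + n1 * k0 = g1,
      f2 * h3 + n2 * k3 = g1 & - (f3 * h2) + n3 * k2 = g1] ->
  [/\ f0 * h2 + n0 * k2 = g2, - (f1 * h3) + n1 * k3 = g2,
      f2 * h0 + n2 * k0 = g2 & f3 * h1 + n3 * k1 = g2] ->
  [/\ f0 * h3 + n0 * k3 = g3, f1 * h2 + n1 * k2 = g3,
      - (f2 * h1) + n2 * k1 = g3 & f3 * h0 + n3 * k0 = g3] -> False.
Proof.
move=> [nh0 nh1 nh2 nh3] [nf0 nf1 nf2 nf3].
rewrite /= !inE !negb_or !andbT => /and3P[/and3P[k01 k02 k03] /andP[k12 k13] k23].
move=> /and3P[/and3P[t01 t02 t03] /andP[t12 t13] t23].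
move=> [a0 a1 a2 a3] [b0 b1 b2 b3] [c0 c1 c2 c3] [d0 d1 d2 d3].
have [A1 B1] : _ /\ _ := pair_rows nf0 nf2 (And4 a0 a1 a2 a3) (And4 b0 b1 b2 b3)
  (And4 c0 c1 c2 c3) (And4 d0 d1 d2 d3).
(* The system is invariant under the cyclic permutation of the indices 1, 2, 3, which produces the
   other two pairings. *)
have [A2 B2] : _ /\ _ := pair_rows nf0 nf3 (And4 a0 a2 a3 a1) (And4 c0 c2 c3 c1)
  (And4 d0 d2 d3 d1) (And4 b0 b2 b3 b1).
have [A3 B3] : _ /\ _ := pair_rows nf0 nf1 (And4 a0 a3 a1 a2) (And4 d0 d3 d1 d2)
  (And4 b0 b3 b1 b2) (And4 c0 c3 c1 c2).
(* Two vanishing factors in [k] contradict the distinctness of the squares; so of the three products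
   at least two vanish through their factor in [h]. *)
have kk (x y z w : K) : x ^+ 2 != y ^+ 2 -> z ^+ 2 != w ^+ 2 ->
    x * z - y * w = 0 -> x * w - z * y = 0 -> False.
  move=> xy zw e1 e2; case/eqP: zw; apply/eqP.
  have : (x + y) * (z - w) = 0 by rewrite -(subrr 0) -{1}e1 -e2; ring.
  move/eqP; rewrite mulf_eq0 subr_eq0 addr_eq0 => /orP[/eqP e|/eqP -> //].
  by case/eqP: xy; rewrite e sqrrN.
move/eqP: (B1); rewrite mulf_eq0 => /orP[/eqP h1v|/eqP k1v];
  move/eqP: (B2); rewrite mulf_eq0 => /orP[/eqP h2v|/eqP k2v].
- exact: (two_h_vanish nh0 nh1 nh2 nh3 k02 t03 A1 A2 A3 h1v h2v B3).
- move/eqP: (B3); rewrite mulf_eq0 => /orP[/eqP h3v|/eqP k3v].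
    apply: (two_h_vanish nh0 nh3 nh1 nh2 k01 t02 A3 A1 A2 h3v _ B2).
    by rewrite -h1v; ring.
  by apply: (kk k0 k2 k3 k1 k02 _ k2v k3v); rewrite eq_sym.
- move/eqP: (B3); rewrite mulf_eq0 => /orP[/eqP h3v|/eqP k3v].
    apply: (two_h_vanish nh0 nh2 nh3 nh1 k03 t01 A2 A3 A1 h2v _ B1).
    by rewrite -h3v; ring.
  by apply: (kk k0 k3 k1 k2 k03 k12 k3v k1v).
by apply: (kk k0 k1 k2 k3 k01 k23 k1v k2v).
Qed.

End Quaternion.

Section NetAny.
Variables (K : fieldType) (G : zmodType) (P : 'I_3 -> G -> vec K).
Hypothesis netP : symnet P.
Variables t0 t1 t2 : 'I_3.
Hypotheses (t01 : t0 != t1) (t02 : t0 != t2) (t12 : t1 != t2).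

Definition line_through (x y z : G) (t : 'I_3) : G :=
  if t == t0 then x else if t == t1 then y else z.

Lemma line_throughE x y z : [/\ line_through x y z t0 = x,
  line_through x y z t1 = y & line_through x y z t2 = z].
Proof.
rewrite /line_through !eqxx (eq_sym t1) (negPf t01) (eq_sym t2) (negPf t02).
by rewrite (eq_sym t2) (negPf t12).
Qed.

Lemma line_through_sum x y z : x + y + z = 0 ->
  line_through x y z 0 + line_through x y z 1 + line_through x y z 2 = 0.
Proof.
move=> s; rewrite /line_through.
have s1 : y + x + z = 0 by rewrite (addrC y).
have s2 : x + z + y = 0 by rewrite addrAC.
have s3 : y + z + x = 0 by rewrite -s -[RHS]addrA [RHS]addrC.
have s4 : z + x + y = 0 by rewrite -s2 (addrC z).
have s5 : z + y + x = 0 by rewrite -s3 (addrC z).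
have e0 (i : 'I_3) : [|| i == 0, i == 1 | i == 2] by case: i => [[|[|[|i]]]].
by move: t01 t02 t12; case/or3P: (e0 t0) => /eqP ->; case/or3P: (e0 t1) => /eqP ->;
 case/or3P: (e0 t2) => /eqP ->.
Qed.

Lemma det3_col x y z : x + y + z = 0 -> det3 (P t0 x) (P t1 y) (P t2 z) = 0.
Proof.
move=> s; have [e0 e1 e2] := line_throughE x y z.
have := det3_net netP t0 t1 t2 (line_through_sum s).
by rewrite e0 e1 e2.
Qed.

Lemma det3_off x y z : x + y + z != 0 -> det3 (P t0 x) (P t1 y) (P t2 z) != 0.
Proof.
move=> s; have [e0 e1 e2] := line_throughE (- (y + z)) y z.
have := @det3_off_net _ _ _ netP (line_through (- (y + z)) y z) t0 t1 t2 x.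
rewrite e0 e1 e2; apply=> //; first by apply: line_through_sum; rewrite -addrA addNr.
by rewrite -subr_eq0 opprK addrA.
Qed.

End NetAny.

(** * Nets over the Klein four-group *)

Section Klein.
Variable K : fieldType.
Hypothesis two_neq0 : 2 != 0 :> K.

Definition klein := ('Z_2 * 'Z_2)%type.
Definition v1 : klein := (1, 0).
Definition v2 : klein := (0, 1).
Definition v3 : klein := (1, 1).

Lemma klein_ind (Q : klein -> Prop) : Q 0 -> Q v1 -> Q v2 -> Q v3 ->
  forall v, Q v.
Proof.
move=> q0 q1 q2 q3 [[[|[|i]] hi] [[|[|j]] hj]] //.
- by rewrite (_ : (_, _) = 0) //; congr pair; apply: val_inj.
- by rewrite (_ : (_, _) = v2) //; congr pair; apply: val_inj.
- by rewrite (_ : (_, _) = v1) //; congr pair; apply: val_inj.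
- by rewrite (_ : (_, _) = v3) //; congr pair; apply: val_inj.
Qed.

Lemma kleinxx (v : klein) : v + v = 0.
Proof. by elim/klein_ind: v; apply/eqP. Qed.

(** The character table of the Klein group, with characters indexed through the alternating form:
    this makes it symmetric and invariant under every automorphism. *)
Definition chi (w v : klein) : K :=
  if [|| w == 0, v == 0 | w == v] then 1 else -1.

Definition comb4 (k : klein -> K) (a : klein -> vec K) : vec K :=
  lc2 1 (lc2 (k 0) (a 0) (k v1) (a v1)) 1 (lc2 (k v2) (a v2) (k v3) (a v3)).

Lemma det3_comb4 k a s t : det3 (comb4 k a) s t =
  k 0 * det3 (a 0) s t + k v1 * det3 (a v1) s t + k v2 * det3 (a v2) s t
  + k v3 * det3 (a v3) s t.
Proof. by rewrite !det3_lc2 !mul1r addrA. Qed.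

Lemma det3_uvu (u v : vec K) : det3 u v u = 0.
Proof. by rewrite -det3_rot det3_uu. Qed.

Lemma vec_ext (u v : vec K) :
  (forall s t, det3 u s t = det3 v s t) -> u = v.
Proof.
move=> h; apply: vecP.
- by have := h (0, 1, 0) (0, 0, 1); rewrite /det3 /= => e;
    apply: etrans (etrans _ e) _; ring.
- by have := h (0, 0, 1) (1, 0, 0); rewrite /det3 /= => e;
    apply: etrans (etrans _ e) _; ring.
- by have := h (1, 0, 0) (0, 1, 0); rewrite /det3 /= => e;
    apply: etrans (etrans _ e) _; ring.
Qed.

Section Hadamard.
Variables a b c : klein -> vec K.
Hypothesis col : forall v w, det3 (a v) (b w) (c (v + w)) = 0.
Hypothesis off : forall v w u, v + w != u -> det3 (a v) (b w) (c u) != 0.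
Hypotheses (gen_ab : general a b) (gen_ac : general a c) (gen_ba : general b a).

(* Scaling [c v] to [al v *: a v - 2 *: b 0], the incidences of [b w] with
   [a v], [c (v + w)] make [b w] proportional to
   [al v *: a v + al (v + w) *: a (v + w) - 2 *: b 0]; comparing these for
   different [v] gives [\sum_v al v *: a v = 4 *: b 0]. *)
Lemma klein_hadamard : exists al : klein -> K,
  (forall v, al v != 0) /\
  forall w, exists2 l, l != 0 & b w = scale l (comb4 (fun v => chi w v * al v) a).
Proof.
pose al v := - 2 * det3 (c v) (b 0) (a (v + v1)) / det3 (a v) (c v) (a (v + v1)).
have neq v : v != v + v1 by rewrite -subr_eq0 opprD addrA subrr; elim/klein_ind: v.
have acn v : det3 (a v) (c v) (a (v + v1)) != 0.
  by rewrite -det3_rot gen_ac // eq_sym.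
have cbn v : det3 (c v) (b 0) (a (v + v1)) != 0.
  by rewrite det3_rot det3_eq0C off // addr0 eq_sym.
have abn v : det3 (a v) (b 0) (a (v + v1)) != 0.
  by rewrite -det3_rot gen_ab // eq_sym.
have aln v : al v != 0 by rewrite /al !mulf_neq0 ?invr_eq0 ?oppr_eq0.
pose A v := scale (al v) (a v).
have cE v : exists2 k, k != 0 & c v = scale k (lc2 1 (A v) (- 2) (b 0)).
  have [||p [q e]] := @vec_plane _ (a v) (b 0) (a (v + v1)) (c v) => //.
    by have := col v 0; rewrite addr0.
  have qn : q != 0.
    by apply: contraNneq (acn v) => q0; rewrite e q0 /det3 /=; apply/eqP; ring.
  exists (- q / 2); first by rewrite mulf_neq0 ?invr_eq0 ?oppr_eq0.
  have alE : al v = - 2 * p / q.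
    rewrite /al e; apply: (mulIf qn); rewrite divfK //.
    have -> : det3 (lc2 p (a v) q (b 0)) (b 0) (a (v + v1)) =
              p * det3 (a v) (b 0) (a (v + v1)) by rewrite /det3 /=; ring.
    have -> : det3 (a v) (lc2 p (a v) q (b 0)) (a (v + v1)) =
              q * det3 (a v) (b 0) (a (v + v1)) by rewrite /det3 /=; ring.
    by field; rewrite qn abn.
  by rewrite e /A alE; apply: vecP; rewrite /=; field; rewrite qn two_neq0.
have cE0 v s t : det3 s t (c v) = 0 -> det3 s t (A v) = 2 * det3 s t (b 0).
  have [k kn ->] := cE v => h; apply/subr0_eq; apply: (mulfI kn).
  by rewrite mulr0 -h /det3 /=; ring.
have Agen v v' : v != v' -> det3 (A v) (A v') (b 0) != 0.
  move=> ne; have -> : det3 (A v) (A v') (b 0) =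
    al v * al v' * det3 (a v) (a v') (b 0) by rewrite /det3 /=; ring.
  exact: mulf_neq0 (mulf_neq0 (aln v) (aln v')) (gen_ab 0 ne).
have bE v v' : v != v' -> exists2 x, x != 0 &
    b (v + v') = scale x (lc3 1 (A v) 1 (A v') (- 2) (b 0)).
  move=> ne; have D := Agen v v' ne.
  have e1 : det3 (A v) (b (v + v')) (A v') = 2 * det3 (A v) (b (v + v')) (b 0).
    apply: (cE0); rewrite det3_scale; have := col v (v + v').
    by rewrite addrA kleinxx add0r => ->; rewrite mulr0.
  have e2 : det3 (A v') (b (v + v')) (A v) = 2 * det3 (A v') (b (v + v')) (b 0).
    apply: (cE0); rewrite det3_scale; have := col v' (v + v').
    by rewrite addrCA kleinxx addr0 => ->; rewrite mulr0.
  have := vec_basis (b (v + v')) D.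
  set x := _ / _; set y := _ / _; set z := _ / _ => e.
  clearbody x y z; have ez : z = - 2 * x.
    move: e2; rewrite e => /eqP; rewrite -subr_eq0 => /eqP e2.
    by apply/subr0_eq/(mulIf D); rewrite mul0r -e2 /det3 /=; ring.
  have ey : y = x.
    move: e1; rewrite e ez => /eqP; rewrite -subr_eq0 => /eqP e1.
    apply/subr0_eq/(mulIf D)/(mulfI two_neq0).
    by rewrite mul0r mulr0 -[RHS]oppr0 -e1 /det3 /=; ring.
  exists x; last by rewrite e ez ey; apply: vecP; rewrite /=; ring.
  apply: contraNneq (abn v) => x0.
  have b0 : b (v + v') = (0, 0, 0).
    by rewrite e ez ey x0; apply: vecP; rewrite /=; ring.
  have := @gen_ba (v + v') (v + v' + v1) 0.
  by rewrite b0 neq /det3 /= => /(_ isT) /eqP[]; ring.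
have sumA (s t : vec K) : det3 (A 0) s t + det3 (A v1) s t + det3 (A v2) s t
    + det3 (A v3) s t = 4 * det3 (b 0) s t.
  have [x01 n01 e01] := bE 0 v1 isT; have [x23 n23 e23] := bE v2 v3 isT.
  have [x02 n02 e02] := bE 0 v2 isT; have [x13 n13 e13] := bE v1 v3 isT.
  have E1 : v2 + v3 = 0 + v1 by apply/eqP.
  have E2 : v1 + v3 = 0 + v2 by apply/eqP.
  rewrite E1 e01 in e23; rewrite E2 e02 in e13.
  (* [b v1] and [b v2] have two expressions each, from [0 + v1 = v2 + v3] and [0 + v2 = v1 + v3];
     [r1] and [r2] are their ratios, and [r1 = -1] is what the sum formula needs. *)
  pose r1 := x23 / x01; pose r2 := x13 / x02.
  have F1 s' t' : det3 (A 0) s' t' + det3 (A v1) s' t' - 2 * det3 (b 0) s' t' =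
     r1 * (det3 (A v2) s' t' + det3 (A v3) s' t' - 2 * det3 (b 0) s' t').
    apply: (mulfI n01); rewrite mulrA /r1 mulrCA divff // mulr1.
    have := congr1 (fun u => det3 u s' t') e23.
    rewrite (det3_scale x01) (det3_scale x23) !det3_lc3 => h.
    by apply: etrans (etrans _ h) _; ring.
  have F2 s' t' : det3 (A 0) s' t' + det3 (A v2) s' t' - 2 * det3 (b 0) s' t' =
     r2 * (det3 (A v1) s' t' + det3 (A v3) s' t' - 2 * det3 (b 0) s' t').
    apply: (mulfI n02); rewrite mulrA /r2 mulrCA divff // mulr1.
    have := congr1 (fun u => det3 u s' t') e13.
    rewrite (det3_scale x02) (det3_scale x13) !det3_lc3 => h.
    by apply: etrans (etrans _ h) _; ring.
  (* Against [A v1, A v2] both relations have the same left side and the same factor, nonzero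
     because [c v3] is off the line of [a v1] and [a v2]. *)
  have r12 : r1 = r2.
    have [k kn ce3] := cE v3.
    have D3 : det3 (A v3) (A v1) (A v2) - 2 * det3 (b 0) (A v1) (A v2) != 0.
      have := @gen_ac v1 v2 v3 isT; apply: contra => /eqP h.
      rewrite -(mulrI_eq0 _ (mulfI (aln v1))) -(mulrI_eq0 _ (mulfI (aln v2))) ce3.
      rewrite -[X in _ == X](mulr0 k) -h; apply/eqP; rewrite /A /det3 /=; ring.
    have G1 := F1 (A v1) (A v2); have G2 := F2 (A v1) (A v2).
    apply/subr0_eq/(mulIf D3); rewrite mul0r.
    move: G1 G2; rewrite !(det3_uvu, det3_uu) => G1 G2.
    transitivity (r1 * (0 + det3 (A v3) (A v1) (A v2) - 2 * det3 (b 0) (A v1) (A v2))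
      - r2 * (0 + det3 (A v3) (A v1) (A v2) - 2 * det3 (b 0) (A v1) (A v2))).
      by ring.
    by rewrite -G1 -G2; ring.
  (* Subtracting the two relations leaves [1 + r1] times [A v1 - A v2]. *)
  have r1N : r1 = -1.
    have D12 := Agen v1 v2 isT.
    have G1 := F1 (A v2) (b 0); have G2 := F2 (A v2) (b 0).
    move: G1 G2; rewrite -r12 !(det3_uvu, det3_uu) => G1 G2.
    apply/subr0_eq/(mulIf D12); rewrite mul0r.
    transitivity ((det3 (A 0) (A v2) (b 0) + det3 (A v1) (A v2) (b 0) - 2 * 0)
      - (det3 (A 0) (A v2) (b 0) + 0 - 2 * 0)
      + r1 * (det3 (A v1) (A v2) (b 0) + det3 (A v3) (A v2) (b 0) - 2 * 0)
      - r1 * (0 + det3 (A v3) (A v2) (b 0) - 2 * 0)); first by ring.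
    by rewrite G1 G2; ring.
  have := F1 s t; rewrite r1N => /eqP; rewrite -subr_eq0 => /eqP h.
  by apply/subr0_eq; rewrite -h; ring.
have four_neq0 : 4 != 0 :> K.
  by rewrite (_ : 4 = 2 * 2) ?mulf_neq0 //; ring.
have AE v s t : det3 (A v) s t = al v * det3 (a v) s t by rewrite det3_scale.
exists al; split=> // w.
(* As [4 b 0] is the sum of all [A u], the vector [2 (A 0 + A v - 2 b 0)] is that sum with the signs
   reversed for the two [u] different from 0 and [v]: the row [chi v]. *)
have hw v l : 0 != v -> l != 0 -> b (0 + v) = scale l (lc3 1 (A 0) 1 (A v) (- 2) (b 0)) ->
    (forall s t, 2 * (det3 (A 0) s t + det3 (A v) s t - 2 * det3 (b 0) s t) =
       det3 (comb4 (fun u => chi v u * al u) a) s t) ->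
    exists2 l, l != 0 & b v = scale l (comb4 (fun u => chi v u * al u) a).
  move=> v0 ln; rewrite add0r => e h; exists (l / 2).
    by rewrite mulf_neq0 ?invr_eq0.
  rewrite e; apply: vec_ext => s t; rewrite !(det3_scale l) !(det3_scale (l / 2)) -h.
  by rewrite det3_lc3; field; exact: two_neq0.
elim/klein_ind: w.
- exists (4^-1); first by rewrite invr_eq0.
  apply: vec_ext => s t; rewrite (det3_scale 4^-1) det3_comb4 /chi /= !mul1r -!AE sumA.
  by rewrite mulKf.
- have [x nx e] := bE 0 v1 isT; apply: (hw v1 x) => // s t.
  rewrite det3_comb4 /chi /= !mul1r !mulNr !mul1r -!AE.
  by rewrite mulrBr mulrA (_ : 2 * 2 = 4) -?sumA; ring.
- have [x nx e] := bE 0 v2 isT; apply: (hw v2 x) => // s t.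
  rewrite det3_comb4 /chi /= !mul1r !mulNr !mul1r -!AE.
  by rewrite mulrBr mulrA (_ : 2 * 2 = 4) -?sumA; ring.
- have [x nx e] := bE 0 v3 isT; apply: (hw v3 x) => // s t.
  rewrite det3_comb4 /chi /= !mul1r !mulNr !mul1r -!AE.
  by rewrite mulrBr mulrA (_ : 2 * 2 = 4) -?sumA; ring.
Qed.

End Hadamard.
End Klein.

Section Triangle.
Variable K : fieldType.
Hypothesis two_neq0 : 2 != 0 :> K.
Local Notation "0v" := ((0, 0, 0) : vec K).

Lemma chi2 w v : chi K w v ^+ 2 = 1.
Proof. by rewrite /chi; case: ifP; rewrite ?sqrrN expr1n. Qed.

Section Relations.
Variables a b : klein -> vec K.
Hypothesis gen_ab : general a b.
Hypothesis hadamard : forall w, exists2 l, l != 0 & b w = scale l (comb4 (chi K w) a).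

(** If the coefficients at [i] and [j] have the ratio that they have in [b w], a multiple of the
    relation cancels both terms of [b w] and puts [b w] on the line through [a p] and [a q], against
    generality. Hence both vanish, and generality then kills the other two. The hypothesis [split4]
    lists the four labels in a chosen order. *)
Lemma relation_pair (k : klein -> K) (i j p q w : klein) :
  (forall k s t, det3 (comb4 k a) s t = k i * det3 (a i) s t +
     k j * det3 (a j) s t + k p * det3 (a p) s t + k q * det3 (a q) s t) ->
  p != q -> comb4 k a = 0v -> k i = chi K w i * chi K w j * k j ->
  [/\ k i = 0, k j = 0, k p = 0 & k q = 0].
Proof.
move=> split4 pq rel kij; have [l ln e] := hadamard w.
have D := gen_ab w pq; have relD s t : det3 (comb4 k a) s t = 0.
  by rewrite rel /det3 /=; ring.
have kj : k j = 0.
  apply: contraNeq D => kjn; rewrite -det3_rot e det3_scale split4.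
  rewrite det3_uu det3_uvu !mulr0 !addr0; apply/eqP.
  apply: (mulfI (mulf_neq0 kjn (_ : chi K w j != 0))).
    by rewrite -sqrf_eq0 chi2 oner_neq0.
  rewrite mulr0; transitivity (l * (k i * det3 (a i) (a p) (a q)
    + chi K w j ^+ 2 * k j * det3 (a j) (a p) (a q))); first by rewrite kij; ring.
  have := relD (a p) (a q); rewrite split4 det3_uu det3_uvu !mulr0 !addr0 chi2.
  by rewrite mul1r => ->; rewrite mulr0.
have ki : k i = 0 by rewrite kij kj mulr0.
split=> //.
  apply: (mulIf D); have := relD (a q) (b w).
  by rewrite split4 ki kj det3_uu !mul0r !add0r mulr0 addr0.
have := relD (a p) (b w).
rewrite split4 ki kj det3_uu !mul0r !add0r mulr0 add0r det3C => /eqP.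
by rewrite mulrN oppr_eq0 mulf_eq0 (negPf D) orbF => /eqP.
Qed.

(** For any two labels, [chi w i * chi w j] takes both signs as [w] varies, so [relation_pair]
    excludes [k i = k j] as well as [k i = - k j]. *)
Lemma relation_sqr_uniq (k : klein -> K) : comb4 k a = 0v ->
  (exists v, k v != 0) ->
  uniq [:: k 0 ^+ 2; k v1 ^+ 2; k v2 ^+ 2; k v3 ^+ 2].
Proof.
move=> rel [v kv].
have main i j p q w w' : uniq [:: i; j; p; q] ->
    chi K w i * chi K w j = 1 -> chi K w' i * chi K w' j = -1 ->
  (forall k s t, det3 (comb4 k a) s t = k i * det3 (a i) s t +
     k j * det3 (a j) s t + k p * det3 (a p) s t + k q * det3 (a q) s t) ->
    k i ^+ 2 != k j ^+ 2.
  move=> un c1 c2 sp; apply: contra kv; rewrite eqf_sqr => kij.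
  have pq : p != q by move: un; rewrite /= !inE; case: (p == q); rewrite ?andbF.
  have [k0 k1 k2 k3] : [/\ k i = 0, k j = 0, k p = 0 & k q = 0].
    case/orP: kij => /eqP e.
      by apply: (relation_pair sp pq rel (w := w)); rewrite c1 mul1r.
    by apply: (relation_pair sp pq rel (w := w')); rewrite c2 mulN1r.
  have : v \in [:: i; j; p; q].
    have /subset_cardP : #|[:: i; j; p; q]| = #|{: klein}|.
      by rewrite (card_uniqP un) card_prod !card_ord.
    by move/(_ (subset_predT _)) => ->.
  by rewrite !inE => /or4P[] /eqP ->; rewrite ?k0 ?k1 ?k2 ?k3.
rewrite /= !inE !negb_or !andbT.
rewrite (main 0 v1 v2 v3 0 v2) ?(main 0 v2 v1 v3 0 v1) ?(main 0 v3 v1 v2 0 v1)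
 ?(main v1 v2 0 v3 0 v1) ?(main v1 v3 0 v2 0 v1) ?(main v2 v3 0 v1 0 v2) //;
 try (by move=> k' s t; rewrite det3_comb4; ring);
 by rewrite /chi /= ?mulr1 ?mul1r ?mulrN1 ?mulNr ?mulr1 ?opprK.
Qed.

(** The combination of the two relations with equal coefficients at [v2] and [v3] must be zero by
    [relation_sqr_uniq]. *)
Lemma relation_unique (k k' : klein -> K) : comb4 k a = 0v ->
  (exists v, k v != 0) -> comb4 k' a = 0v -> exists r, forall v, k' v = r * k v.
Proof.
move=> rk nk rk'; have /and4P[_ _ h _] := relation_sqr_uniq rk nk.
have kn : k v2 - k v3 != 0.
  rewrite subr_eq0; apply: contraTneq h => e.
  by rewrite inE e eqxx.
pose k2 v := (k v2 - k v3) * k' v - (k' v2 - k' v3) * k v.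
have rel2 : comb4 k2 a = 0v.
  have E : comb4 k2 a = lc2 (k v2 - k v3) (comb4 k' a) (- (k' v2 - k' v3)) (comb4 k a).
    by rewrite /k2; apply: vecP; rewrite /=; ring.
  by rewrite E rk rk'; apply: vecP; rewrite /=; ring.
exists ((k' v2 - k' v3) / (k v2 - k v3)) => v; apply: (mulfI kn).
rewrite mulrA mulrCA divff // mulr1; apply/eqP; rewrite -subr_eq0 -/(k2 v).
apply: contraT => k2v.
have /and4P[_ _ + _] := relation_sqr_uniq rel2 (ex_intro _ v k2v).
rewrite inE (_ : k2 v2 = k2 v3) ?eqxx // /k2; ring.
Qed.

End Relations.

Lemma relation_exists (a : klein -> vec K) t : det3 (a 0) (a v1) t != 0 ->
  exists k, comb4 k a = 0v /\ exists v, k v != 0.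
Proof.
move=> D; have N1 : -1 != 0 :> K by rewrite oppr_eq0 oner_neq0.
have [D2|D2] := eqVneq (det3 (a 0) (a v1) (a v2)) 0.
  have [x [y e]] := vec_plane D D2.
  exists (fun v => if v == v2 then -1 else if v == 0 then x
                   else if v == v1 then y else 0); split; last by exists v2.
  by rewrite /comb4 /= e; apply: vecP; rewrite /=; ring.
have e := vec_basis (a v3) D2; move: e.
set x := _ / _; set y := _ / _; set z := _ / _ => e.
exists (fun v => if v == v3 then -1 else if v == 0 then x
                 else if v == v1 then y else z); split; last by exists v3.
by rewrite /comb4 /= e; apply: vecP; rewrite /=; ring.
Qed.

Lemma comb4_scale (k al : klein -> K) a :
  comb4 (fun v => k v * al v) a = comb4 k (fun v => scale (al v) (a v)).
Proof. by apply: vecP; rewrite /=; ring. Qed.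

Lemma general_scale (I J : eqType) (al : I -> K) (a : I -> vec K) (b : J -> vec K) :
  (forall v, al v != 0) -> general a b -> general (fun v => scale (al v) (a v)) b.
Proof.
move=> aln gab x x' y ne.
have -> : det3 (scale (al x) (a x)) (scale (al x') (a x')) (b y) =
  al x * al x' * det3 (a x) (a x') (b y) by rewrite /det3 /=; ring.
exact: mulf_neq0 (mulf_neq0 (aln x) (aln x')) (gab _ _ _ ne).
Qed.

Lemma klein_net_hadamard (P : 'I_3 -> klein -> vec K) (t t' t'' : 'I_3) :
  symnet P -> t != t' -> t != t'' -> t' != t'' ->
  exists (al l : klein -> K), [/\ forall v, al v != 0, forall v, l v != 0 &
    forall w, P t' w = scale (l w) (comb4 (fun v => chi K w v * al v) (P t))].
Proof.
move=> netP h1 h2 h3.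
have [|||||al [aln /fin_all_exists2[l ln e]]] :=
    @klein_hadamard K two_neq0 (P t) (P t') (P t'').
- move=> v w; apply: (det3_col netP) => //; exact: kleinxx.
- move=> v w u ne; apply: (det3_off netP) => //.
  by apply: contra ne; rewrite addr_eq0 => /eqP ->;
    rewrite -[_ == _]subr_eq0 -opprD kleinxx oppr0.
- exact: (net_gen netP).
- exact: (net_gen netP).
- by apply: (net_gen netP); rewrite eq_sym.
by exists al, l.
Qed.

Definition turn (v : klein) : klein :=
  if v == v1 then v2 else if v == v2 then v3 else if v == v3 then v1 else 0.

(** Two routes lead from the first component to the points of [Q 2]: directly by [Q], or through the
    second component by [P] and then [R]. For each point the two descriptions differ by a multiple
    of the unique relation among the points of the first component; these are the 16 equations of
    [quaternion_obstruction]. *)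
Lemma klein_triangle (P Q R : 'I_3 -> klein -> vec K) :
  symnet P -> symnet Q -> symnet R -> P 0 =1 Q 0 -> P 1 =1 R 1 ->
  (forall u, Q 2 (turn u) = R 2 u) -> False.
Proof.
move=> netP netQ netR a_eq b_eq c_eq.
have [//|//|//|al [l [aln ln bE]]] := @klein_net_hadamard P 0 1 2 netP.
have [//|//|//|al' [m [al'n mn cE]]] := @klein_net_hadamard Q 0 2 1 netQ.
have [//|//|//|ep [n [_ nn cE']]] := @klein_net_hadamard R 1 2 0 netR.
pose a v := scale (al v) (P 0 v); pose h v := al' v / al v.
pose a' v := scale (al' v) (P 0 v).
have hn v : h v != 0 by rewrite mulf_neq0 ?invr_eq0.
have bE1 w : P 1 w = scale (l w) (comb4 (chi K w) a).
  by rewrite bE comb4_scale.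
have cE1 w : Q 2 w = scale (m w) (comb4 (chi K w) a').
  by rewrite cE comb4_scale /a' /comb4 -!a_eq.
have hE v : al' v = h v * al v by rewrite /h divfK.
have cE2 w : Q 2 w = scale (m w) (comb4 (fun v => chi K w v * h v) a).
  by rewrite cE /comb4 -!a_eq !hE; congr scale; apply: vecP; rewrite /=; ring.
have gab : general a (P 1) by apply: general_scale => //; apply: (net_gen netP).
have gac : general a' (Q 2).
  by move=> x x' y ne; rewrite /a' !a_eq; apply: (general_scale al'n) => //;
     apply: (net_gen netQ).
have hb w : exists2 l, l != 0 & P 1 w = scale l (comb4 (chi K w) a) by exists (l w).
have hc w : exists2 l, l != 0 & Q 2 w = scale l (comb4 (chi K w) a') by exists (m w).
have [k [rk nk]] : exists k, comb4 k a = 0v /\ exists v, k v != 0.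
  by apply: (relation_exists (t := P 1 0)); apply: gab.
have U1 := relation_sqr_uniq gab hb rk nk.
(* Dividing [k] by [h] turns it into the relation among the vectors scaled by [al']. *)
have U2 := @relation_sqr_uniq _ _ gac hc (fun v => k v / h v).
have {}U2 : uniq [:: (k 0 / h 0) ^+ 2; (k v1 / h v1) ^+ 2; (k v2 / h v2) ^+ 2;
    (k v3 / h v3) ^+ 2].
  apply: U2; last by case: nk => v kv; exists v; rewrite mulf_neq0 ?invr_eq0.
  rewrite -rk; have E v : k v / h v * al' v = k v * al v.
    by rewrite /h; field; rewrite al'n aln.
  by apply: vecP; rewrite /= !mulrA !E.
pose d w := ep w * l w.
(* [g] is the transform of [d] by the character table; composing two tables multiplies characters,
   hence the translate [u + v] below. *)
pose g x := chi K 0 x * d 0 + chi K v1 x * d v1 + chi K v2 x * d v2 + chi K v3 x * d v3.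
have rel u : comb4 (fun v => n u * g (u + v)
    - m (turn u) * (chi K (turn u) v * h v)) a = 0v.
  have e : scale (n u) (comb4 (fun v => chi K u v * ep v) (P 1)) =
           scale (m (turn u)) (comb4 (fun v => chi K (turn u) v * h v) a).
    by rewrite -cE2 c_eq cE' /comb4 -!b_eq.
  have addv : [/\ v1 + v1 = 0, v1 + v2 = v3, v1 + v3 = v2 & v2 + v1 = v3] /\
    [/\ v2 + v2 = 0, v2 + v3 = v1, v3 + v1 = v2, v3 + v2 = v1 & v3 + v3 = 0].
    by do 2 split; apply/eqP.
  apply: vec_ext => s t; have := congr1 (fun q => det3 q s t) e => {}e.
  apply/eqP; rewrite det3_comb4; have -> : det3 0v s t = 0 by rewrite /det3 /=; ring.
  have e0 : det3 (scale (n u) (comb4 (fun v => chi K u v * ep v) (P 1))) s t -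
    det3 (scale (m (turn u)) (comb4 (fun v => chi K (turn u) v * h v) a)) s t = 0.
    by rewrite e subrr.
  rewrite -[X in _ == X]e0 !(det3_scale (n u)) !(det3_scale (m _)) !det3_comb4.
  rewrite !bE1 !(det3_scale (l _)) !det3_comb4 /g /d; apply/eqP.
  case: addv => [[a11 a12 a13 a21] [a22 a23 a31 a32 a33]].
  by elim/klein_ind: u {e e0}; rewrite ?addr0 ?add0r ?a11 ?a12 ?a13 ?a21 ?a22 ?a23
    ?a31 ?a32 ?a33 /chi /=; ring.
have eqn u : exists r, forall v,
    m (turn u) / n u * (chi K (turn u) v * h v) + r * k v = g (u + v).
  have [r hr] := relation_unique gab hb rk nk (rel u).
  exists (r / n u) => v; apply: (mulfI (nn u)).
  transitivity (n u * g (u + v) - (n u * g (u + v)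
     - m (turn u) * (chi K (turn u) v * h v))
     + r * k v); last by rewrite -hr; ring.
  by field.
have [r0 q0] := eqn 0; have [r1 q1] := eqn v1.
have [r2 q2] := eqn v2; have [r3 q3] := eqn v3.
pose f u := m (turn u) / n u.
have fn u : f u != 0 by rewrite mulf_neq0 ?invr_eq0.
have [a12 a13 a21 a23] : [/\ v1 + v2 = v3, v1 + v3 = v2, v2 + v1 = v3 & v2 + v3 = v1].
  by split; apply/eqP.
have [a31 a32] : v3 + v1 = v2 /\ v3 + v2 = v1 by split; apply/eqP.
apply: (@quaternion_obstruction K two_neq0 (h 0) (h v1) (h v2) (h v3) (k 0) (k v1)
  (k v2) (k v3) (f 0) (f v1) (f v2) (f v3) r0 r1 r2 r3 (g 0) (g v1) (g v2) (g v3)) => //;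
  split.
all: first [ by have := q0 0; rewrite addr0 => <-; rewrite /chi /= /f; ring
  | by have := q0 v1; rewrite add0r => <-; rewrite /chi /= /f; ring
  | by have := q0 v2; rewrite add0r => <-; rewrite /chi /= /f; ring
  | by have := q0 v3; rewrite add0r => <-; rewrite /chi /= /f; ring
  | by have := q1 0; rewrite addr0 => <-; rewrite /chi /= /f; ring
  | by have := q1 v1; rewrite kleinxx => <-; rewrite /chi /= /f; ring
  | by have := q1 v2; rewrite a12 => <-; rewrite /chi /= /f; ring
  | by have := q1 v3; rewrite a13 => <-; rewrite /chi /= /f; ring
  | by have := q2 0; rewrite addr0 => <-; rewrite /chi /= /f; ring
  | by have := q2 v1; rewrite a21 => <-; rewrite /chi /= /f; ring
  | by have := q2 v2; rewrite kleinxx => <-; rewrite /chi /= /f; ring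
  | by have := q2 v3; rewrite a23 => <-; rewrite /chi /= /f; ring
  | by have := q3 0; rewrite addr0 => <-; rewrite /chi /= /f; ring
  | by have := q3 v1; rewrite a31 => <-; rewrite /chi /= /f; ring
  | by have := q3 v2; rewrite a32 => <-; rewrite /chi /= /f; ring
  | by have := q3 v3; rewrite kleinxx => <-; rewrite /chi /= /f; ring].
Qed.

End Triangle.

Lemma small_prime_neq0 (K : fieldType) p q : has_char K p -> p = 0%N \/ (5 <= p)%N ->
  prime q -> (q < 5)%N -> q%:R != 0 :> K.
Proof.
move=> hp hp5 pq q5; apply/negP => q0.
have qc : q \in [pchar K] by rewrite inE pq.
case: hp5 hp => [-> /(_ q)|p5]; first by rewrite qc.
case: p p5 => // p p5 /= pc; move: q5; rewrite ltnNge => /negP[].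
by move: (pcharf_eq pc) => /(_ q); rewrite qc inE /= => /esym /eqP ->.
Qed.

(** * Cosets of V_4 in Alt_4 *)

Section Alt4.

Definition double_transposition (v : klein) : {perm 'I_4} :=
  if v == v1 then (tperm 0%R 1%R * tperm 2%R 3%R)%g
  else if v == v2 then (tperm 0%R 2%R * tperm 1%R 3%R)%g
  else if v == v3 then (tperm 0%R 3%R * tperm 1%R 2%R)%g else 1%g.

Definition three_cycle : {perm 'I_4} := (tperm 1%R 3%R * tperm 1%R 2%R)%g.

Lemma double_transposition_Alt v : double_transposition v \in ('Alt_('I_4))%g.
Proof.
rewrite Alt_even; elim/klein_ind: v; rewrite /double_transposition /=.
all: by rewrite ?odd_perm1 ?odd_permM ?odd_tperm.
Qed.

Lemma three_cycle_Alt : three_cycle \in ('Alt_('I_4))%g.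
Proof. by rewrite Alt_even odd_permM !odd_tperm. Qed.

Lemma double_transposition_inj : injective double_transposition.
Proof.
move=> u v /(congr1 (fun s : {perm 'I_4} => s 0%R)).
by elim/klein_ind: u; elim/klein_ind: v;
  rewrite /double_transposition /= ?permM ?perm1 ?permE.
Qed.

Lemma double_transpositionD u v : (double_transposition u * double_transposition v)%g =
  double_transposition (u + v).
Proof.
have [a12 a13 a23] : [/\ v1 + v2 = v3, v1 + v3 = v2 & v2 + v3 = v1] by split; apply/eqP.
apply/permP => i; elim/klein_ind: u; elim/klein_ind: v;
 rewrite ?addr0 ?add0r ?kleinxx ?(addrC v3 v1) ?(addrC v3 v2) ?(addrC v2 v1)
   ?a12 ?a13 ?a23 /double_transposition /= ?permM ?perm1 ?permE //;
 case: i => [[|[|[|[|i]]]] hi] //; rewrite ?permE /=.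
all: try by apply: val_inj.
Qed.

Lemma three_cycle_conj v : (three_cycle * double_transposition v)%g =
  (double_transposition (turn v) * three_cycle)%g.
Proof.
apply/permP => i; elim/klein_ind: v; rewrite /turn /double_transposition /three_cycle /=.
all: rewrite ?mulg1 ?mul1g ?permM ?permE //; case: i => [[|[|[|[|i]]]] hi] //.
all: rewrite ?permE /= ?permE /=; try by apply: val_inj.
Qed.

Lemma alt4_not_realized (K : fieldType) n (L : 'I_3 -> {fset point K}) :
  2 != 0 :> K -> dual_3net n L -> ~ realizes L ('Alt_('I_4))%G.
Proof.
move=> two_neq0 netL /realizes_labelling[lab labP].
pose e := double_transposition; pose s := three_cycle.
have eA v : e v \in ('Alt_('I_4))%G := double_transposition_Alt v.
have sA : s \in ('Alt_('I_4))%G := three_cycle_Alt.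
have eD u v : (e u * e v)%g = e (u + v) := double_transpositionD u v.
have es v : (s * e v)%g = (e (turn v) * s)%g := three_cycle_conj v.
have sum0 (x y z : klein) : x + y + z = 0 -> z = x + y.
  move/eqP; rewrite addr_eq0 => /eqP ->.
  by apply/eqP; rewrite -addr_eq0 kleinxx.
have inj_l : injective e := double_transposition_inj.
have inj_r : injective (fun v => e v * s)%g by move=> x y /mulIg /inj_l.
have turn_inj : injective turn.
  by move=> x y; elim/klein_ind: x; elim/klein_ind: y.
have turnD x y : turn (x + y) = turn x + turn y.
  by elim/klein_ind: x; elim/klein_ind: y; apply/eqP.
pose P := fun t v => vpt (lab t (e v)).
pose Q := fun t v => vpt (lab t (if t == 0%R then e v else e v * s)%g).
(* Since [s] conjugates [e v] to [e (turn v)], labelling the two cosets Vs through [turn] makes the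
   products additive and matches [R 2 u] with [Q 2 (turn u)]. *)
pose R := fun t v => vpt (lab t (if t == 1%R then e v else e (turn v) * s)%g).
have netP : symnet P.
  apply: (symnet_lab netL labP (f := fun _ => e)) => // x y z /sum0 ->.
  exact: double_transpositionD.
have netQ : symnet Q.
  apply: (symnet_lab netL labP (f := fun t v => if t == 0%R then e v else e v * s)%g).
  - by move=> t x y; case: ifP => _; [apply: inj_l|apply: inj_r].
  - by move=> t v; case: ifP => _; rewrite ?eA // groupM ?eA ?sA.
  by move=> x y z /sum0 -> /=; rewrite -eD mulgA.
have netR : symnet R.
  apply: (symnet_lab netL labP
    (f := fun t v => if t == 1%R then e v else e (turn v) * s)%g).
  - by move=> t x y; case: ifP => _ h; [apply: inj_l|apply/turn_inj/inj_r].
  - by move=> t v; case: ifP => _; rewrite ?eA // groupM ?eA ?sA.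
  move=> x y z /sum0 -> /=; rewrite turnD -eD.
  by rewrite -[LHS]mulgA -[RHS]mulgA; congr (_ * _)%g; apply: es.
exact: (klein_triangle two_neq0 netP netQ netR).
Qed.

End Alt4.

(** * The group C_3 x C_3 with a noncollinear coset *)

Section Pappus.
Variable K : fieldType.
Implicit Types b c d x : vec K.

Definition rotv x : vec K := (x.2, x.1.1, x.1.2).
Definition had d x : vec K := (d.1.1 * x.1.1, d.1.2 * x.1.2, d.2 * x.2).
(** On the torus this is (1/b0, 1/b2, 1/b1) up to a factor: the quadratic Cremona map followed by an
    exchange of coordinates. It is collinear with [b] and the first vertex of the triangle. *)
Definition dual b : vec K := (b.1.2 * b.2, b.1.1 * b.1.2, b.1.1 * b.2).
Definition cross x y : vec K :=
  (x.1.2 * y.2 - x.2 * y.1.2, x.2 * y.1.1 - x.1.1 * y.2,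
   x.1.1 * y.1.2 - x.1.2 * y.1.1).
Definition torus x := [&& x.1.1 != 0, x.1.2 != 0 & x.2 != 0].

Lemma det3_rotv x y z : det3 (rotv x) (rotv y) (rotv z) = det3 x y z.
Proof. rewrite /det3 /=; ring. Qed.

Lemma rot3 x : rotv (rotv (rotv x)) = x. Proof. by case: x => [[? ?] ?]. Qed.

Lemma torus_rot x : torus (rotv x) = torus x.
Proof. by rewrite /torus /=; case: (_ != 0); case: (_ != 0); case: (_ != 0). Qed.

Lemma concurrent a u0 w0 u1 w1 u2 w2 t s : det3 a t s != 0 ->
  det3 a u0 w0 = 0 -> det3 a u1 w1 = 0 -> det3 a u2 w2 = 0 ->
  det3 (cross u0 w0) (cross u1 w1) (cross u2 w2) = 0 :> K.
Proof.
move=> D e0 e1 e2; apply: contraNeq D => D.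
pose l0 := cross u0 w0; pose l1 := cross u1 w1; pose l2 := cross u2 w2.
have az i : i \in [:: (1, 0, 0); (0, 1, 0); (0, 0, 1)] ->
    det3 (cross u0 w0) (cross u1 w1) (cross u2 w2)
    * (i.1.1 * a.1.1 + i.1.2 * a.1.2 + i.2 * a.2) = 0.
  move=> _; transitivity (det3 a u0 w0 * det3 l1 l2 i + det3 a u1 w1 * det3 l2 l0 i
     + det3 a u2 w2 * det3 l0 l1 i).
    by rewrite /l0 /l1 /l2 /det3 /cross /=; ring.
  by rewrite e0 e1 e2; ring.
have := az (1, 0, 0); have := az (0, 1, 0); have := az (0, 0, 1).
rewrite !inE !eqxx ?orbT /= !mul0r !mul1r ?addr0 ?add0r.
move=> /(_ isT)/eqP h2 /(_ isT)/eqP h1 /(_ isT)/eqP h0.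
move: h0 h1 h2; rewrite !mulf_eq0 (negPf D) /= => /eqP h0 /eqP h1 /eqP h2.
by rewrite /det3 h0 h1 h2; apply/eqP; ring.
Qed.

(** A converse of [concurrent]: [D] and [D1] make the first two lines distinct, so [a] is their only
    common point. *)
Lemma concurrent_line a u0 w0 u1 w1 u2 w2 t : det3 u0 w0 t != 0 ->
  det3 u0 u1 w1 != 0 ->
  det3 a u0 w0 = 0 -> det3 a u1 w1 = 0 ->
  det3 (cross u0 w0) (cross u1 w1) (cross u2 w2) = 0 -> det3 a u2 w2 = 0 :> K.
Proof.
move=> D D1 e0 e1 e2; rewrite det3_rot in e0.
have [p [q e]] := vec_plane D e0; apply: (mulfI D1).
have {}e1 : p * det3 u0 u1 w1 = - (q * det3 w0 u1 w1).
  by apply/eqP; rewrite -addr_eq0 -e1 e det3_lc2.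
rewrite mulr0 e det3_lc2.
transitivity (p * det3 u0 u1 w1 * det3 u0 u2 w2
  + q * det3 u0 u1 w1 * det3 w0 u2 w2); first by ring.
by rewrite e1 -[RHS](mulr0 q) -[X in _ = _ * X]e2 /det3 /cross /=; ring.
Qed.

Definition rotn (j : 'Z_3) x : vec K := iter j rotv x.

(* For a net over C_3 x C_3, take the points of one coset of 0 x C_3 in the first
   component as coordinate triangle. Then a coset of points of the second
   component is an orbit of [rotv] up to a diagonal map, and the matching coset
   of the third component is the orbit of its [dual] up to the same map.
   A [pair_config] records two such pairs of cosets, with the diagonal map of the
   first pair normalized to 1; [a1] and [a2] are the cosets of the first
   component collinear with one coset of each pair. *)
Record pair_config b b' d (a1 a2 : 'Z_3 -> vec K) : Prop := PairConfig {
  pc_b : torus b; pc_b' : torus b'; pc_d : torus d;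
  pc_col1 : forall m j k, m + j + k = 0 ->
    det3 (a1 m) (rotn j b) (had d (rotn k (dual b'))) = 0;
  pc_col2 : forall m j k, m + j + k = 0 ->
    det3 (a2 m) (had d (rotn j b')) (rotn k (dual b)) = 0;
  pc_off1 : forall m j k, det3 (a1 m) (had d (rotn j b')) (rotn k (dual b)) != 0;
  pc_off2 : forall m j k, det3 (a2 m) (rotn j b) (had d (rotn k (dual b'))) != 0;
  pc_gen : forall j j' k, j != j' ->
    det3 (rotn j b) (rotn j' b) (had d (rotn k (dual b'))) != 0;
  pc_gen' : forall j k k', k != k' ->
    det3 (rotn j b) (had d (rotn k (dual b'))) (had d (rotn k' (dual b'))) != 0
}.

Lemma dual_rot b : dual (rotv b) = rotv (rotv (dual b)).
Proof. by apply: vecP; rewrite /=; ring. Qed.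

Lemma had_rot d x : had (rotv d) (rotv x) = rotv (had d x).
Proof. by []. Qed.

Lemma rotn_rot j x : rotn j (rotv x) = rotv (rotn j x).
Proof. by rewrite /rotn -iterS iterSr. Qed.

Lemma rotnS j x : rotn (j + 1) x = rotv (rotn j x).
Proof. by case: j => [[|[|[|j]]] hj] //=; rewrite ?rot3. Qed.

Lemma rotn_dual_rot k b : rotn k (dual (rotv b)) = rotv (rotn (k + 1) (dual b)).
Proof. by rewrite dual_rot !rotn_rot rotnS. Qed.

(** The cyclic symmetry of the coordinate triangle; it reduces the three factors in [pair_curves] to
    the single one treated in [pair_curve]. *)
Lemma pair_config_rot b b' d a1 a2 : pair_config b b' d a1 a2 ->
  pair_config (rotv b) (rotv b') (rotv d) (fun m => rotv (a1 (m - 1)))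
              (fun m => rotv (a2 (m - 1))).
Proof.
case=> tb tb' td c1 c2 o1 o2 g g'; split; rewrite ?torus_rot //.
- move=> m j k s; rewrite rotn_dual_rot rotn_rot had_rot det3_rotv c1 //.
  by rewrite -s; ring.
- move=> m j k s; rewrite rotn_dual_rot rotn_rot had_rot det3_rotv c2 //.
  by rewrite -s; ring.
- by move=> m j k; rewrite rotn_dual_rot rotn_rot had_rot det3_rotv.
- by move=> m j k; rewrite rotn_dual_rot rotn_rot had_rot det3_rotv.
- by move=> j j' k h; rewrite rotn_dual_rot !rotn_rot had_rot det3_rotv g.
- by move=> j k k' h; rewrite !rotn_dual_rot rotn_rot !had_rot det3_rotv g' //
    (inj_eq (addIr _)).
Qed.

(** In a [pair_config] with [c = dual b'], the index triples 0 2 1, 2 1 0 and 1 0 2 belong to the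
    lines through [a1 0], [a1 1] and [a1 2]. *)
Definition conc m0 m1 m2 b c d : K :=
  det3 (cross (rotn 0 b) (had d (rotn m0 c))) (cross (rotn 1 b) (had d (rotn m1 c)))
       (cross (rotn 2 b) (had d (rotn m2 c))).

(* The given determinant has the factor [t ^+ 4 - t]; what remains is a factor
   [R] common to both determinants. *)
Lemma conc_curve (t z : K) b c : conc 0 2 1 b c (t * z, t ^+ 2 * z, z) = 0 ->
  t != 0 -> t ^+ 3 != 1 -> z != 0 ->
  det3 (cross b (had (t * z, t ^+ 2 * z, z) c))
       (cross (rotv b) (had (t * z, t ^+ 2 * z, z) (rotv (rotv c))))
       (cross (had (t * z, t ^+ 2 * z, z) (dual c)) (dual b)) = 0.
Proof.
move=> e nt nt3 nz.
pose U (x : vec K) := [:: x.1.1 ^+ 2 * x.2; x.1.2 ^+ 2 * x.1.1; x.2 ^+ 2 * x.1.2].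
pose S n0 n1 n2 (x y : vec K) := (U x)`_n0 * (y.1.1 ^+ 2 * y.1.2)
  + (U x)`_n1 * (y.1.2 ^+ 2 * y.2) + (U x)`_n2 * (y.2 ^+ 2 * y.1.1).
pose R := t * (S 1 0 2 c b - S 2 1 0 c b) - (S 1 0 2 b c - S 2 1 0 b c).
have eR : z ^+ 3 * (t ^+ 4 - t) * R = 0.
  by rewrite -e /R /S /U /conc /det3 /cross /had /=; ring.
have R0 : R = 0.
  apply: (mulfI (_ : z ^+ 3 * (t ^+ 4 - t) != 0)); last by rewrite eR mulr0.
  rewrite mulf_neq0 ?expf_neq0 // (_ : t ^+ 4 - t = t * (t ^+ 3 - 1)); last by ring.
  by rewrite mulf_neq0 // subr_eq0.
transitivity (R * (z ^+ 3 * (b.1.2 * c.2 * t ^+ 2 - b.2 * c.1.2 * t ^+ 4))).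
  by rewrite /R /S /U /det3 /cross /had /dual /=; ring.
by rewrite R0 mul0r.
Qed.

End Pappus.

Section PairConfig.
Variable K : fieldType.
Implicit Types b c d x : vec K.

Lemma dual_dual b : dual (dual b) = scale (b.1.1 * b.1.2 * b.2) b.
Proof. by apply: vecP; rewrite /=; ring. Qed.

Lemma had_scale (z : K) d b : had d (scale z b) = scale z (had d b).
Proof. by apply: vecP; rewrite /=; ring. Qed.

(** On the torus: [d] is proportional to (1, e, e^2) with e^3 = 1, so that [had d] commutes with
    [rotv] up to a factor. *)
Definition trivial_ratio d :=
  [/\ d.1.1 ^+ 2 = d.1.2 * d.2, d.1.2 ^+ 2 = d.1.1 * d.2
    & d.2 ^+ 2 = d.1.1 * d.1.2].

Lemma trivial_ratio_rot d : trivial_ratio (rotv d) -> trivial_ratio d.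
Proof. by case=> /= e0 e1 e2; split; rewrite ?e0 ?e1 ?e2 // mulrC. Qed.

(** Unless [d] is trivial, [conc_curve] puts [a1 0] on the line joining [had d b'] and [dual b],
    which [pc_off1] forbids. *)
Lemma pair_curve b b' d a1 a2 : pair_config b b' d a1 a2 ->
  d.1.1 ^+ 2 = d.1.2 * d.2 -> trivial_ratio d.
Proof.
case=> tb tb' td c1 _ o1 _ g _ e.
have /and3P[n0 n1 n2] := td.
pose z := d.2; pose t := d.1.1 / z.
have tz : t * z = d.1.1 by rewrite divfK.
have ttz : t ^+ 2 * z = d.1.2.
  by apply: (mulIf n2); rewrite -e -tz /z; ring.
have dE : d = (t * z, t ^+ 2 * z, z) by rewrite tz ttz /z; case: (d) => [[]].
have [t3|t3] := eqVneq (t ^+ 3) 1.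
  split=> //; rewrite -/z -tz -ttz.
    by transitivity (t * t ^+ 3 * z ^+ 2); [ring | rewrite t3; ring].
  by transitivity (t ^+ 3 * z ^+ 2); [rewrite t3; ring | ring].
have nt : t != 0 by rewrite mulf_neq0 ?invr_neq0.
have E : conc 0 2 1 b (dual b') d = 0.
  by apply: (concurrent (o1 0 0 0)); apply: c1; apply: val_inj.
rewrite dE in E; have {}E := conc_curve E nt t3 n2.
have s0 : 0 + 0 + 0 = 0 :> 'Z_3 by apply: val_inj.
have s1 : 0 + 1 + 2 = 0 :> 'Z_3 by apply: val_inj.
have h0 := c1 0 0 0 s0; have h1 := c1 0 1 2 s1.
have D := g 0 1 0 isT; rewrite -det3_rot det3C oppr_eq0 in D.
have := concurrent_line D (g 0 1 2 isT) h0 h1.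
rewrite {1 2}dE => /(_ _ _ E)/eqP; rewrite -dE dual_dual had_scale.
rewrite det3_rot det3_scale -det3_rot mulf_eq0 (negPf (o1 0 0 0)) orbF.
by case/and3P: tb' => /negPf m0 /negPf m1 /negPf m2; rewrite !mulf_eq0 m0 m1 m2.
Qed.

Lemma pair_curves b b' d a1 a2 : pair_config b b' d a1 a2 ->
  (d.1.1 ^+ 2 - d.1.2 * d.2) * (d.1.2 ^+ 2 - d.1.1 * d.2)
    * (d.2 ^+ 2 - d.1.1 * d.1.2) = 0 -> trivial_ratio d.
Proof.
move=> h /eqP; rewrite !mulf_eq0 !subr_eq0 -orbA => /or3P[] /eqP e.
- exact: pair_curve h e.
- do 2 apply: trivial_ratio_rot.
  apply: (pair_curve (pair_config_rot (pair_config_rot h))).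
  by rewrite /= e mulrC.
- apply: trivial_ratio_rot; apply: (pair_curve (pair_config_rot h)).
  by rewrite /= e mulrC.
Qed.

(* For a primitive cube root of unity [w], these are the Fourier coefficients
   at [w] of the [rotv]-orbits of the monomials x0^2 x2 and x0^2 x1. *)
Definition hatU w x : K := x.1.1 ^+ 2 * x.2 + w * (x.1.2 ^+ 2 * x.1.1)
  + w ^+ 2 * (x.2 ^+ 2 * x.1.2).
Definition hatV w x : K := x.1.1 ^+ 2 * x.1.2 + w * (x.1.2 ^+ 2 * x.2)
  + w ^+ 2 * (x.2 ^+ 2 * x.1.1).

Section Hats.
Variable w : K.
Hypothesis w2 : w ^+ 2 = - w - 1.

Lemma cube_omega : w ^+ 3 = 1.
Proof. by rewrite exprS w2; ring: w2. Qed.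

(** A Fourier transform over the three points of concurrence diagonalizes the cyclic shift and
    reduces the determinants to two products of one-vector coefficients. *)
Lemma hat_conc b c d :
  conc 0 2 1 b c d + w * conc 2 1 0 b c d + w ^+ 2 * conc 1 0 2 b c d =
  - (1 - w) * hatU w d * hatU w c * hatV w b
  + (1 - w ^+ 2) * hatV w d * hatU w b * hatV w c.
Proof.
by rewrite /conc /hatU /hatV /det3 /cross /had /=; ring: w2.
Qed.

Lemma hatU_dual b :
  hatU w (dual b) = b.1.1 * b.1.2 * b.2 * w ^+ 2 * hatU (w ^+ 2) b.
Proof. by rewrite /hatU /dual /=; ring: w2. Qed.

Lemma hatV_dual b :
  hatV w (dual b) = b.1.1 * b.1.2 * b.2 * w * hatV (w ^+ 2) b.
Proof. by rewrite /hatV /dual /=; ring: w2. Qed.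

Hypothesis w1 : w != 1.

Lemma omega_neq0 : w != 0.
Proof. by apply: contra_eq_neq cube_omega => ->; rewrite expr0n /= eq_sym oner_neq0. Qed.

Lemma hat_pair b b' d (a : 'Z_3 -> vec K) : torus b' ->
  (forall m, exists t s, det3 (a m) t s != 0) ->
  (forall m j k, m + j + k = 0 ->
     det3 (a m) (rotn j b) (had d (rotn k (dual b'))) = 0) ->
  hatU w d * (hatV w b * hatU (w ^+ 2) b')
  + w * hatV w d * (hatU w b * hatV (w ^+ 2) b') = 0.
Proof.
case/and3P=> n0 n1 n2 na h.
have cz m0 m1 m2 (m : 'Z_3) : m + 0 + m0 = 0 -> m + 1 + m1 = 0 -> m + 2 + m2 = 0 ->
    conc m0 m1 m2 b (dual b') d = 0.
  move=> h0 h1 h2; have [t [s D]] := na m.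
  by apply: (concurrent D); apply: h.
have := hat_conc b (dual b') d.
have -> : conc 0 2 1 b (dual b') d = 0 by apply: (cz _ _ _ 0); apply: val_inj.
have -> : conc 2 1 0 b (dual b') d = 0 by apply: (cz _ _ _ 1); apply: val_inj.
have -> : conc 1 0 2 b (dual b') d = 0 by apply: (cz _ _ _ 2); apply: val_inj.
rewrite !mulr0 !addr0 hatU_dual hatV_dual => e.
apply: (mulfI (_ : (1 - w) * w ^+ 2 * (b'.1.1 * b'.1.2 * b'.2) != 0)).
  by rewrite !mulf_neq0 ?omega_neq0 // subr_eq0 eq_sym.
by rewrite mulr0 -[RHS]oppr0 e; ring: w2.
Qed.

End Hats.

Definition exotic w b b' :=
  hatU w b * hatV (w ^+ 2) b' = 0 /\ hatV w b * hatU (w ^+ 2) b' = 0.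

(* The two families of concurrent lines give two linear equations for the products
   in [exotic]; the determinant of the system is, up to a unit, the product
   whose vanishing is treated in [pair_curves]. *)
Lemma pair_dichotomy w b b' d a1 a2 : w ^+ 2 = - w - 1 -> w != 1 ->
  pair_config b b' d a1 a2 -> trivial_ratio d \/ exotic w b b'.
Proof.
move=> w2 w1 h; have [tb tb' td c1 c2 o1 o2 _ _] := h.
have e1 : hatU w d * (hatV w b * hatU (w ^+ 2) b')
    + w * hatV w d * (hatU w b * hatV (w ^+ 2) b') = 0.
  apply: (hat_pair w2 w1 (a := a1)) => // m.
  by exists (had d (rotn 0 b')), (rotn 0 (dual b)).
(* [d'] is the inverse of [d] up to a factor; it moves the diagonal map to the other side, so that
   the second family takes the form of the first with [b] and [b'] exchanged. *)
pose d' : vec K := (d.1.2 * d.2, d.1.1 * d.2, d.1.1 * d.1.2).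
have had_det x y z : det3 (had d' x) y (had d' z) =
    d.1.1 * d.1.2 * d.2 * det3 x (had d y) z.
  by rewrite /det3 /had /d' /=; ring.
have nd : d.1.1 * d.1.2 * d.2 != 0.
  by case/and3P: td => ? ? ?; rewrite !mulf_neq0.
have w4 : (w ^+ 2) ^+ 2 = w by ring: w2.
have e2 : hatU (w ^+ 2) d' * (hatV (w ^+ 2) b' * hatU w b)
    + w ^+ 2 * hatV (w ^+ 2) d' * (hatU (w ^+ 2) b' * hatV w b) = 0.
  have w22 : (w ^+ 2) ^+ 2 = - w ^+ 2 - 1 by rewrite w4 w2; ring.
  have w21 : w ^+ 2 != 1.
    by apply: contraNneq w1 => e; rewrite -(cube_omega w2) exprS e mulr1.
  have := @hat_pair (w ^+ 2) w22 w21 b' b d' (fun m => had d' (a2 m)) tb.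
  rewrite w4; apply; last by move=> m j k s; rewrite had_det c2 ?mulr0.
  move=> m; exists (rotn 0 (dual b')), (had d' (rotn 0 b)).
  by rewrite had_det mulf_neq0 // -det3_rot det3C oppr_eq0.
set p := hatU w b * hatV (w ^+ 2) b' in e1 *.
set q := hatV w b * hatU (w ^+ 2) b' in e1 *.
have {}e2 : hatV (w ^+ 2) d * p + hatU (w ^+ 2) d * q = 0.
  apply: (mulfI (_ : w * (d.1.1 * d.1.2 * d.2) != 0)).
    by rewrite mulf_neq0 // omega_neq0.
  by rewrite mulr0 -[RHS]e2 /p /q /hatU /hatV /d' /=; ring: w2.
have [C|C] := eqVneq ((d.1.1 ^+ 2 - d.1.2 * d.2) * (d.1.2 ^+ 2 - d.1.1 * d.2)
    * (d.2 ^+ 2 - d.1.1 * d.1.2)) 0; first by left; apply: pair_curves h C.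
right; have D : (w * hatV w d) * hatU (w ^+ 2) d - hatU w d * hatV (w ^+ 2) d =
   - (1 - w) * ((d.1.1 ^+ 2 - d.1.2 * d.2) * (d.1.2 ^+ 2 - d.1.1 * d.2)
    * (d.2 ^+ 2 - d.1.1 * d.1.2)).
  by rewrite /hatU /hatV; ring: w2.
have {}C : (w * hatV w d) * hatU (w ^+ 2) d - hatU w d * hatV (w ^+ 2) d != 0.
  by rewrite D mulf_neq0 // oppr_eq0 subr_eq0 eq_sym.
rewrite /exotic -/p -/q; split; apply: (mulfI C); rewrite mulr0.
  transitivity (hatU (w ^+ 2) d * (hatU w d * q + w * hatV w d * p)
    - hatU w d * (hatV (w ^+ 2) d * p + hatU (w ^+ 2) d * q)); first by ring.
  by rewrite e1 e2; ring.
transitivity (w * hatV w d * (hatV (w ^+ 2) d * p + hatU (w ^+ 2) d * q)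
    - hatV (w ^+ 2) d * (hatU w d * q + w * hatV w d * p)); first by ring.
by rewrite e1 e2; ring.
Qed.

End PairConfig.

Section Exotic.
Variable K : fieldType.
Implicit Types (b x y z : vec K) (w : K).

Lemma trivial_ratio_det3 b t : trivial_ratio b -> det3 b (rotv b) t = 0.
Proof.
case=> e0 e1 e2; transitivity (t.1.1 * (b.1.2 ^+ 2 - b.1.1 * b.2)
  + t.1.2 * (b.2 ^+ 2 - b.1.1 * b.1.2) + t.2 * (b.1.1 ^+ 2 - b.1.2 * b.2)).
  by rewrite /det3 /rotv /=; ring.
by rewrite e0 e1 e2 !subrr !mulr0 !addr0.
Qed.

Lemma hatU_rot w b : w ^+ 2 = - w - 1 -> hatU w (rotv b) = w * hatU w b.
Proof. by move=> w2; rewrite /hatU /=; ring: w2. Qed.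

Lemma hatV_rot w b : w ^+ 2 = - w - 1 -> hatV w (rotv b) = w * hatV w b.
Proof. by move=> w2; rewrite /hatV /=; ring: w2. Qed.

(* Up to unit factors, the square of [x1 ^+ 2 - x0 * x2] is in the ideal generated
   by the two Fourier coefficients. *)
Lemma hatUV_eq0 w b : w ^+ 2 = - w - 1 -> torus b ->
  hatU w b = 0 -> hatV w b = 0 -> trivial_ratio b.
Proof.
move=> w2; have sq x : torus x -> hatU w x = 0 -> hatV w x = 0 ->
    x.1.2 ^+ 2 = x.1.1 * x.2.
  case/and3P=> n0 _ _ eU eV; apply/eqP; rewrite eq_sym -subr_eq0 -sqrf_eq0.
  apply/eqP/(mulfI n0); rewrite mulr0.
  transitivity (- hatV w x * x.1.2 * x.2
    + (w ^+ 2 * x.1.2 ^+ 2 + x.1.1 * x.2) * hatU w x).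
    by rewrite /hatU /hatV; ring: w2.
  by rewrite eU eV; ring.
move=> tb eU eV; have h1 := sq b tb eU eV.
have eU' : hatU w (rotv b) = 0 by rewrite hatU_rot // eU mulr0.
have eV' : hatV w (rotv b) = 0 by rewrite hatV_rot // eV mulr0.
have := sq (rotv b); rewrite torus_rot => /(_ tb eU' eV') h0.
have := sq (rotv (rotv b)); rewrite !torus_rot hatU_rot // hatV_rot //.
rewrite eU' eV' mulr0 => /(_ tb erefl erefl) h2.
by split; [rewrite h0 /= mulrC | | rewrite h2 /= mulrC].
Qed.

(** Fourier inversion on C_3: with both nontrivial coefficients zero, the sequence [r, s, t] is
    constant. *)
Lemma hat_sum_eq0 w (r s t : K) : w ^+ 2 = - w - 1 -> w != 1 ->
  r + w * s + w ^+ 2 * t = 0 -> r + w ^+ 2 * s + (w ^+ 2) ^+ 2 * t = 0 ->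
  r = s /\ s = t.
Proof.
move=> w2 w1 e e'.
have st : s = t.
  apply/subr0_eq/(mulfI (_ : w * (1 - w) != 0)).
    by rewrite mulf_neq0 ?(omega_neq0 w2) // subr_eq0 eq_sym.
  by rewrite mulr0 -[RHS](subrr 0) -[X in _ = X - _]e -[X in _ = _ - X]e'; ring: w2.
by split=> //; apply/subr0_eq; rewrite -[RHS]e st; ring: w2.
Qed.

Lemma hatU_eq0 w b : w ^+ 2 = - w - 1 -> w != 1 -> torus b ->
  hatU w b = 0 -> hatU (w ^+ 2) b = 0 -> trivial_ratio b.
Proof.
move=> w2 w1 /and3P[n0 n1 n2] e e'; have [h h'] := hat_sum_eq0 w2 w1 e e'.
split.
- by apply: (mulIf n2); rewrite h h'; ring.
- by apply: (mulIf n0); rewrite -h; ring.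
- by apply: (mulIf n1); rewrite -h'; ring.
Qed.

Lemma hatV_eq0 w b : w ^+ 2 = - w - 1 -> w != 1 -> torus b ->
  hatV w b = 0 -> hatV (w ^+ 2) b = 0 -> trivial_ratio b.
Proof.
move=> w2 w1 /and3P[n0 n1 n2] e e'; have [h h'] := hat_sum_eq0 w2 w1 e e'.
split.
- by apply: (mulIf n1); rewrite h; ring.
- by apply: (mulIf n2); rewrite h'; ring.
- by apply: (mulIf n0); rewrite -h' -h; ring.
Qed.

(** Some [hatU v x] is nonzero, which forces [hatV (v ^+ 2)] to vanish at both [y] and [z]. The pair
    [y, z] then makes a second coefficient vanish at one of them, and two such zeros occur only for
    a trivial vector. *)
Lemma exotic_triple w x y z : w ^+ 2 = - w - 1 -> w != 1 ->
  torus x -> torus y -> torus z ->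
  ~ trivial_ratio x -> ~ trivial_ratio y -> ~ trivial_ratio z ->
  (forall v, v ^+ 2 = - v - 1 -> v != 1 ->
     [/\ exotic v x y, exotic v x z & exotic v y z]) -> False.
Proof.
move=> w2 w1 tx ty tz nx ny nz ex.
have w22 : (w ^+ 2) ^+ 2 = - w ^+ 2 - 1 by ring: w2.
have w21 : w ^+ 2 != 1.
  by apply: contraNneq w1 => e; rewrite -(cube_omega w2) exprS e mulr1.
have [v [v2 v1 Ux]] : exists v, [/\ v ^+ 2 = - v - 1, v != 1 & hatU v x != 0].
  have [e|] := eqVneq (hatU w x) 0; last by exists w.
  exists (w ^+ 2); split=> //.
  by apply/eqP => e'; apply: nx; apply: hatU_eq0 e e'.
have [[xy _] [xz _] _] := ex v v2 v1.
have v22 : (v ^+ 2) ^+ 2 = - v ^+ 2 - 1 by ring: v2.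
have v21 : v ^+ 2 != 1.
  by apply: contraNneq v1 => e; rewrite -(cube_omega v2) exprS e mulr1.
have [_ _ [yz _]] := ex _ v22 v21.
have v4 : (v ^+ 2) ^+ 2 = v by ring: v2.
rewrite v4 in yz.
have Vy : hatV (v ^+ 2) y = 0 by apply: (mulfI Ux); rewrite mulr0.
have Vz : hatV (v ^+ 2) z = 0 by apply: (mulfI Ux); rewrite mulr0.
move/eqP: yz; rewrite mulf_eq0 => /orP[] /eqP e.
  by apply: ny; apply: hatUV_eq0 e Vy.
by apply: nz; apply: hatV_eq0 e Vz.
Qed.

End Exotic.

Lemma Z3_cases (j : 'Z_3) : [\/ j = 0, j = 1 | j = 2].
Proof.
by case: j => [[|[|[|j]]] hj] //; [constructor 1|constructor 2|constructor 3];
  apply: val_inj.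
Qed.

Section Blocks.
Variable K : fieldType.
Hypothesis cube_root : forall c : K, exists x, x ^+ 3 = c.
Implicit Types b c d x y z u v : vec K.

Lemma torus_had d x : torus d -> torus x -> torus (had d x).
Proof. by case/and3P=> ? ? ? /and3P[? ? ?]; rewrite /torus /= !mulf_neq0. Qed.

Lemma torus_dual b : torus b -> torus (dual b).
Proof. by case/and3P=> ? ? ?; rewrite /torus /= !mulf_neq0. Qed.

Lemma torus_rotn j b : torus b -> torus (rotn j b).
Proof. by rewrite /rotn; case: j => j _ /= h; elim: j => //= j; rewrite torus_rot. Qed.

Lemma scale_of_ratios (r q : K) u v : torus v ->
  u.1.2 = r * u.2 -> u.2 = q * u.1.1 -> v.1.2 = r * v.2 -> v.2 = q * v.1.1 ->
  u = scale (u.1.1 / v.1.1) v.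
Proof.
case/and3P=> n0 _ _ e0 e1 f0 f1; apply: vecP; rewrite /= ?divfK //.
  by rewrite e0 f0 e1 f1; field.
by rewrite e1 f1; field.
Qed.

(* [b] and [d] are read off from the ratios of the coordinates of the [B j]; the
   cube root adjusts the diagonal map. *)
Lemma block_shape (B C : 'Z_3 -> vec K) :
  (forall j, torus (B j)) -> (forall k, torus (C k)) ->
  (forall j k, 0 + j + k = 0 -> (B j).1.2 * (C k).2 = (B j).2 * (C k).1.2) ->
  (forall j k, 1 + j + k = 0 -> (B j).2 * (C k).1.1 = (B j).1.1 * (C k).2) ->
  (forall j k, 2 + j + k = 0 -> (B j).1.1 * (C k).1.2 = (B j).1.2 * (C k).1.1) ->
  exists d b, [/\ torus d, torus b,
    forall j, exists2 c : K, c != 0 & B j = scale c (had d (rotn j b))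
    & forall k, exists2 c : K, c != 0 & C k = scale c (had d (rotn k (dual b)))].
Proof.
move=> tB tC h0 h1 h2.
pose r j := (B j).1.2 / (B j).2; pose q j := (B j).2 / (B j).1.1.
have rn j : r j != 0 by case/and3P: (tB j) => *; rewrite mulf_neq0 ?invr_neq0.
have qn j : q j != 0 by case/and3P: (tB j) => *; rewrite mulf_neq0 ?invr_neq0.
have Br j : (B j).1.2 = r j * (B j).2 by case/and3P: (tB j) => *; rewrite divfK.
have Bq j : (B j).2 = q j * (B j).1.1 by case/and3P: (tB j) => *; rewrite divfK.
clearbody r q.
have Cr j k : 0 + j + k = 0 -> (C k).1.2 = r j * (C k).2.
  case/and3P: (tB j) => ? ? n /h0 e; apply: (mulfI n); rewrite -e Br; ring.
have Cq j k : 1 + j + k = 0 -> (C k).2 = q j * (C k).1.1.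
  case/and3P: (tB j) => n ? ? /h1 e; apply: (mulfI n); rewrite -e Bq; ring.
have Cp j k : 2 + j + k = 0 -> (C k).1.2 = r j * q j * (C k).1.1.
  case/and3P: (tB j) => n ? ? /h2 e; apply: (mulfI n); rewrite e Br Bq; ring.
have rq0 : r 0 * q 0 = r 2 * q 1.
  case/and3P: (tC 1) => n ? ?; apply: (mulIf n).
  rewrite -Cp; last exact: val_inj.
  rewrite (Cr 2); last exact: val_inj.
  by rewrite (Cq 1) ?mulrA //; apply: val_inj.
have rq2 : r 2 * q 2 = r 1 * q 0.
  case/and3P: (tC 2) => n ? ?; apply: (mulIf n).
  rewrite -Cp; last exact: val_inj.
  rewrite (Cr 1); last exact: val_inj.
  by rewrite (Cq 0) ?mulrA //; apply: val_inj.
(* Over the three shifts of [b] the ratios of the last two coordinates multiply to 1, so the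
   corresponding ratio [e] of [d] must have cube [r 0 * r 1 * r 2]. *)
have [e e3] := cube_root (r 0 * r 1 * r 2).
have en : e != 0.
  have : e ^+ 3 != 0 by rewrite e3 !mulf_neq0.
  by rewrite expf_eq0.
(* The incidences force [q j = p * r (j - 1)] with a single constant [p]. *)
pose p := q 0 / r 2.
have pn : p != 0 by rewrite mulf_neq0 ?invr_neq0.
have q0 : q 0 = p * r 2 by rewrite divfK.
clearbody p.
have q1 : q 1 = p * r 0 by apply: (mulfI (rn 2)); rewrite -rq0 q0; ring.
have q2 : q 2 = p * r 1 by apply: (mulfI (rn 2)); rewrite rq2 q0; ring.
have r0 : r 0 = e ^+ 3 / (r 1 * r 2) by rewrite e3; field; rewrite !rn.
pose d : vec K := (1, e * (p * e), p * e).
pose b : vec K := (1, e / r 1, r 2 / e).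
have td : torus d by rewrite /torus /= oner_neq0 !mulf_neq0.
have tb : torus b by rewrite /torus /= oner_neq0 !mulf_neq0 ?invr_neq0.
have Vr j : (had d (rotn j b)).1.2 = r j * (had d (rotn j b)).2.
  by case: (Z3_cases j) => ->; rewrite ?r0 /=; field; rewrite ?rn ?en.
have Vq j : (had d (rotn j b)).2 = q j * (had d (rotn j b)).1.1.
  by case: (Z3_cases j) => ->; rewrite ?q0 ?q1 ?q2 ?r0 /=; field; rewrite ?rn ?en.
exists d, b; split=> // [j|k].
  exists ((B j).1.1 / (had d (rotn j b)).1.1).
    case/and3P: (tB j) => n _ _.
    case/and3P: (torus_had td (torus_rotn j tb)) => n' _ _.
    by rewrite mulf_neq0 ?invr_neq0.
  apply: (scale_of_ratios (torus_had td (torus_rotn j tb)) (Br j) (Bq j)) => //.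
have tV := torus_had td (torus_rotn k (torus_dual tb)).
exists ((C k).1.1 / (had d (rotn k (dual b))).1.1).
  case/and3P: (tC k) => n _ _; case/and3P: tV => n' _ _.
  by rewrite mulf_neq0 ?invr_neq0.
have s0 : 0 + - k + k = 0 by rewrite add0r addNr.
have s1 : 1 + (2 - k) + k = 0 by case: (Z3_cases k) => ->; apply: val_inj.
apply: (scale_of_ratios tV (Cr _ _ s0) (Cq _ _ s1)).
  have [N0 N1 N2] : [/\ - 0 = 0 :> 'Z_3, - 1 = 2 :> 'Z_3 & - 2 = 1 :> 'Z_3].
    by split; apply: val_inj.
  by case: (Z3_cases k) => ->; rewrite ?N0 ?N1 ?N2 ?r0 /=; field; rewrite ?rn ?en.
have [N0 N1 N2] : [/\ 2 - 0 = 2 :> 'Z_3, 2 - 1 = 1 :> 'Z_3 & 2 - 2 = 0 :> 'Z_3].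
  by split; apply: val_inj.
by case: (Z3_cases k) => ->; rewrite ?N0 ?N1 ?N2 ?q0 ?q1 ?q2 ?r0 /=; field;
  rewrite ?rn ?en.
Qed.

End Blocks.

Section HadAlgebra.
Variable K : fieldType.
Implicit Types b c d x y z u v w : vec K.

Definition vinv d : vec K := (d.1.1^-1, d.1.2^-1, d.2^-1).

Lemma torus_vinv d : torus d -> torus (vinv d).
Proof. by case/and3P=> ? ? ?; rewrite /torus /= !invr_neq0. Qed.

Lemma had_vinv d x : torus d -> had (vinv d) (had d x) = x.
Proof. by case/and3P=> ? ? ?; apply: vecP; rewrite /= mulKf. Qed.

Lemma had_had d c x : had d (had c x) = had (had d c) x.
Proof. by apply: vecP; rewrite /= mulrA. Qed.

Lemma det3_had_eq0 d u v w : torus d ->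
  (det3 (had d u) (had d v) (had d w) == 0) = (det3 u v w == 0).
Proof.
case/and3P=> /negPf n0 /negPf n1 /negPf n2.
rewrite (_ : det3 _ _ _ = d.1.1 * d.1.2 * d.2 * det3 u v w).
  by rewrite !mulf_eq0 n0 n1 n2.
by rewrite /det3 /=; ring.
Qed.

Lemma det3_scale2_eq0 (r q : K) u v w : r != 0 -> q != 0 ->
  (det3 u (scale r v) (scale q w) == 0) = (det3 u v w == 0).
Proof.
move=> /negPf n0 /negPf n1.
rewrite (_ : det3 _ _ _ = r * q * det3 u v w).
  by rewrite !mulf_eq0 n0 n1.
by rewrite /det3 /=; ring.
Qed.

Lemma det3_scale3_eq0 (p r q : K) u v w : p != 0 -> r != 0 -> q != 0 ->
  (det3 (scale p u) (scale r v) (scale q w) == 0) = (det3 u v w == 0).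
Proof.
by move=> /negPf n0 n1 n2; rewrite det3_scale mulf_eq0 n0 det3_scale2_eq0.
Qed.

End HadAlgebra.

Section Frame.
Variable K : fieldType.
Hypothesis cube_root : forall c : K, exists x, x ^+ 3 = c.
Variable P : 'I_3 -> 'Z_3 * 'Z_3 -> vec K.
Hypothesis netP : symnet P.

Let a m := P 0 (0, m).
Hypothesis free_a : det3 (a 0) (a 1) (a 2) != 0.

Definition frame (v : vec K) : vec K :=
  (det3 v (a 1) (a 2), det3 (a 0) v (a 2), det3 (a 0) (a 1) v).

Lemma det3_frame u v w : (det3 (frame u) (frame v) (frame w) == 0) =
  (det3 u v w == 0).
Proof.
have -> : det3 (frame u) (frame v) (frame w) =
    det3 (a 0) (a 1) (a 2) ^+ 2 * det3 u v w.
  by rewrite /frame /det3 /=; ring.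
by rewrite mulf_eq0 sqrf_eq0 (negPf free_a).
Qed.

Record block_form (t : 'Z_3) (d b : vec K) : Prop := BlockForm {
  bf_d : torus d; bf_b : torus b;
  bf_1 : forall j, exists2 c : K,
    c != 0 & frame (P 1 (t, j)) = scale c (had d (rotn j b));
  bf_2 : forall k, exists2 c : K,
    c != 0 & frame (P 2 (- t, k)) = scale c (had d (rotn k (dual b)))
}.

Lemma block_formP t : exists d b, block_form t d b.
Proof.
have tor (i : 'I_3) x : 0 != i -> torus (frame (P i x)).
  move=> i0; rewrite /torus /=; apply/and3P; split.
  - by rewrite det3_rot (net_gen netP).
  - by rewrite -det3_rot (net_gen netP).
  - by rewrite (net_gen netP).
have col m j k : m + j + k = 0 ->
    det3 (frame (a m)) (frame (P 1 (t, j))) (frame (P 2 (- t, k))) = 0.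
  move=> s; apply/eqP; rewrite det3_frame; apply/eqP.
  by apply: (net_col netP); congr pair => //; rewrite /= add0r subrr.
pose D := det3 (a 0) (a 1) (a 2).
have f0 : frame (a 0) = (D, 0, 0) by apply: vecP; rewrite /D /frame /det3 /=; ring.
have f1 : frame (a 1) = (0, D, 0) by apply: vecP; rewrite /D /frame /det3 /=; ring.
have f2 : frame (a 2) = (0, 0, D) by apply: vecP; rewrite /D /frame /det3 /=; ring.
have [||j k s|j k s|j k s|d [b [td tb h1 h2]]] := block_shape cube_root
   (B := fun j => frame (P 1 (t, j))) (C := fun k => frame (P 2 (- t, k))).
- by move=> j; apply: tor.
- by move=> k; apply: tor.
- have := col 0 j k s; rewrite f0 => e; apply/subr0_eq/(mulfI free_a).
  by rewrite mulr0 -[RHS]e /D /det3 /=; ring.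
- have := col 1 j k s; rewrite f1 => e; apply/subr0_eq/(mulfI free_a).
  by rewrite mulr0 -[RHS]e /D /det3 /=; ring.
- have := col 2 j k s; rewrite f2 => e; apply/subr0_eq/(mulfI free_a).
  by rewrite mulr0 -[RHS]e /D /det3 /=; ring.
by exists d, b.
Qed.

Section Pair.
Variables (s t : 'Z_3) (d b d' b' : vec K).
Hypotheses (st : s != t) (bs : block_form s d b) (bt : block_form t d' b').

Definition chart v := had (vinv d) (frame v).

Lemma det3_chart u v w :
  (det3 (chart u) (chart v) (chart w) == 0) = (det3 u v w == 0).
Proof. by rewrite det3_had_eq0 ?det3_frame // torus_vinv // (bf_d bs). Qed.

Lemma had_vinv_scale (c : K) x e :
  had (vinv d) (scale c (had e x)) = scale c (had (had (vinv d) e) x).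
Proof. by rewrite had_scale had_had. Qed.

Lemma chart1 j : exists2 c : K, c != 0 & chart (P 1 (s, j)) = scale c (rotn j b).
Proof.
have [c c0 e] := bf_1 bs j; exists c => //.
by rewrite /chart e had_scale had_vinv ?(bf_d bs).
Qed.

Lemma chart2 k :
  exists2 c : K, c != 0 & chart (P 2 (- s, k)) = scale c (rotn k (dual b)).
Proof.
have [c c0 e] := bf_2 bs k; exists c => //.
by rewrite /chart e had_scale had_vinv ?(bf_d bs).
Qed.

Lemma chart1' j : exists2 c : K, c != 0 &
  chart (P 1 (t, j)) = scale c (had (had (vinv d) d') (rotn j b')).
Proof.
by have [c c0 e] := bf_1 bt j; exists c; rewrite // /chart e had_vinv_scale.
Qed.

Lemma chart2' k : exists2 c : K, c != 0 &
  chart (P 2 (- t, k)) = scale c (had (had (vinv d) d') (rotn k (dual b'))).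
Proof.
by have [c c0 e] := bf_2 bt k; exists c; rewrite // /chart e had_vinv_scale.
Qed.

(** The coset [t - s] of the first component completes [s] and [- t] to a zero sum, and [s - t]
    completes [t] and [- s]. *)
Lemma block_pair : pair_config b b' (had (vinv d) d')
  (fun m => chart (P 0 (t - s, m))) (fun m => chart (P 0 (s - t, m))).
Proof.
have td : torus (had (vinv d) d').
  by apply: torus_had (bf_d bt); apply: torus_vinv (bf_d bs).
have nst (m j k : 'Z_3) : (s - t, m) + (s, j) + (- t, k) != 0.
  rewrite -[_ == _]/(_ && _) negb_and; apply/orP; left; move: st.
  by case: (Z3_cases s) => ->; case: (Z3_cases t) => ->.
have nts (m j k : 'Z_3) : (t - s, m) + (t, j) + (- s, k) != 0.
  rewrite -[_ == _]/(_ && _) negb_and; apply/orP; left; move: st.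
  by case: (Z3_cases s) => ->; case: (Z3_cases t) => ->.
split=> //; [exact: bf_b bs | exact: bf_b bt |..].
- move=> m j k e; have [c c0 ec] := chart1 j; have [c' c0' ec'] := chart2' k.
  apply/eqP; rewrite -(det3_scale2_eq0 _ _ _ c0 c0') -ec -ec' det3_chart.
  by apply/eqP/(net_col netP); congr pair; rewrite //= subrK subrr.
- move=> m j k e; have [c c0 ec] := chart1' j; have [c' c0' ec'] := chart2 k.
  apply/eqP; rewrite -(det3_scale2_eq0 _ _ _ c0 c0') -ec -ec' det3_chart.
  by apply/eqP/(net_col netP); congr pair; rewrite //= subrK subrr.
- move=> m j k; have [c c0 ec] := chart1' j; have [c' c0' ec'] := chart2 k.
  rewrite -(det3_scale2_eq0 _ _ _ c0 c0') -ec -ec' det3_chart.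
  exact: (det3_off netP).
- move=> m j k; have [c c0 ec] := chart1 j; have [c' c0' ec'] := chart2' k.
  rewrite -(det3_scale2_eq0 _ _ _ c0 c0') -ec -ec' det3_chart.
  exact: (det3_off netP).
- move=> j j' k jj; have [c c0 ec] := chart1 j; have [c' c0' ec'] := chart1 j'.
  have [c2 c20 ec2] := chart2' k.
  rewrite -(det3_scale3_eq0 _ _ _ c0 c0' c20) -ec -ec' -ec2 det3_chart.
  by apply: (net_gen netP) => //; rewrite xpair_eqE negb_and jj orbT.
move=> j k k' kk; have [c c0 ec] := chart1 j; have [c' c0' ec'] := chart2' k.
have [c2 c20 ec2] := chart2' k'.
rewrite -(det3_scale3_eq0 _ _ _ c0 c0' c20) -ec -ec' -ec2 det3_chart det3_rot.
by apply: (net_gen netP) => //; rewrite xpair_eqE negb_and kk orbT.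
Qed.

(** A trivial [b] is proportional to its shift, so two points of a coset would coincide. *)
Lemma block_nontrivial : ~ trivial_ratio b.
Proof.
move=> tr; have := pc_gen block_pair (j := 0) (j' := 1) 0 isT.
by rewrite trivial_ratio_det3 ?eqxx.
Qed.

End Pair.

End Frame.

(** * Cubics invariant under the cyclic shift *)

Section CyclicCubic.
Variable K : fieldType.
Hypothesis two_neq0 : 2 != 0 :> K.
Implicit Types b d x y z u v : vec K.

Definition dot x y : K := x.1.1 * y.1.1 + x.1.2 * y.1.2 + x.2 * y.2.

Lemma orthogonal_vec x : exists2 z, z != 0 & dot x z = 0.
Proof.
case: x => [[x0 x1] x2].
have [e|n] := eqVneq x0 0.
  exists (1, 0, 0); first by rewrite !xpair_eqE oner_eq0.
  by rewrite /dot /= e; ring.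
exists (x1, - x0, 0); first by rewrite !xpair_eqE oppr_eq0 (negPf n) andbF.
by rewrite /dot /=; ring.
Qed.

Lemma orthogonal_vec2 x y : exists2 z, z != 0 & dot x z = 0 /\ dot y z = 0.
Proof.
have [e|n] := eqVneq (cross x y) 0; last first.
  by exists (cross x y) => //; split; rewrite /dot /cross /=; ring.
have [x0|xn] := eqVneq x 0.
  have [z z0 h] := orthogonal_vec y; exists z; rewrite // x0; split=> //.
  by rewrite /dot /=; ring.
have [|c ->] := vec_line xn (v := y).
  move=> t; transitivity (dot (cross x y) t); first by rewrite /det3 /dot /cross /=; ring.
  by rewrite e /dot /=; ring.
have [z z0 h] := orthogonal_vec x; exists z => //; split=> //.
by transitivity (c * dot x z); [rewrite /dot /=; ring | rewrite h mulr0].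
Qed.

Definition cyclic_monomials v : vec K :=
  (v.1.1 * v.1.2 * v.2,
   v.1.1 ^+ 2 * v.1.2 + v.1.2 ^+ 2 * v.2 + v.2 ^+ 2 * v.1.1,
   v.1.1 ^+ 2 * v.2 + v.1.2 ^+ 2 * v.1.1 + v.2 ^+ 2 * v.1.2).

Lemma cyclic_monomials_rotn j v :
  cyclic_monomials (rotn j v) = cyclic_monomials v.
Proof.
case: (Z3_cases j) => -> //.
  by apply: vecP; rewrite /=; ring.
by apply: vecP; rewrite /=; ring.
Qed.

(** Hence a cubic of the span through [b] passes through [dual b] at no extra cost. *)
Lemma cyclic_monomials_dual b : cyclic_monomials (dual b) =
  scale (b.1.1 * b.1.2 * b.2) (cyclic_monomials b).
Proof. by apply: vecP; rewrite /=; ring. Qed.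

Lemma cyclic_monomials_scale (c : K) v :
  cyclic_monomials (scale c v) = scale (c ^+ 3) (cyclic_monomials v).
Proof. by apply: vecP; rewrite /=; ring. Qed.

(** A trivial [d] multiplies the three terms of each cyclic sum by the same factor, so it acts
    diagonally and preserves the proportionality between [b'] and its dual. *)
Lemma cyclic_monomials_had d v : trivial_ratio d ->
  cyclic_monomials (had d v) = had (d.1.1 * d.1.2 * d.2,
    d.1.1 ^+ 2 * d.1.2, d.1.1 ^+ 2 * d.2) (cyclic_monomials v).
Proof.
case=> e0 e1 e2.
have f0 : d.1.2 ^+ 2 * d.2 = d.1.1 ^+ 2 * d.1.2 by rewrite e0; ring.
have f1 : d.2 ^+ 2 * d.1.1 = d.1.1 ^+ 2 * d.1.2 by rewrite e2; ring.
have f2 : d.1.2 ^+ 2 * d.1.1 = d.1.1 ^+ 2 * d.2 by rewrite e1; ring.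
have f3 : d.2 ^+ 2 * d.1.2 = d.1.1 ^+ 2 * d.2 by rewrite e0; ring.
apply: vecP => /=; first by ring.
  transitivity (d.1.1 ^+ 2 * d.1.2 * (v.1.1 ^+ 2 * v.1.2)
    + d.1.2 ^+ 2 * d.2 * (v.1.2 ^+ 2 * v.2)
    + d.2 ^+ 2 * d.1.1 * (v.2 ^+ 2 * v.1.1)); first by ring.
  by rewrite f0 f1; ring.
transitivity (d.1.1 ^+ 2 * d.2 * (v.1.1 ^+ 2 * v.2)
  + d.1.2 ^+ 2 * d.1.1 * (v.1.2 ^+ 2 * v.1.1)
  + d.2 ^+ 2 * d.1.2 * (v.2 ^+ 2 * v.1.2)); first by ring.
by rewrite f2 f3; ring.
Qed.

Lemma dot_scale (c : K) x y : dot (scale c x) y = c * dot x y.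
Proof. by rewrite /dot /=; ring. Qed.

(** The points (1, 1, 0) and (1, -1, 0) give [b + c] and [c - b], where 2 has to be inverted, and
    (1, 1, 1) gives [a + 3 b + 3 c]. *)
Lemma cyclic_cubic_neq0 z : z != 0 -> exists v, dot (cyclic_monomials v) z != 0.
Proof.
case: z => [[a b] c] nz.
pose f v := dot (cyclic_monomials v) (a, b, c).
have [e0|] := eqVneq (f (1, 1, 0)) 0; last by exists (1, 1, 0).
have [e1|] := eqVneq (f (1, - 1, 0)) 0; last by exists (1, - 1, 0).
have [e2|] := eqVneq (f (1, 1, 1)) 0; last by exists (1, 1, 1).
case/eqP: nz; rewrite /f /dot /= in e0 e1 e2.
have b0 : b = 0.
  apply: (mulfI two_neq0); rewrite mulr0 -[RHS](subrr 0) -[X in _ = X - _]e0.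
  by rewrite -[X in _ = _ - X]e1; ring.
have c0 : c = 0 by rewrite -e0 b0; ring.
have a0 : a = 0 by rewrite -e2 b0 c0; ring.
by rewrite a0 b0 c0.
Qed.

End CyclicCubic.

Section FrameCubic.
Variable K : fieldType.
Hypotheses (two_neq0 : 2 != 0 :> K)
           (cube_root : forall c : K, exists x, x ^+ 3 = c).
Variable P : 'I_3 -> 'Z_3 * 'Z_3 -> vec K.
Hypothesis netP : symnet P.

Lemma blocks_in (F : {mpoly K[3]}) (s : seq ('I_3 * 'Z_3)) :
  {in s, forall i j, mev F (P i.1 (i.2, j)) = 0} ->
  {in blocks s, forall z, mev F (P z.1 z.2) = 0}.
Proof. by move=> h z /allpairsP[[i j] [/h hi _ ->]]; apply: hi. Qed.

Lemma mev_two_blocks (s t : 'Z_3) (F : {mpoly K[3]}) : s != t ->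
  F \is 3.-homog -> (forall j, mev F (P 0 (0, j)) = 0) ->
  (forall j, mev F (P 1 (s, j)) = 0) -> (forall j, mev F (P 2 (- s, j)) = 0) ->
  (forall j, mev F (P 1 (t, j)) = 0) -> (forall j, mev F (P 2 (- t, j)) = 0) ->
  forall i g, mev F (P i g) = 0.
Proof.
move=> st hF h0 hs hs' ht ht' i g.
have [[c1 f1] [c2 f2] [c3 f3]] := forces_all33.
case: (Z3_cases s) (Z3_cases t) => e [] e'; move: st hs hs' ht ht';
  rewrite e e' ?oppr0 // => _ hs hs' ht ht'.
- apply: (mev_forces_all i g netP hF f1); apply: blocks_in => x.
  by rewrite !inE => /or4P[|||/orP[]] /eqP ->.
- apply: (mev_forces_all i g netP hF f2); apply: blocks_in => x.
  by rewrite !inE => /or4P[|||/orP[]] /eqP ->.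
- apply: (mev_forces_all i g netP hF f1); apply: blocks_in => x.
  by rewrite !inE => /or4P[|||/orP[]] /eqP ->.
- apply: (mev_forces_all i g netP hF f3); apply: blocks_in => x.
  by rewrite !inE => /or4P[|||/orP[]] /eqP ->.
- apply: (mev_forces_all i g netP hF f2); apply: blocks_in => x.
  by rewrite !inE => /or4P[|||/orP[]] /eqP ->.
- apply: (mev_forces_all i g netP hF f3); apply: blocks_in => x.
  by rewrite !inE => /or4P[|||/orP[]] /eqP ->.
Qed.

Let a m := P 0 (0, m).
Hypothesis free_a : det3 (a 0) (a 1) (a 2) != 0.

Lemma trivial_pair_cubic s t d b d' b' : s != t ->
  block_form P s d b -> block_form P t d' b' ->
  trivial_ratio (had (vinv d) d') ->
  exists F : {mpoly K[3]}, [/\ F != 0, F \is 3.-homog &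
    forall i g, mev F (P i g) = 0].
Proof.
move=> st bs bt tr.
set r := had (vinv d) d' in tr *.
(* Two linear conditions on three coefficients, one for each pair of cosets. *)
have [z z0 [eb eb']] := orthogonal_vec2 (cyclic_monomials b)
  (cyclic_monomials (had r b')).
pose X := d.1.1^-1 *: line_form (a 1) (a 2).
pose Y := d.1.2^-1 *: line_form (a 2) (a 0).
pose Z := d.2^-1 *: line_form (a 0) (a 1).
have [hX hY hZ] : [/\ X \is 1.-homog, Y \is 1.-homog & Z \is 1.-homog].
  by split; apply: rpredZ; apply: linear_form_homog.
have Xv v : mev X v = (chart P d v).1.1.
  by rewrite /X mevZ mev_line_form /chart /= -det3_rot.
have Yv v : mev Y v = (chart P d v).1.2.
  by rewrite /Y mevZ mev_line_form /chart /= det3_rot.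
have Zv v : mev Z v = (chart P d v).2.
  by rewrite /Z mevZ mev_line_form.
clearbody X Y Z.
pose F := z.1.1 *: (X * Y * Z)
  + z.1.2 *: (X * X * Y + Y * Y * Z + Z * Z * X)
  + z.2 *: (X * X * Z + Y * Y * X + Z * Z * Y).
have Fv v : mev F v = dot (cyclic_monomials (chart P d v)) z.
  by rewrite /F !(mevD, mevZ, mevM) Xv Yv Zv /dot /=; ring.
have hF : F \is 3.-homog.
  by rewrite !(rpredD, rpredZ) ?mul3_homog.
exists F; split=> //.
  have [v hv] := cyclic_cubic_neq0 two_neq0 z0.
  apply: contraNneq hv => F0.
  pose D := det3 (a 0) (a 1) (a 2).
  have /and3P[n0 n1 n2] := bf_d bs.
  pose u := lc3 (v.1.1 * d.1.1) (a 0) (v.1.2 * d.1.2) (a 1) (v.2 * d.2) (a 2).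
  have := Fv u; rewrite F0 mev0.
  have -> : chart P d u = scale D v.
    by apply: vecP; rewrite /chart /frame /u /D /det3 /=; field.
  rewrite cyclic_monomials_scale dot_scale => /esym/eqP.
  by rewrite mulf_eq0 expf_eq0 /= (negPf free_a).
apply: (mev_two_blocks st hF) => j; rewrite Fv.
- have -> : cyclic_monomials (chart P d (P 0 (0, j))) = 0.
    by case: (Z3_cases j) => ->; apply: vecP;
       rewrite /chart /frame /det3 /=; ring.
  by rewrite /dot /=; ring.
- have [c _ ->] := chart1 bs j.
  by rewrite cyclic_monomials_scale cyclic_monomials_rotn dot_scale eb mulr0.
- have [c _ ->] := chart2 bs j.
  rewrite cyclic_monomials_scale cyclic_monomials_rotn cyclic_monomials_dual.
  by rewrite !dot_scale eb !mulr0.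
- have [c _ ->] := chart1' d bt j.
  rewrite cyclic_monomials_scale dot_scale (cyclic_monomials_had _ tr).
  by rewrite cyclic_monomials_rotn -cyclic_monomials_had // eb' mulr0.
have [c _ ->] := chart2' d bt j.
rewrite cyclic_monomials_scale dot_scale (cyclic_monomials_had _ tr).
rewrite cyclic_monomials_rotn cyclic_monomials_dual had_scale dot_scale.
by rewrite -cyclic_monomials_had // eb' !mulr0.
Qed.

Lemma trivial_ratio_dec d : decidable (@trivial_ratio K d).
Proof.
rewrite /decidable; have [e0|] := eqVneq (d.1.1 ^+ 2) (d.1.2 * d.2); last first.
  by move/eqP => h; right=> -[].
have [e1|] := eqVneq (d.1.2 ^+ 2) (d.1.1 * d.2); last first.
  by move/eqP => h; right=> -[].
have [e2|] := eqVneq (d.2 ^+ 2) (d.1.1 * d.1.2); last first.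
  by move/eqP => h; right=> -[].
by left.
Qed.

Lemma framed_cubic (w : K) : w ^+ 2 = - w - 1 -> w != 1 ->
  exists F : {mpoly K[3]}, [/\ F != 0, F \is 3.-homog &
    forall i g, mev F (P i g) = 0].
Proof.
move=> w2 w1.
have [d0 [b0 h0]] := block_formP cube_root netP free_a 0.
have [d1 [b1 h1]] := block_formP cube_root netP free_a 1.
have [d2 [b2 h2]] := block_formP cube_root netP free_a 2.
case: (trivial_ratio_dec (had (vinv d0) d1)) => [t01|t01].
  exact: trivial_pair_cubic h0 h1 t01.
case: (trivial_ratio_dec (had (vinv d0) d2)) => [t02|t02].
  exact: trivial_pair_cubic h0 h2 t02.
case: (trivial_ratio_dec (had (vinv d1) d2)) => [t12|t12].
  exact: trivial_pair_cubic h1 h2 t12.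
exfalso; apply: (exotic_triple w2 w1 (bf_b h0) (bf_b h1) (bf_b h2)).
- exact: (block_nontrivial netP free_a (t := 1) _ h0 h1).
- exact: (block_nontrivial netP free_a (t := 0) _ h1 h0).
- exact: (block_nontrivial netP free_a (t := 0) _ h2 h0).
move=> v v2 v1; split.
- by case: (pair_dichotomy v2 v1 (block_pair netP free_a (isT : 0 != 1 :> 'Z_3) h0 h1)).
- by case: (pair_dichotomy v2 v1 (block_pair netP free_a (isT : 0 != 2 :> 'Z_3) h0 h2)).
- by case: (pair_dichotomy v2 v1 (block_pair netP free_a (isT : 1 != 2 :> 'Z_3) h1 h2)).
Qed.

End FrameCubic.

(** * The group C_3 x C_3 with collinear cosets *)

Section NetMoves.
Variables (K : fieldType) (G : zmodType) (P : 'I_3 -> G -> vec K).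
Hypothesis netP : symnet P.

(** Moves an arbitrary noncollinear coset to coset 0 of the first component. *)
Lemma symnet_shift (i : 'I_3) (s : 'I_3 -> G) : s 0 + s 1 + s 2 = 0 ->
  symnet (fun k x => P (k + i) (x + s k)).
Proof.
move=> s0; split=> [x y z e|t t' tt' x x' y xx].
  apply: (det3_col netP); rewrite ?(inj_eq (addIr i)) //.
  by rewrite (addrACA x) (addrACA (x + y)) e s0 addr0.
by apply: (net_gen netP); rewrite ?(inj_eq (addIr _)).
Qed.

Lemma symnet_scale (c : 'I_3 -> G -> K) : (forall i x, c i x != 0) ->
  symnet (fun i x => scale (c i x) (P i x)).
Proof.
move=> nc; split=> [x y z e|t t' tt' x x' y xx].
  by apply/eqP; rewrite det3_scale3_eq0 // (net_col netP) // eqxx.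
by rewrite det3_scale3_eq0 // (net_gen netP).
Qed.

End NetMoves.

Section CollinearBlocks.
Variable K : fieldType.
Hypothesis three_neq0 : 3 != 0 :> K.

Lemma unity_root3 (r q : K) : r ^+ 2 = - r - 1 -> q ^+ 2 = - q - 1 ->
  q = r \/ q = r ^+ 2.
Proof.
move=> r2 q2; have /eqP : (q - r) * (q - r ^+ 2) = 0 by ring: r2 q2.
by rewrite mulf_eq0 !subr_eq0 => /orP[] /eqP; [left | right].
Qed.

Lemma unity_root3_sqr (r : K) : r ^+ 2 = - r - 1 -> r != r ^+ 2.
Proof.
move=> r2; apply: contraNneq three_neq0 => e.
have e1 : r = 1 by rewrite -(cube_omega r2) exprS -e -expr2.
by rewrite -(subrr (r ^+ 2)) {2}r2 e1; apply/eqP; ring.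
Qed.

Definition parallel (u v : vec K) := exists2 c, c != 0 & u = scale c v.

Lemma parallel_sym u v : parallel u v -> parallel v u.
Proof.
by case=> c c0 ->; exists c^-1; rewrite ?invr_neq0 //; apply: vecP; rewrite /= mulKf.
Qed.

Lemma parallel_trans u v w : parallel u v -> parallel v w -> parallel u w.
Proof.
case=> c c0 -> [d d0 ->]; exists (c * d); rewrite ?mulf_neq0 //.
by apply: vecP; rewrite /= mulrA.
Qed.

Lemma block01 (t : 'Z_3) : (t, 0) != (t, 1) :> 'Z_3 * 'Z_3.
Proof. by rewrite xpair_eqE negb_and orbT. Qed.

Variable P : 'I_3 -> 'Z_3 * 'Z_3 -> vec K.
Hypothesis netP : symnet P.
Hypothesis block_sum :
  forall i t, P i (t, 2) = lc2 (- 1) (P i (t, 0)) (- 1) (P i (t, 1)).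

(* When [r] is a primitive cube root of unity, this is a fixed point of the
   projectivity of the line that permutes the three points of the block
   cyclically. *)
Definition special i t r := lc2 1 (P i (t, 0)) (- r) (P i (t, 1)).

Lemma special_inj i t r q : parallel (special i t r) (special i t q) -> r = q.
Proof.
case=> c _ e; apply/eqP; rewrite -subr_eq0; apply: contraT => n.
have i1 : i != i + 1 by case: i {e} => [[|[|[|]]]].
have /eqP[] := net_gen netP i1 0 (block01 t).
apply: (mulfI n).
transitivity (det3 (special i t r) (special i t q) (P (i + 1) 0)).
  by rewrite /special /det3 /=; ring.
by rewrite e det3_scale det3_uu !mulr0.
Qed.

(** Projection from a point of block [(k, u)] carries one block line to the other and fixes their
    intersection. Composing the projections from two such points gives the projectivity of order 3,
    so the intersection is a special point of both lines. *)
Lemma special_meet (i j k : 'I_3) (s t u : 'Z_3) :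
  i != j -> i != k -> j != k -> s + t + u = 0 ->
  exists r, r ^+ 2 = - r - 1 /\ parallel (special i s r) (special j t (r ^+ 2)).
Proof.
move=> ij ik jk stu.
have D : det3 (P i (s, 0)) (P i (s, 1)) (P j (t, 0)) != 0.
  exact: (net_gen netP ij _ (block01 s)).
have Ec l : det3 (P k (u, l)) (P i (s, 0)) (P i (s, 1)) != 0.
  by rewrite det3_rot; apply: (net_gen netP ik _ (block01 s)).
have col m h l : m + h + l = 0 -> det3 (P k (u, l)) (P i (s, m)) (P j (t, h)) = 0.
  by move=> e; rewrite det3_rot (det3_col netP ij ik jk) //; congr pair.
have z (m h l : 'Z_3) : val (m + h + l) = 0%N -> m + h + l = 0 :> 'Z_3.
  by move=> e; apply: val_inj.
have C0 := concurrent (Ec 0) (col 0 0 0 (z 0 0 0 erefl)) (col 1 2 0 (z 1 2 0 erefl))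
  (col 2 1 0 (z 2 1 0 erefl)).
have C2 := concurrent (Ec 2) (col 1 0 2 (z 1 0 2 erefl)) (col 0 1 2 (z 0 1 2 erefl))
  (col 2 2 2 (z 2 2 2 erefl)).
have B1 : exists p q r, P j (t, 1) = lc3 p (P i (s, 0)) q (P i (s, 1)) r (P j (t, 0)).
  by do 3 eexists; apply: (vec_basis (P j (t, 1)) D).
case: B1 => [p [q [r eb]]].
have D2 : det3 (P i (s, 0)) (P i (s, 1)) (P j (t, 0)) ^+ 2 != 0 by rewrite sqrf_eq0.
have e0 : q + r * q - p = 0.
  apply: (mulfI D2); rewrite mulr0 -C0 !block_sum eb /det3 /cross /=.
  by ring.
have e2 : r * p + q = 0.
  apply: (mulfI D2); rewrite mulr0 -C2 !block_sum eb /det3 /cross /=.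
  by ring.
have eq : q = - (r * p) by apply/eqP; rewrite -addr_eq0 addrC e2.
have p0 : p != 0.
  apply/eqP => p0; have ji : j != i by rewrite eq_sym.
  have /eqP[] := net_gen netP ji (s, 0) (block01 t).
  by rewrite eb eq p0 /det3 /=; ring.
have r2 : r ^+ 2 = - r - 1.
  apply/subr0_eq/(mulfI p0); rewrite mulr0 -[RHS]oppr0 -e0 eq; ring.
exists r; split=> //; exists (- r / p).
  by rewrite mulf_neq0 ?invr_neq0 // oppr_eq0 (omega_neq0 r2).
have rr : r * r ^+ 2 = 1 by rewrite -exprS (cube_omega r2).
apply: vecP; rewrite /special eb eq /=; field: rr => //.
Qed.

(** Each line has two special points; an inconsistent choice of cube roots at the three
    intersections would identify the two special points of one line. *)
Lemma special_triple s t u : s + t + u = 0 ->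
  exists r, [/\ r ^+ 2 = - r - 1, parallel (special 0 s r) (special 1 t (r ^+ 2)),
    parallel (special 1 t r) (special 2 u (r ^+ 2))
    & parallel (special 2 u r) (special 0 s (r ^+ 2))].
Proof.
move=> e.
have [r [r2 lm]] := special_meet (isT : 0 != 1 :> 'I_3) (isT : 0 != 2 :> 'I_3) isT e.
have e' : t + u + s = 0 by rewrite -e; ring.
have e'' : u + s + t = 0 by rewrite -e; ring.
have [q [q2 mn]] := special_meet (isT : 1 != 2 :> 'I_3) (isT : 1 != 0 :> 'I_3) isT e'.
have [p [p2 nl]] := special_meet (isT : 2 != 0 :> 'I_3) (isT : 2 != 1 :> 'I_3) isT e''.
have r4 : (r ^+ 2) ^+ 2 = r by ring: r2.
case: (unity_root3 r2 q2) => qE; rewrite qE ?r4 in mn.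
  case: (unity_root3 r2 p2) => pE; rewrite pE ?r4 in nl; first by exists r.
  case/eqP: (unity_root3_sqr r2).
  exact: special_inj (parallel_trans mn (parallel_trans nl lm)).
have ln := parallel_trans lm mn; case/eqP: (unity_root3_sqr r2).
case: (unity_root3 r2 p2) => pE; rewrite pE ?r4 in nl.
  exact: special_inj (parallel_trans ln nl).
exact/esym/(special_inj (parallel_trans nl ln)).
Qed.

Lemma block_collinear i t j : det3 (P i (t, 0)) (P i (t, 1)) (P i (t, j)) = 0.
Proof.
by case: (Z3_cases j) => ->; rewrite ?block_sum /det3 /=; ring.
Qed.

Lemma special_det i t r q w : det3 (special i t r) (special i t q) w =
  (r - q) * det3 (P i (t, 0)) (P i (t, 1)) w.
Proof. by rewrite /special /det3 /=; ring. Qed.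

Lemma same_line i s t r q : r != q ->
  parallel (special i s r) (special i t r) ->
  parallel (special i s q) (special i t q) ->
  forall j, det3 (P i (s, 0)) (P i (s, 1)) (P i (t, j)) = 0.
Proof.
rewrite -subr_eq0 => rq [c _ er] [c' _ eq] j; apply: (mulfI rq).
rewrite -special_det er eq det3_scale det3_rot det3_scale -det3_rot.
by rewrite special_det block_collinear !mulr0.
Qed.

(** Each of the triples [0, t, - t] is oriented by one of two primitive cube roots of unity, so two
    of the three triples have the same orientation. *)
Lemma collinear_cubic : exists F : {mpoly K[3]},
  [/\ F != 0, F \is 3.-homog & forall i g, mev F (P i g) = 0].
Proof.
have z t : 0 + t + - t = 0 :> 'Z_3 by ring.
suff two (s t : 'Z_3) r : s != t -> r ^+ 2 = - r - 1 ->
    parallel (special 0 0 r) (special 1 s (r ^+ 2)) ->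
    parallel (special 1 s r) (special 2 (- s) (r ^+ 2)) ->
    parallel (special 2 (- s) r) (special 0 0 (r ^+ 2)) ->
    parallel (special 0 0 r) (special 1 t (r ^+ 2)) ->
    parallel (special 1 t r) (special 2 (- t) (r ^+ 2)) ->
    parallel (special 2 (- t) r) (special 0 0 (r ^+ 2)) ->
    exists F : {mpoly K[3]},
      [/\ F != 0, F \is 3.-homog & forall i g, mev F (P i g) = 0].
  have [r [r2 lm0 mn0 nl0]] := special_triple (z 0).
  have [q [q2 lm1 mn1 nl1]] := special_triple (z 1).
  have [p [p2 lm2 mn2 nl2]] := special_triple (z 2).
  case: (unity_root3 r2 q2) => qE.
    by subst q; apply: (two 0 1 r).
  case: (unity_root3 r2 p2) => pE.
    by subst p; apply: (two 0 2 r).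
  by subst p q; apply: (two 1 2 (r ^+ 2)).
move=> st r2 lms mns nls lmt mnt nlt.
have r4 : (r ^+ 2) ^+ 2 = r by ring: r2.
have rn := unity_root3_sqr r2.
have e : (t - s) + s + - t = 0 by ring.
(* The triple [t - s, s, - t] compares the two given ones; the orientation [r ^+ 2] would identify
   the two special points of block 0 of the first component. *)
have [q [q2 _ mn _]] := special_triple e.
have {q q2} mn : parallel (special 1 s r) (special 2 (- t) (r ^+ 2)).
  case: (unity_root3 r2 q2) => qE; rewrite qE ?r4 // in mn.
  case/eqP: rn; apply: special_inj (parallel_trans lms (parallel_trans mn _)).
  exact: nlt.
pose line i u := line_form (P i (u, 0)) (P i (u, 1)).
have line_neq0 i u : line i u != 0.
  have ii : i != i + 1 by case: i => [[|[|[|]]]].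
  apply: contraNneq (net_gen netP ii 0 (block01 u)) => h.
  by rewrite -mev_line_form -/(line i u) h mev0.
exists (line 0 0 * line 1 s * line 2 (- s)); split.
- by rewrite !mulf_neq0.
- by apply: mul3_homog; apply: linear_form_homog.
(* The blocks belonging to [s] and [t] share both special points, hence their line, in the second
   and in the third component; three lines thus contain all five cosets. *)
have ms := same_line rn (parallel_trans mn (parallel_sym mnt))
  (parallel_trans (parallel_sym lms) lmt).
have ns := same_line rn (parallel_trans nls (parallel_sym nlt))
  (parallel_trans (parallel_sym mns) mn).
apply: (mev_two_blocks netP st) => [|j|j|j|j|j].
- by apply: mul3_homog; apply: linear_form_homog.
all: rewrite !mevM !mev_line_form.
- by rewrite block_collinear !mul0r.
- by rewrite block_collinear mulr0 mul0r.
- by rewrite block_collinear mulr0.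
- by rewrite ms mulr0 mul0r.
by rewrite ns mulr0.
Qed.

End CollinearBlocks.

(** * Both cases over an algebraically closed field *)

Section SymnetCubic.
Variable K : closedFieldType.
Hypotheses (two_neq0 : 2 != 0 :> K) (three_neq0 : 3 != 0 :> K).

Lemma closed_cube_root (c : K) : exists x, x ^+ 3 = c.
Proof.
have [x e] := solve_monicpoly (fun i => if i == 0%N then c else 0) (isT : 0 < 3)%N.
by exists x; rewrite e !big_ord_recl big_ord0 /=; ring.
Qed.

Lemma closed_unity_root3 : exists2 w : K, w ^+ 2 = - w - 1 & w != 1.
Proof.
have [x e] := solve_monicpoly (fun=> - 1 : K) (isT : 0 < 2)%N.
have x2 : x ^+ 2 = - x - 1 by rewrite e !big_ord_recl big_ord0 /=; ring.
exists x => //; apply: contraNneq three_neq0 => x1.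
by rewrite -(subrr (x ^+ 2)) {2}x2 x1; apply/eqP; ring.
Qed.

Lemma symnet33_cubic (P : 'I_3 -> 'Z_3 * 'Z_3 -> vec K) : symnet P ->
  exists F : {mpoly K[3]},
    [/\ F != 0, F \is 3.-homog & forall i g, mev F (P i g) = 0].
Proof.
move=> netP; have [w w2 w1] := closed_unity_root3.
case: (pickP [pred z : 'I_3 * 'Z_3 |
    det3 (P z.1 (z.2, 0)) (P z.1 (z.2, 1)) (P z.1 (z.2, 2)) != 0]) => [[i t] /= D|D].
  pose s (k : 'I_3) : 'Z_3 * 'Z_3 := [:: (t, 0); (- t, 0); 0]`_k.
  have s0 : s 0 + s 1 + s 2 = 0.
    by rewrite /s /= addr0 -[LHS]/(t - t, 0 + 0) subrr addr0.
  have net' := symnet_shift netP i s0.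
  have e m : P (0 + i) ((0, m) + s 0) = P i (t, m).
    by rewrite add0r -[(0, m) + _]/(0 + t, m + 0) add0r addr0.
  have [|F [F0 hF Fv]] := framed_cubic two_neq0 closed_cube_root net' _ w2 w1.
    by rewrite !e.
  exists F; split=> // k g; have := Fv (k - i) (g - s (k - i)).
  by rewrite !subrK.
(* Coefficients of the Cramer relation of the three points of a block with an outside point; as the
   block is collinear, its rescaled points sum to zero. *)
pose c (i : 'I_3) (x : 'Z_3 * 'Z_3) : K :=
  det3 (P i (x.1, x.2 + 1)) (P i (x.1, x.2 + 2)) (P (i + 1) 0).
have nc i x : c i x != 0.
  apply: (net_gen netP); first by case: i => [[|[|[|]]]].
  by rewrite xpair_eqE negb_and (inj_eq (addrI _)) orbT.
have net' := symnet_scale netP nc.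
have [i t|F [F0 hF Fv]] := collinear_cubic three_neq0 net'.
  have /negbT := D (i, t); rewrite /= negbK => /eqP h.
  have [e1 e2 e3 e4] : [/\ 1 + 1 = 2 :> 'Z_3, 1 + 2 = 0 :> 'Z_3,
     2 + 1 = 0 :> 'Z_3 & 2 + 2 = 1 :> 'Z_3] by split; apply: val_inj.
  rewrite /c /= !add0r e1 e2 e3 e4.
  move: h; move: (P i (t, 0)) (P i (t, 1)) (P i (t, 2)) (P (i + 1) 0) => x y z e h.
  by apply: vecP; apply/subr0_eq;
   [transitivity (det3 x y z * e.1.1)|transitivity (det3 x y z * e.1.2)
   |transitivity (det3 x y z * e.2)];
   first [by rewrite h mul0r | by rewrite /det3 /=; ring].
exists F; split=> // i g; apply: (mulfI (expf_neq0 3 (nc i g))).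
by rewrite -mev_scale // Fv mulr0.
Qed.

Lemma algebraic33 n (L : 'I_3 -> {fset point K}) (gT : finGroupType) (G : {group gT}) :
  dual_3net n L -> realizes L G -> G \isog [set: 'Z_3 * 'Z_3] -> algebraic L.
Proof.
move=> netL /realizes_labelling[lab labP] /(isog_symnet netL labP)[P [netP algP]].
by have [F [F0 hF Fv]] := symnet33_cubic netP; apply: (algP F).
Qed.

End SymnetCubic.

Local Close Scope ring_scope.

Theorem theorem1p1 (K : closedFieldType) (p : nat) (charK : has_char K p)
    (p_cond : p = 0 \/ 5 <= p) :
  (forall (n : nat) (L : 'I_3 -> {fset point K})
          (gT : finGroupType) (G : {group gT}),
     dual_3net n L -> realizes L G -> (0 < p -> n < p) ->
     G \isog [set: 'Z_3 * 'Z_3] \/ G \isog [set: 'Z_2 * 'Z_4] ->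
     algebraic L)
  /\
  (p = 0 ->
   forall (n : nat) (L : 'I_3 -> {fset point K}),
     dual_3net n L -> ~ realizes L ('Alt_('I_4))%G).
Proof.
have two_neq0 : (2 != 0 :> K)%R by apply: (small_prime_neq0 charK p_cond (q := 2)).
have three_neq0 : (3 != 0 :> K)%R by apply: (small_prime_neq0 charK p_cond (q := 3)).
split=> [n L gT G netL realL _ [GE | GE] | _ n L netL].
- exact: algebraic33 netL realL GE.
- exact: algebraic24 netL realL GE.
exact: alt4_not_realized two_neq0 netL.
Qed.
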